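(* Let $\mathbf{G}$ be one of the groups $\mathbf{G}(E)$ or $\mathbf{G}^\omega(E)$. Let $\mathbf{P},\mathbf{B}\subset\mathbf{G}$ be a splitting parabolic subgroup and a splitting Borel subgroup, both containing the splitting Cartan subgroup $\mathbf{H}$ of $\mathbf{G}$. (a) The following conditions are equivalent: (i) $\mathbf{B}$ is conjugate (under $\mathbf{G}$) to a subgroup of $\mathbf{P}$; (ii) at least one $\mathbf{B}$-orbit of $\mathbf{G}/\mathbf{P}$ is finite dimensional; (iii) one $\mathbf{B}$-orbit of $\mathbf{G}/\mathbf{P}$ is a single point (and this orbit is necessarily unique). (b) Let $\preceq_{\mathbf{B}}$ be the total order on the basis $E$ induced by $\mathbf{B}$. Assume that $\mathbf{P}\neq\mathbf{G}$. The following conditions are equivalent: (i) $\mathbf{B}$ is conjugate (under $\mathbf{G}$) to a subgroup of $\mathbf{P}$, and the ordered set $(E,\preceq_{\mathbf{B}})$ is isomorphic (as ordered set) to a subset of $(\mathbb{Z},\leq)$; (ii) every $\mathbf{B}$-orbit of $\mathbf{G}/\mathbf{P}$ is finite dimensional.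
   Context: $\mathbb{K}$ is an algebraically closed field of characteristic zero; $V$ is a $\mathbb{K}$-vector space of countably infinite dimension with basis $E$, and $E=\bigcup_{n\ge1}E_n$ is a filtration by finite subsets $E_n\subset E_{n+1}$. $\langle\cdot\rangle$ denotes linear span. $\mathbf{G}(E)$ is the group of linear automorphisms $g$ of $V$ with $g(e)=e$ for all but finitely many $e\in E$; it is the ind-group $\bigcup_nG_n$ with $G_n=GL(\langle E_n\rangle)$ (acting trivially on $E\setminus E_n$). When $\mathbf{G}^\omega(E)$ is considered, $V$ carries a nondegenerate symmetric or skew-symmetric bilinear form $\omega$, $E$ is $\omega$-isotropic (it has an involution $i_E$ with at most one fixed point such that $\omega(e,e')=0$ unless $e'=i_E(e)$), the $E_n$ are $i_E$-stable, and, by convention, if $\omega$ is symmetric then $i_E$ has exactly one fixed point, which lies in every $E_n$; $\mathbf{G}^\omega(E)$ is the subgroup of elements of $\mathbf{G}(E)$ preserving $\omega$, exhausted by $G_n=G^\omega(E_n)$, the subgroup of $GL(\langle E_n\rangle)$ preserving the restriction of $\omega$. An ind-variety is a union of a chain of inclusions of algebraic varieties $X_1\subset X_2\subset\cdots$, with a subset open (closed) iff its intersection with each $X_n$ is. $\mathbf{H}\subset\mathbf{G}$ is the subgroup of elements diagonal in $E$ (splitting Cartan subgroup). A splitting Borel subgroup containing $\mathbf{H}$ is a closed ind-subgroup containing $\mathbf{H}$ which is locally solvable (all algebraic subgroups solvable) and maximal with this property; a splitting parabolic subgroup is a closed ind-subgroup containing such a splitting Borel subgroup. The ind-variety structure of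 $\mathbf{G}/\mathbf{P}$ is $\bigcup_nG_n/(\mathbf{P}\cap G_n)$. The $\mathbf{B}$-orbits in $\mathbf{G}/\mathbf{P}$ are locally closed ind-subvarieties, each isomorphic to a finite-dimensional affine space or to $\mathbb{A}^\infty=\bigcup_n\mathbb{A}^n$; ''finite dimensional'' refers to this dichotomy. Splitting Borel subgroups $\mathbf{B}\supset\mathbf{H}$ correspond bijectively to total orders $\preceq_{\mathbf{B}}$ on $E$ (with the extra requirement that $i_E$ is order reversing if $\mathbf{G}=\mathbf{G}^\omega(E)$): $\mathbf{B}$ is the subgroup of all $g\in\mathbf{G}$ preserving each of the subspaces $\langle e'\in E:e'\prec_{\mathbf{B}}e\rangle$, $\langle e'\in E:e'\preceq_{\mathbf{B}}e\rangle$, $e\in E$. *)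

(* Defs.v *)
From HB Require Import structures.
From mathcomp Require Import all_boot all_order all_algebra.
From mathcomp Require Import boolp classical_sets functions cardinality.

Set Implicit Arguments.
Unset Strict Implicit.
Unset Printing Implicit Defensive.

Import GRing.Theory.

Local Open Scope classical_set_scope.
Local Open Scope ring_scope.

Section Varieties.
Variable K : fieldType.

Inductive generated_algebra (T : Type) (gens : set (T -> K)) : set (T -> K) :=
| GenConst c : generated_algebra gens (fun=> c)
| GenBase f : gens f -> generated_algebra gens f
| GenAdd f g : generated_algebra gens f -> generated_algebra gens g ->
    generated_algebra gens (fun x => f x + g x)
| GenMul f g : generated_algebra gens f -> generated_algebra gens g ->
    generated_algebra gens (fun x => f x * g x).

(* Varieties are encoded by their topology and sheaf of K-valued functions.
   The underlying set is [points], a subset of an ambient type T. The predicate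
   [regular U f] is meaningful only for U open, and depends only on f|_U. *)
Record space (T : Type) := Space {
  points : set T;
  opens : set (set T);
  regular : set T -> set (T -> K) }.

Definition closed_in (T : Type) (X : space T) : set (set T) :=
  [set A | A `<=` points X /\ opens X (points X `\` A)].

(* Zariski topology on D defined by the polynomials in the functions of [gens];
   regular functions are locally quotients of such polynomials. When [gens]
   restricts to finitely many coordinates embedding D as a locally closed subset
   of some K^N, this is the (reduced) variety D. *)
Definition zariski (T : Type) (D : set T) (gens : set (T -> K)) : space T :=
  let op := [set U : set T | exists2 S : set (T -> K),
      S `<=` generated_algebra gens &
      U = [set x | D x /\ exists2 p, S p & p x != 0]] in
  {| points := D;
     opens := op;
     regular := fun U => [set f : T -> K | forall x, U x ->
       exists W a b, [/\ op W, W x, W `<=` U,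
         generated_algebra gens a /\ generated_algebra gens b &
         forall y, W y -> b y != 0 /\ f y = a y / b y]] |}.

(* Induced structure on a locally closed subset. *)
Definition subspace (T : Type) (X : space T) (A : set T) : space T :=
  {| points := points X `&` A;
     opens := [set U `&` A | U in opens X];
     regular := fun U => [set f : T -> K | forall x, U x ->
       exists W h, [/\ opens X W, regular X W h, W x, W `&` A `<=` U &
         forall y, W y -> A y -> f y = h y]] |}.

(* Quotient by the equivalence relation pi x = pi y. In characteristic zero,
   for G an algebraic group, H a closed subgroup and pi : g |-> gH, this is the
   variety G/H: its regular functions are the H-invariant ones upstairs. *)
Definition quotient_space (T T' : Type) (X : space T) (pi : T -> T') :
    space T' :=
  {| points := pi @` points X;
     opens := [set U | U `<=` pi @` points X /\
                       opens X (pi @^-1` U `&` points X)];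
     regular := fun U => [set f : T' -> K |
       regular X (pi @^-1` U `&` points X) (f \o pi)] |}.

Definition affine_space (d : nat) : space 'rV[K]_d :=
  zariski setT [set f | exists i : 'I_d, f = fun x : 'rV[K]_d => x 0 i].

Definition morphism (T T' : Type) (X : space T) (Y : space T') (f : T -> T') :=
  [/\ forall x, points X x -> points Y (f x),
      forall U, opens Y U -> opens X (f @^-1` U `&` points X) &
      forall U h, opens Y U -> regular Y U h ->
        regular X (f @^-1` U `&` points X) (h \o f)].

(* An ind-variety is given by its exhausting chain of varieties. *)
Definition ind_space (T : Type) := nat -> space T.

Definition ind_points (T : Type) (X : ind_space T) : set T :=
  \bigcup_n points (X n).

Definition ind_morphism (T T' : Type) (X : ind_space T) (Y : ind_space T')
    (f : T -> T') :=
  forall n, exists m, morphism (X n) (Y m) f.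

Definition ind_isomorphic (T T' : Type) (X : ind_space T) (Y : ind_space T') :=
  exists f g, [/\ ind_morphism X Y f, ind_morphism Y X g,
    forall x, ind_points X x -> g (f x) = x &
    forall y, ind_points Y y -> f (g y) = y].

Definition finite_dimensional_affine (T : Type) (X : ind_space T) :=
  exists d : nat, ind_isomorphic X (fun=> affine_space d).

End Varieties.

Section TransformationGroups.
Variable T : Type.
Implicit Types A Q S : set (T -> T).

Definition inverse_of (g g' : T -> T) := cancel g g' /\ cancel g' g.

Definition is_group A :=
  [/\ A id,
      forall g h, A g -> A h -> A (g \o h) &
      forall g, A g -> exists2 g', A g' & inverse_of g g'].

Definition derived A : set (T -> T) :=
  [set x | forall S, is_group S ->
     (forall g h g' h', A g -> A h -> inverse_of g g' -> inverse_of h h' ->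
        S (g \o h \o g' \o h')) -> S x].

Definition solvable_group A := exists n, iter n derived A = [set id].

Definition conjugate_into G A Q :=
  exists g g', [/\ G g, inverse_of g g' & forall a, A a -> Q (g \o a \o g')].

Definition coset Q (g : T -> T) : set (T -> T) := [set g \o q | q in Q].

(* The B-orbits of G/P, as sets of left cosets gP. *)
Definition orbits_in_quotient G Q A : set (set (set (T -> T))) :=
  [set O | exists2 g, G g & O = [set coset Q (b \o g) | b in A]].

End TransformationGroups.

(* The basis is the family e, indexed by I: subsets of the basis are identified
   with sets of indices, and so are orders and involutions on it. *)
Section IndGroups.
Variables (K : closedFieldType) (V : lmodType K) (I : choiceType) (e : I -> V).

Definition span (A : set I) : set V :=
  [set v | exists (s : seq I) (c : I -> K),
     (forall i, i \in s -> A i) /\ v = \sum_(i <- s) c i *: e i].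

Definition is_basis :=
  (forall (s : seq I) (c : I -> K), uniq s ->
     \sum_(i <- s) c i *: e i = 0 -> forall i, i \in s -> c i = 0) /\
  span setT = setT.

Variable E : nat -> set I.

Definition is_filtration :=
  [/\ forall n, finite_set (E n),
      forall n, E n `<=` E n.+1 &
      \bigcup_n E n = setT].

Variant group_kind :=
| General
| Isometry of (V -> V -> K) & (I -> I).

Variable k : group_kind.

Definition admissible :=
  match k with
  | General => True
  | Isometry omega iE =>
      [/\ (forall u, scalar (omega u)) /\ (forall v, scalar (omega^~ v)),
          forall u, (forall v, omega u v = 0) -> u = 0,
          (forall u v, omega u v = omega v u) \/
          (forall u v, omega u v = - omega v u),
          [/\ involutive iE,
              forall i j, iE i = i -> iE j = j -> i = j &
              forall i j, j <> iE i -> omega (e i) (e j) = 0] &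
          (forall n i, E n i -> E n (iE i)) /\
          ((forall u v, omega u v = omega v u) ->
             exists2 i0, iE i0 = i0 & forall n, E n i0)]
  end.

Definition ambient_group : set (V -> V) :=
  [set g | [/\ linear g, bijective g, finite_set [set i | g (e i) <> e i] &
     match k with
     | General => True
     | Isometry omega _ => forall u v, omega (g u) (g v) = omega u v
     end]].

(* In the isometry case the E n are iE-stable, so that the span of E n is
   orthogonal to the remaining basis vectors: preserving omega amounts to
   preserving its restriction to this span. *)
Definition level n : set (V -> V) :=
  [set g | [/\ ambient_group g, g @` span (E n) = span (E n) &
     forall i, ~ E n i -> g (e i) = e i]].

(* On [level n] these restrict to linear combinations of the entries of the
   matrix of g in the basis E n, and of 1. *)
Definition matrix_coefficients : set ((V -> V) -> K) :=
  [set f | exists (phi : V -> K) (v : V), scalar phi /\ f = fun g => phi (g v)].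

Definition level_variety n : space K (V -> V) :=
  zariski (level n) matrix_coefficients.

Definition cartan : set (V -> V) :=
  [set h | ambient_group h /\ forall i, exists c, h (e i) = c *: e i].

Definition closed_ind_subgroup (Q : set (V -> V)) :=
  [/\ is_group Q, Q `<=` ambient_group &
      forall n, closed_in (level_variety n) (Q `&` level n)].

Definition locally_solvable (Q : set (V -> V)) :=
  forall n (A : set (V -> V)), is_group A -> A `<=` Q ->
    closed_in (level_variety n) A -> solvable_group A.

Definition compatible_order (le : rel I) :=
  [/\ reflexive le, antisymmetric le, transitive le, total le &
      match k with
      | General => True
      | Isometry _ iE => forall i j, le i j = le (iE j) (iE i)
      end].

Definition order_stabilizer (le : rel I) : set (V -> V) :=
  [set g | ambient_group g /\ forall i,
     g @` span [set j | le j i /\ j <> i] = span [set j | le j i /\ j <> i] /\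
     g @` span [set j | le j i] = span [set j | le j i]].

(* The last condition selects the groups attached to total orders. It holds for
   the maximal locally solvable subgroups in the classical sense, where Borel
   subgroups are connected (up to H, which contains -1 on the fixed vector of
   iE when omega is symmetric). Maximality among possibly disconnected groups
   does not imply it: the normalizer of the diagonal torus of GL_2 is a maximal
   solvable subgroup. Conversely, every order stabilizer satisfies the first
   four conditions. *)
Definition splitting_borel (B : set (V -> V)) :=
  [/\ closed_ind_subgroup B,
      cartan `<=` B,
      locally_solvable B,
      forall Q, closed_ind_subgroup Q -> locally_solvable Q -> B `<=` Q ->
        Q = B &
      exists2 le, compatible_order le & B = order_stabilizer le].

Definition splitting_parabolic (P : set (V -> V)) :=
  closed_ind_subgroup P /\ exists2 B, splitting_borel B & B `<=` P.

Definition homogeneous_space (P : set (V -> V)) : ind_space K (set (V -> V)) :=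
  fun n => quotient_space (level_variety n) (coset P).

(* Every B-orbit is isomorphic, as an ind-variety, either to some A^d or to
   A^infinity; this is the first case. *)
Definition finite_dimensional_orbit (P : set (V -> V))
    (O : set (set (V -> V))) :=
  finite_dimensional_affine (fun n => subspace (homogeneous_space P n) O).

End IndGroups.

Arguments General {K V I}.
Arguments Isometry {K V I} _ _.

(* Main.v *)
Require Import Defs.
From mathcomp Require Import all_boot all_order all_algebra.
From mathcomp Require Import boolp classical_sets functions cardinality.
From mathcomp Require Import ring.

(** Put [R i j] when [e i] occurs in the smallest [P]-stable coordinate subspace
    containing [e j]. Using the reflections in the rank one subgroups of [P], one
    sees that [R] is a total preorder and that [P] is its full stabilizer.

    The Bruhat decomposition reduces every [B]-orbit to the orbit of [nP] with
    [n] permuting the lines of [E] by [s]. Each of its points is [unP] for a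
    unique unipotent [u] supported on the inversions: the pairs [i < j] for [B]
    with [R (s^-1 i) (s^-1 j)] false. If there are finitely many inversions, the
    Cayley transform and ratios of minors identify the orbit with an affine
    space. If there are infinitely many, the one-parameter root subgroups give
    arbitrarily many independent tangent directions at [nP], which cannot live
    in a fixed [A^d]. So an orbit is finite dimensional iff it has finitely many
    inversions, and it is a point iff it has none, which means that [n]
    conjugates [B] into [P].

    Two orders on [E] that differ on finitely many pairs differ by a finitary
    permutation; hence finitely many inversions can be sorted away. This proves
    (a). For (b), start from a point orbit and compose [s] with a finitary
    permutation: if all intervals of [B] are finite there are finitely many
    inversions, while swapping [x] and [y], with [x] strictly below [y] for [R],
    inverts every [z] between them with [x] or with [y]. Finite intervals mean
    precisely that the countable order embeds in the integers. *)

Set Implicit Arguments.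
Unset Strict Implicit.
Unset Printing Implicit Defensive.

Import GRing.Theory.
Local Open Scope classical_set_scope.
Local Open Scope ring_scope.

(** * Linear maps and coordinates *)

(** Isometries are never decomposed directly. Column reduction is carried out for all finitary
    automorphisms; it works for any two total orders, without well-foundedness, because everything
    happens inside a finite support. Restricting the left factor to inversions makes the
    decomposition unique, and since passing to inverse adjoints permutes the decompositions,
    uniqueness forces the factors of an isometry to be isometries. The recurrent obstacle is a
    symmetric form: an index and its dual then carry no common root vector, so arguments with root
    vectors detour through the fixed index of the involution, an index that no permutation in the
    group moves. The Cayley transform is preferred to the exponential on whole cells because it is
    rational in both directions and turns the isometry condition into linear equations.
    Characteristic zero enters twice: 2 is invertible, and the natural numbers give infinitely many
    points at which to test a polynomial, which makes derivatives at 0 well defined. Dimension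
    theory is replaced by the rank of a Jacobian matrix. *)

Section LinearMaps.
Variables (K : fieldType) (V W : lmodType K).

Section Linear.
Variables (f : V -> W) (lf : linear f).
Lemma lin_addr : {morph f : u v / u + v}.
Proof. by move=> u v; rewrite -[u]scale1r lf !scale1r. Qed.
Lemma lin_zero : f 0 = 0.
Proof. by apply: (addrI (f 0)); rewrite -lin_addr !addr0. Qed.
Lemma lin_scale c : {morph f : u / c *: u}.
Proof. by move=> u; rewrite -[c *: u]addr0 lf lin_zero addr0. Qed.
Lemma lin_opp : {morph f : u / - u}.
Proof. by move=> u; rewrite -scaleN1r lin_scale scaleN1r. Qed.
Lemma lin_sub : {morph f : u v / u - v}.
Proof. by move=> u v; rewrite lin_addr lin_opp. Qed.
Lemma lin_sum (J : Type) (r : seq J) (P : pred J) (F : J -> V) :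
  f (\sum_(j <- r | P j) F j) = \sum_(j <- r | P j) f (F j).
Proof. exact: (big_morph f lin_addr lin_zero). Qed.
End Linear.

Section Scalar.
Variables (f : V -> K) (lf : scalar f).
Lemma scal_addr : {morph f : u v / u + v}.
Proof. by move=> u v; rewrite -[u]scale1r lf scale1r mul1r. Qed.
Lemma scal_zero : f 0 = 0.
Proof. by apply: (addrI (f 0)); rewrite -scal_addr !addr0. Qed.
Lemma scal_scale c : {morph f : u / c *: u >-> c * u}.
Proof. by move=> u; rewrite -[c *: u]addr0 lf scal_zero addr0. Qed.
Lemma scal_opp : {morph f : u / - u}.
Proof. by move=> u; rewrite -scaleN1r scal_scale mulN1r. Qed.
Lemma scal_sub : {morph f : u v / u - v}.
Proof. by move=> u v; rewrite scal_addr scal_opp. Qed.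
Lemma scal_sum (J : Type) (r : seq J) (P : pred J) (F : J -> V) :
  f (\sum_(j <- r | P j) F j) = \sum_(j <- r | P j) f (F j).
Proof. exact: (big_morph f scal_addr scal_zero). Qed.
End Scalar.

End LinearMaps.

Section LinearClosure.
Variables (K : fieldType) (V : lmodType K).
Implicit Types f g : V -> V.

Lemma linear_comp f g : linear f -> linear g -> linear (f \o g).
Proof. by move=> lf lg c u v /=; rewrite lg lf. Qed.

Lemma linear_inverse f g : linear f -> cancel f g -> cancel g f -> linear g.
Proof. by move=> lf fK gK c u v; apply: (can_inj fK); rewrite lf !gK. Qed.

Lemma linear_add f g : linear f -> linear g -> linear (fun v => f v + g v).
Proof. by move=> lf lg c u v; rewrite (lf c) (lg c) scalerDr addrACA. Qed.

Lemma linear_mulz f c : linear f -> linear (fun v => c *: f v).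
Proof. by move=> lf a u v; rewrite (lf a) scalerDr !scalerA mulrC. Qed.

Lemma linear_bigsum (J : Type) (r : seq J) (F : J -> V -> V) :
  (forall j, linear (F j)) -> linear (fun v => \sum_(j <- r) F j v).
Proof.
move=> lF c u v; rewrite scaler_sumr -big_split /=.
by apply: eq_bigr => j _; rewrite lF.
Qed.

Lemma linear_iter f n : linear f -> linear (iter n f).
Proof. by move=> lf; elim: n => [|n IH] c u v //=; rewrite IH lf. Qed.

Lemma scalar_comp (phi : V -> K) f : scalar phi -> linear f -> scalar (phi \o f).
Proof. by move=> lphi lf c u v /=; rewrite lf lphi. Qed.

(** Truncated geometric series: it inverts 1 - f on the vectors killed by the n-th iterate. Being a
    polynomial in f, it later keeps the parametrization of a cell polynomial. *)
Definition neumann n f : V -> V := fun v => \sum_(k < n) iter k f v.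

Lemma linear_neumann n f : linear f -> linear (neumann n f).
Proof. by move=> lf; apply: linear_bigsum => j; apply: linear_iter. Qed.

Lemma neumannK n f v : linear f -> iter n f v = 0 ->
  neumann n f v - f (neumann n f v) = v.
Proof.
move=> lf fn0; rewrite /neumann (lin_sum lf); case: n fn0 => [|n] fn0.
  by rewrite !big_ord0 subr0 -fn0.
rewrite big_ord_recl big_ord_recr /= -iterS fn0 addr0.
by rewrite -addrA -sumrB big1 ?addr0 // => i _; rewrite subrr.
Qed.

Lemma neumannVK n f v : linear f -> iter n f v = 0 ->
  neumann n f (v - f v) = v.
Proof.
move=> lf fn0; rewrite -[RHS](neumannK lf fn0).
rewrite (lin_sub (linear_neumann n lf)); congr (_ - _).
rewrite /neumann (lin_sum lf); apply: eq_bigr => i _.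
by rewrite -iterSr.
Qed.

End LinearClosure.

Section Coordinates.
Variables (K : closedFieldType) (V : lmodType K) (I : choiceType) (e : I -> V).

Definition coordinates (v : V) (f : I -> K) := exists s : seq I,
  [/\ uniq s, forall i, i \notin s -> f i = 0 & v = \sum_(i <- s) f i *: e i].

(** Classical choice with default 0 makes the coordinate a total function that carries no proof
    about [e]; by [coordP] the default is never taken when [e] is a basis. *)
Definition coord (i : I) (v : V) : K :=
  if pselect (exists f, coordinates v f) is left h then projT1 (cid h) i else 0.

Hypothesis hb : is_basis e.
Local Notation co := coord.

Lemma coordinates_ex v : exists f, coordinates v f.
Proof.
have : Defs.span e setT v by case: hb => _ ->.
case=> s [c [_ ->]].
exists (fun i => if i \in s then (count_mem i s)%:R * c i else 0), (undup s).
split; first exact: undup_uniq.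
  by move=> i; rewrite mem_undup => /negPf ->.
rewrite -big_undup_iterop_count /= [LHS]big_seq [RHS]big_seq.
apply: eq_bigr => i; rewrite mem_undup => -> .
rewrite -scalerA scaler_nat.
by elim: (count_mem i s) => //= -[//|m] /= ->; rewrite mulrS.
Qed.

Lemma coordinates_sum v f (s : seq I) : uniq s -> coordinates v f ->
  (forall i, f i != 0 -> i \in s) -> v = \sum_(i <- s) f i *: e i.
Proof.
move=> us [t [ut f0 ->]] sf.
rewrite [LHS](bigID (fun i => i \in s)) [RHS](bigID (fun i => i \in t)) /=.
rewrite [X in _ + X]big1 ?addr0; last first.
  by move=> i si; have [->|/sf] := eqVneq (f i) 0; [rewrite scale0r | rewrite (negPf si)].
rewrite [X in _ = _ + X]big1 ?addr0; last first.
  by move=> i ti; rewrite f0 // scale0r.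
rewrite -[LHS]big_filter -[RHS]big_filter; apply: perm_big.
apply: uniq_perm; rewrite ?filter_uniq // => i.
by rewrite !mem_filter andbC.
Qed.

Lemma coordP v : coordinates v (co^~ v).
Proof.
rewrite /coord; case: pselect => [h|nh]; last by case: nh; apply: coordinates_ex.
by case: (cid h).
Qed.

Lemma coordinates_uniq v f g : coordinates v f -> coordinates v g -> f = g.
Proof.
move=> hf hg; have [s [us f0 vf]] := hf; have [t [ut g0 vg]] := hg.
pose r := undup (s ++ t); have ur : uniq r by apply: undup_uniq.
have rf i : f i != 0 -> i \in r.
  by apply: contraNT; rewrite mem_undup mem_cat negb_or => /andP[/f0 ->].
have rg i : g i != 0 -> i \in r.
  by apply: contraNT; rewrite mem_undup mem_cat negb_or => /andP[_ /g0 ->].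
have : \sum_(i <- r) (f i - g i) *: e i = 0.
  have := coordinates_sum ur hf rf; rewrite {1}(coordinates_sum ur hg rg) => h.
  by under eq_bigr do rewrite scalerBl; rewrite sumrB -h subrr.
case: hb => free _ /(free r) fg; apply: funext => i.
case: (boolP (i \in r)) => [/(fg ur) /subr0_eq //|ni].
have := contra (rf i) ni; have := contra (rg i) ni.
by rewrite !negbK => /eqP -> /eqP ->.
Qed.

Lemma coordinates_coord v f : coordinates v f -> forall i, co i v = f i.
Proof. by move=> h i; rewrite -(coordinates_uniq (coordP v) h). Qed.

Lemma coord_fin v : exists2 s : seq I, uniq s & forall i, co i v != 0 -> i \in s.
Proof.
by have [s [us h _]] := coordP v; exists s => // i; apply: contraNT => /h ->.
Qed.

Lemma coord_sum (s : seq I) v : uniq s -> (forall i, co i v != 0 -> i \in s) ->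
  v = \sum_(i <- s) co i v *: e i.
Proof. by move=> us; apply: coordinates_sum us (coordP v). Qed.

Lemma coord_scalar i : scalar (co i).
Proof.
move=> c u v.
have [s us su] := coord_fin u; have [t ut tv] := coord_fin v.
pose r := undup (s ++ t).
apply: (@coordinates_coord _ (fun i => c * co i u + co i v)).
exists r; split; first exact: undup_uniq.
  move=> j; rewrite mem_undup mem_cat negb_or => /andP[js jt].
  have /eqP -> : co j u == 0 by apply: contraNT js; apply: su.
  have /eqP -> : co j v == 0 by apply: contraNT jt; apply: tv.
  by rewrite mulr0 addr0.
have eu : u = \sum_(i <- r) co i u *: e i.
  by apply: coord_sum => [|j /su]; rewrite ?undup_uniq // mem_undup mem_cat => ->.
have ev : v = \sum_(i <- r) co i v *: e i.
  by apply: coord_sum => [|j /tv]; rewrite ?undup_uniq // mem_undup mem_cat => ->;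
    rewrite orbT.
rewrite {1}eu {1}ev scaler_sumr -big_split; apply: eq_bigr => j _ /=.
by rewrite scalerA -scalerDl.
Qed.

Lemma coord_basis i j : co i (e j) = (i == j)%:R.
Proof.
apply: (@coordinates_coord _ (fun i => (i == j)%:R)); exists [:: j]; split=> //.
  by move=> k; rewrite inE => /negPf ->.
by rewrite big_seq1 eqxx scale1r.
Qed.

Lemma coord_ext u v : (forall i, co i u = co i v) -> u = v.
Proof.
move=> h; have [s us su] := coord_fin u.
by rewrite (coord_sum us su) [RHS](coord_sum us) => [|i]; [apply: eq_bigr => i _;
  rewrite h | rewrite -h; apply: su].
Qed.

End Coordinates.

Lemma leq_count_in (T : eqType) (P Q : pred T) (s : seq T) :
  {in s, forall x, P x -> Q x} -> (count P s <= count Q s)%N.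
Proof.
elim: s => //= x s IH h; apply: leq_add; last first.
  by apply: IH => y ys; apply: h; rewrite inE ys orbT.
by have := h x (mem_head _ _); case: (P x) => // ->.
Qed.

Lemma ltn_count_in (T : eqType) (P Q : pred T) (s : seq T) x :
  {in s, forall x, P x -> Q x} -> x \in s -> Q x -> ~~ P x ->
  (count P s < count Q s)%N.
Proof.
move=> h /path.splitPr; move: h => /[swap] -[s1 s2] h Qx nPx.
rewrite !count_cat /= Qx (negPf nPx) add0n add1n addnS ltnS.
by apply: leq_add; apply: leq_count_in => y ys; apply: h; rewrite mem_cat ?inE ys ?orbT.
Qed.

Section FinitaryMaps.
Variables (K : closedFieldType) (V : lmodType K) (I : choiceType) (e : I -> V).
Hypothesis hb : is_basis e.
Local Notation co := (coord e).
Implicit Types (A B : I -> Prop) (f g : V -> V).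

Lemma coord_lin i v w c : co i (c *: v + w) = c * co i v + co i w.
Proof. exact: (coord_scalar hb). Qed.
Lemma coordD i v w : co i (v + w) = co i v + co i w.
Proof. exact: (scal_addr (coord_scalar hb i)). Qed.
Lemma coordB i v w : co i (v - w) = co i v - co i w.
Proof. exact: (scal_sub (coord_scalar hb i)). Qed.
Lemma coordN i v : co i (- v) = - co i v.
Proof. exact: (scal_opp (coord_scalar hb i)). Qed.
Lemma coordZ i c v : co i (c *: v) = c * co i v.
Proof. exact: (scal_scale (coord_scalar hb i)). Qed.
Lemma coord0 i : co i 0 = 0.
Proof. exact: (scal_zero (coord_scalar hb i)). Qed.
Lemma coord_bigsum i (J : Type) (r : seq J) (P : pred J) (F : J -> V) :
  co i (\sum_(j <- r | P j) F j) = \sum_(j <- r | P j) co i (F j).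
Proof. exact: (scal_sum (coord_scalar hb i)). Qed.

Definition spans A v := forall i, co i v != 0 -> A i.

Lemma spans_basis A i : A i -> spans A (e i).
Proof.
by move=> Ai j; rewrite coord_basis //; case: (j =P i) => [-> //|_]; rewrite eqxx.
Qed.

Lemma spans_zero A : spans A 0.
Proof. by move=> i; rewrite coord0 eqxx. Qed.

Lemma spans_add A u v : spans A u -> spans A v -> spans A (u + v).
Proof.
move=> hu hv i; rewrite coordD => h; have [h0|] := eqVneq (co i u) 0.
  by apply: hv; move: h; rewrite h0 add0r.
exact: hu.
Qed.

Lemma spans_scale A c v : spans A v -> spans A (c *: v).
Proof. by move=> hv i; rewrite coordZ mulf_eq0 negb_or => /andP[_]; apply: hv. Qed.

Lemma spans_opp A v : spans A v -> spans A (- v).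
Proof. by move=> h; rewrite -scaleN1r; apply: spans_scale. Qed.

Lemma spans_sub A u v : spans A u -> spans A v -> spans A (u - v).
Proof. by move=> hu hv; apply: spans_add => //; apply: spans_opp. Qed.

Lemma spans_sum A (J : eqType) (r : seq J) (F : J -> V) :
  (forall j, j \in r -> spans A (F j)) -> spans A (\sum_(j <- r) F j).
Proof.
move=> h; rewrite big_seq; apply: (big_ind (spans A)) => //.
  exact: spans_zero.
exact: spans_add.
Qed.

Lemma spans_sub_set A B v : spans A v -> (forall i, A i -> B i) -> spans B v.
Proof. by move=> h AB i /h /AB. Qed.

Lemma span_spans A v : Defs.span e A v <-> spans A v.
Proof.
split=> [[s [c [sA ->]]]|h].
  by apply: spans_sum => i /sA Ai; apply: spans_scale; apply: spans_basis.
have [s us sv] := coord_fin hb v.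
exists [seq i <- s | co i v != 0], (co^~ v); split.
  by move=> i; rewrite mem_filter => /andP[/h].
rewrite [LHS](coord_sum hb us sv) big_filter [RHS]big_mkcond /=.
by apply: eq_bigr => i _; case: eqVneq => // ->; rewrite scale0r.
Qed.

Lemma spans_finite A v : spans A v -> exists s : seq I,
  [/\ uniq s, forall i, i \in s -> A i & forall i, co i v != 0 -> i \in s].
Proof.
move=> h; have [s us sv] := coord_fin hb v.
exists [seq i <- s | co i v != 0]; split; first exact: filter_uniq.
  by move=> i; rewrite mem_filter => /andP[/h].
by move=> i hi; rewrite mem_filter hi sv.
Qed.

Lemma spans_lin A B f v : linear f -> (forall i, A i -> spans B (f (e i))) ->
  spans A v -> spans B (f v).
Proof.
move=> lf fA /spans_finite[s [us sA sv]].
rewrite (coord_sum hb us sv) (lin_sum lf).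
by apply: spans_sum => i /sA /fA; rewrite (lin_scale lf); apply: spans_scale.
Qed.

Lemma linear_ext f g : linear f -> linear g ->
  (forall i, f (e i) = g (e i)) -> f = g.
Proof.
move=> lf lg h; apply: funext => v; have [s us sv] := coord_fin hb v.
rewrite (coord_sum hb us sv) (lin_sum lf) (lin_sum lg).
by apply: eq_bigr => i _; rewrite (lin_scale lf) (lin_scale lg) h.
Qed.

Lemma scalar_ext (f g : V -> K) : scalar f -> scalar g ->
  (forall i, f (e i) = g (e i)) -> f = g.
Proof.
move=> lf lg h; apply: funext => v; have [s us sv] := coord_fin hb v.
rewrite (coord_sum hb us sv) (scal_sum lf) (scal_sum lg).
by apply: eq_bigr => i _; rewrite (scal_scale lf) (scal_scale lg) h.
Qed.

Lemma basis_map (h : I -> V) : exists2 f, linear f & forall i, f (e i) = h i.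
Proof.
(* The sum does not depend on the list chosen to cover the support. The supports of u, v and c u + v
   can thus be replaced by one common list, over which linearity is termwise. *)
have key v (s t : seq I) : uniq s -> uniq t -> (forall i, co i v != 0 -> i \in s) ->
    (forall i, co i v != 0 -> i \in t) ->
    \sum_(i <- s) co i v *: h i = \sum_(i <- t) co i v *: h i.
  move=> us ut sv tv.
  rewrite [LHS](bigID (fun i => co i v != 0)) [RHS](bigID (fun i => co i v != 0)) /=.
  have z (r : seq I) : \sum_(i <- r | ~~ (co i v != 0)) co i v *: h i = 0.
    by rewrite big1 // => i; rewrite negbK => /eqP ->; rewrite scale0r.
  rewrite !z !addr0 -[LHS]big_filter -[RHS]big_filter; apply: perm_big.
  apply: uniq_perm; rewrite ?filter_uniq // => i; rewrite !mem_filter.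
  by case: (boolP (co i v != 0)) => //= hi; rewrite sv ?tv.
pose s v := s2val (cid2 (coord_fin hb v)).
have us v : uniq (s v) by rewrite /s; case: cid2.
have sv v i : co i v != 0 -> i \in s v by rewrite /s; case: cid2 => /= t _; apply.
exists (fun v => \sum_(i <- s v) co i v *: h i) => [c u v|i].
  pose r := undup (s u ++ s v ++ s (c *: u + v)).
  have ur : uniq r by apply: undup_uniq.
  rewrite (key u (s u) r) ?(key v (s v) r) ?(key _ (s (c *: u + v)) r) //;
    try by [move=> i /sv hi; rewrite mem_undup !mem_cat hi ?orbT | exact: sv].
  rewrite scaler_sumr -big_split; apply: eq_bigr => i _ /=.
  by rewrite coord_lin scalerDl scalerA.
rewrite (key _ _ [:: i]) ?big_seq1 ?coord_basis ?eqxx ?scale1r // => j; last first.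
  by rewrite inE coord_basis //; case: (j =P i) => // _; rewrite eqxx.
exact: sv.
Qed.

Lemma coord_image f i v (s : seq I) : linear f -> uniq s ->
  (forall j, co j v != 0 -> j \in s) ->
  co i (f v) = \sum_(j <- s) co j v * co i (f (e j)).
Proof.
move=> lf us sv; rewrite {1}(coord_sum hb us sv) (lin_sum lf) coord_bigsum.
by apply: eq_bigr => j _; rewrite (lin_scale lf) coordZ.
Qed.

Definition finmoved f := exists s : seq I, forall i, i \notin s -> f (e i) = e i.

Lemma finmovedP f : finite_set [set i | f (e i) <> e i] <-> finmoved f.
Proof.
split=> [/finite_seqP[s hs]|[s hs]].
  exists s => i; apply: contraNeq => /eqP h.
  by have : [set i | f (e i) <> e i] i by []; rewrite hs.
apply: (@sub_finite_set _ _ [set` s]); last exact: finite_seq.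
by move=> i /= h; apply: contrapT => /negP /hs.
Qed.

Definition finitary f := [/\ linear f, bijective f & finmoved f].

Lemma finmoved_comp f g : finmoved f -> finmoved g -> finmoved (f \o g).
Proof.
move=> [s hs] [t ht]; exists (s ++ t) => i; rewrite mem_cat negb_or => /andP[? ?].
by rewrite /= ht // hs.
Qed.

Lemma finitary_comp f g : finitary f -> finitary g -> finitary (f \o g).
Proof.
move=> [lf bf mf] [lg bg mg]; split; first exact: linear_comp.
- exact: bij_comp.
- exact: finmoved_comp.
Qed.

Lemma finitary_inverse f : finitary f ->
  exists g, [/\ finitary g, cancel f g & cancel g f].
Proof.
move=> [lf [g fK gK] [s hs]]; exists g; split=> //; split.
- exact: linear_inverse lf fK gK.
- by exists f.
- by exists s => i /hs h; rewrite -{1}h fK.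
Qed.

Lemma finitary_id : finitary id.
Proof. by split=> //; [exists id | exists [::]]. Qed.

(** Finite-dimensional linear algebra: in the basis listed by [B] the map is a square matrix with
    trivial kernel, hence invertible. *)
Let listed_onto g (B : seq I) : linear g -> injective g -> uniq B ->
  (forall i, i \in B -> spans (fun j => j \in B) (g (e i))) ->
  forall v, spans (fun j => j \in B) v ->
  exists2 w, spans (fun j => j \in B) w & g w = v.
Proof.
move=> lg ig uB gB v vB.
pose b (a : 'I_(size B)) := tnth (in_tuple B) a.
have bB a : b a \in B by apply: mem_tnth.
pose vec (r : 'rV[K]_(size B)) := \sum_a r 0 a *: e (b a).
have vecE w : spans (fun j => j \in B) w -> w = vec (\row_a co (b a) w).
  by move=> h; rewrite {1}(coord_sum hb uB h) big_tnth; apply: eq_bigr => a _; rewrite mxE.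
have bI : injective b by apply/injectiveP; rewrite /injectiveb /dinjectiveb map_inj_uniq
  ?enum_uniq //; apply/tuple_uniqP.
have vecI r : vec r = 0 -> r = 0.
  move=> h; apply/rowP => a; rewrite mxE.
  have : co (b a) (vec r) = 0 by rewrite h coord0.
  rewrite coord_bigsum (bigD1 a) //= coordZ coord_basis // eqxx mulr1 big1 ?addr0 // =>
    c ca.
  by rewrite coordZ coord_basis // (inj_eq bI) eq_sym (negPf ca) mulr0.
pose M : 'M[K]_(size B) := \matrix_(a, c) co (b c) (g (e (b a))).
have gvec r : g (vec r) = vec (r *m M).
  rewrite (lin_sum lg) /vec; under eq_bigr => a _.
    rewrite (lin_scale lg) (vecE _ (gB _ (bB a))) /vec scaler_sumr; over.
  rewrite exchange_big /=; apply: eq_bigr => c _; rewrite mxE scaler_suml.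
  by apply: eq_bigr => a _; rewrite !mxE scalerA.
have Mfree : row_free M.
  rewrite -kermx_eq0; apply/eqP/row_matrixP => i; rewrite row0.
  apply: vecI; apply: ig; rewrite gvec (lin_zero lg).
  have -> : row i (kermx M) *m M = 0 by rewrite -row_mul mulmx_ker row0.
  by rewrite /vec big1 // => a _; rewrite mxE scale0r.
have Mu : M \in unitmx by rewrite -row_free_unit.
exists (vec ((\row_a co (b a) v) *m invmx M)); last by rewrite gvec mulmxKV // -vecE.
by apply: spans_sum => a _; apply: spans_scale; apply: spans_basis.
Qed.

(** [A] may be infinite, but [g] moves finitely many basis vectors: the support of v, together with
    the part of [A] met by the moved vectors and their images, is a finite stable set to which
    [listed_onto] applies. *)
Lemma stable_onto g A : linear g -> injective g -> finmoved g ->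
  (forall i, A i -> spans A (g (e i))) ->
  forall v, spans A v -> exists2 w, spans A w & g w = v.
Proof.
move=> lg ig [s hs] gA v /spans_finite[t [ut tA tv]].
pose supp w := s2val (cid2 (coord_fin hb w)).
have suppP w i : co i w != 0 -> i \in supp w.
  by rewrite /supp; case: cid2 => /= x _; apply.
pose B := undup (t ++ [seq i <- s ++ flatten [seq supp (g (e i)) | i <- s] | `[<A i>]]).
have BA i : i \in B -> A i.
  by rewrite mem_undup mem_cat mem_filter => /orP[/tA//|/andP[/asboolP]].
have gB i : i \in B -> spans (fun j => j \in B) (g (e i)).
  move=> iB; have Ai := BA _ iB; case: (boolP (i \in s)) => is_; last first.
    by rewrite hs //; apply: spans_basis.
  move=> j hj; rewrite mem_undup mem_cat mem_filter mem_cat.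
  have Aj : A j := gA _ Ai _ hj.
  have -> : `[< A j >] by apply/asboolP.
  apply/orP; right; apply/orP; right; apply/flatten_mapP.
  by exists i => //; apply: suppP.
have [] := @listed_onto g B lg ig (undup_uniq _) gB v.
  by move=> i /tv it; rewrite mem_undup mem_cat it.
by move=> w wB <-; exists w => // i /wB /BA.
Qed.

Definition tri (r : I -> I -> Prop) g := forall j, spans (r^~ j) (g (e j)).

Lemma tri_spans (r : I -> I -> Prop) g j v : linear g ->
  (forall x y z, r x y -> r y z -> r x z) ->
  tri r g -> spans (r^~ j) v -> spans (r^~ j) (g v).
Proof.
move=> lg tr hg; apply: spans_lin => // i ij.
by apply: (spans_sub_set (hg i) _) => k ki; apply: tr ki ij.
Qed.

Lemma tri_comp (r : I -> I -> Prop) f g : linear f ->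
  (forall x y z, r x y -> r y z -> r x z) ->
  tri r f -> tri r g -> tri r (f \o g).
Proof. by move=> lf tr hf hg j; apply: (tri_spans lf tr hf (hg j)). Qed.

Lemma tri_inverse (r : I -> I -> Prop) f g : (forall x, r x x) ->
  (forall x y z, r x y -> r y z -> r x z) ->
  finitary f -> cancel f g -> cancel g f -> tri r f -> tri r g.
Proof.
move=> rr tr [lf _ mf] fK gK hf j.
have [||w wj hw] := @stable_onto f (r^~ j) lf (can_inj fK) mf _ (e j).
- by move=> i ij; apply: tri_spans => //; apply: spans_basis.
- exact: spans_basis.
- by rewrite -hw fK.
Qed.

(** The order may be dense, so height is measured inside [s] only: [y] strictly raises the number of
    elements of [s] strictly above an index, and this number is at most [size s]. *)
Lemma strict_nilpotent (le : rel I) (y : V -> V) (s : seq I) :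
  transitive le -> antisymmetric le ->
  linear y -> (forall i, i \notin s -> y (e i) = 0) ->
  tri (fun i j => le i j /\ i <> j) y -> forall v, iter (size s).+1 y v = 0.
Proof.
move=> tr an ly ys hy v.
pose rk i := count (fun t => le i t && (i != t)) s.
have step k u : spans (fun i => (k <= rk i)%N) u -> spans (fun i => (k < rk i)%N) (y u).
  apply: spans_lin => // j kj; have [js|js] := boolP (j \in s); last first.
    by rewrite ys //; apply: spans_zero.
  apply: (spans_sub_set (hy j) _) => i [ij nij]; apply: leq_ltn_trans kj _.
  apply: ltn_count_in (js) _ _ => [t _ /andP[jt njt]||].
  - rewrite (tr _ _ _ ij jt) /=; apply: contraNneq njt => it.
    by rewrite -it in jt; case: nij; apply: an; rewrite ij.
  - by rewrite ij; apply/eqP.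
  - by rewrite eqxx andbF.
have it k : spans (fun i => (k <= rk i)%N) (iter k y v).
  by elim: k => [|k IH] //=; apply: step.
apply: (coord_ext hb) => i; rewrite coord0.
have [->//|/it] := eqVneq (co i (iter (size s).+1 y v)) 0.
by rewrite ltnNge count_size.
Qed.

Lemma one_sub_bij (y : V -> V) n : linear y -> (forall v, iter n y v = 0) ->
  bijective (fun v => v - y v).
Proof.
move=> ly yn; exists (neumann n y) => v; first exact: neumannVK.
exact: neumannK.
Qed.

End FinitaryMaps.

(** * Bilinear forms and the ambient group *)

Section Forms.
Variables (K : closedFieldType) (V : lmodType K) (I : choiceType) (e : I -> V).
Hypothesis hb : is_basis e.
Local Notation co := (coord e).
Local Notation sp := (spans e).
Variables (E : nat -> set I) (k : group_kind V I).
Hypothesis adm : admissible e E k.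
Hypothesis two0 : 2%:R != 0 :> K.
Local Notation G := (ambient_group e k).

Definition preserving (g : V -> V) :=
  if k is Isometry om _ then forall u v, om (g u) (g v) = om u v else True.

(** The Lie algebra of the isometry group. *)
Definition skew (x : V -> V) :=
  if k is Isometry om _ then forall u v, om (x u) v + om u (x v) = 0 else True.

Definition respects_dual (s : I -> I) :=
  if k is Isometry _ iE then forall i, s (iE i) = iE (s i) else True.

Lemma ambientP g : G g <-> finitary e g /\ preserving g.
Proof.
rewrite /ambient_group /preserving /=; split.
  by case=> lg bg /(finmovedP e) mg; case: k => [|om iE] h.
by case=> [[lg bg /(finmovedP e) mg]]; case: k => [|om iE] h.
Qed.

Lemma preserving_comp f g : preserving f -> preserving g -> preserving (f \o g).
Proof. by rewrite /preserving; case: k => // om _ hf hg u v; rewrite /= hf hg. Qed.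

Lemma ambient_comp f g : G f -> G g -> G (f \o g).
Proof.
move=> /ambientP[ff pf] /ambientP[fg pg]; apply/ambientP; split.
  exact: finitary_comp.
exact: preserving_comp.
Qed.

Lemma ambient_inverse g : G g -> exists g', [/\ G g', cancel g g' & cancel g' g].
Proof.
move=> /ambientP[fg pg]; have [g' [fg' gK g'K]] := finitary_inverse fg.
exists g'; split=> //; apply/ambientP; split=> //; move: pg.
by rewrite /preserving; case: k => // om _ pg u v; rewrite -pg !g'K.
Qed.

Lemma ambient_cancel g g' : G g -> cancel g g' -> cancel g' g -> G g'.
Proof.
move=> Gg gK g'K; have [h [Gh hK hK']] := ambient_inverse Gg.
by have -> : g' = h by apply: funext => v; rewrite -[v in LHS]hK' gK.
Qed.

Lemma ambient_id : G id.
Proof.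
apply/ambientP; split; first exact: finitary_id.
by rewrite /preserving; case: k.
Qed.

Section Isometric.
Variables (om : V -> V -> K) (iE : I -> I).
Hypothesis kE : k = Isometry om iE.

Lemma form_linl v : scalar (om^~ v).
Proof. by move: adm; rewrite kE => -[[_ h] _ _ _ _]; apply: h. Qed.
Lemma form_linr v : scalar (om v).
Proof. by move: adm; rewrite kE => -[[h _] _ _ _ _]; apply: h. Qed.
Lemma dualK : involutive iE.
Proof. by move: adm; rewrite kE => -[_ _ _ [h _ _] _]. Qed.
Lemma dual_fix i j : iE i = i -> iE j = j -> i = j.
Proof. by move: adm; rewrite kE => -[_ _ _ [_ h _] _]; apply: h. Qed.
Lemma form_nondeg u : (forall v, om u v = 0) -> u = 0.
Proof. by move: adm; rewrite kE => -[_ h _ _ _]; apply: h. Qed.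
Lemma form_basis0 i j : j <> iE i -> om (e i) (e j) = 0.
Proof. by move: adm; rewrite kE => -[_ _ _ [_ _ h] _]; apply: h. Qed.
Lemma form_sign : exists2 s : K, s * s = 1 & forall u v, om v u = s * om u v.
Proof.
move: adm; rewrite kE => -[_ _ [h|h] _ _].
  by exists 1 => [|u v]; rewrite mul1r.
by exists (-1) => [|u v]; rewrite mulN1r ?opprK // h opprK.
Qed.

Lemma form_pair_neq0 i : om (e i) (e (iE i)) != 0.
Proof.
apply/eqP => h; have : e i = 0.
  apply: form_nondeg => v; rewrite (_ : om (e i) = fun=> 0) //.
  apply: (scalar_ext hb) => [|c u w|j]; first exact: form_linr.
    by rewrite mulr0 addr0.
  by case: (eqVneq j (iE i)) => [->//|/eqP]; apply: form_basis0.
move=> /(congr1 (co i)); rewrite coord_basis // coord0 // eqxx => /eqP.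
by rewrite oner_eq0.
Qed.

Lemma form_dual_neq0 i : om (e (iE i)) (e i) != 0.
Proof. by have := form_pair_neq0 (iE i); rewrite dualK. Qed.

(** Pairing with a dual basis vector extracts a single coordinate. This turns every later statement
    about the form into one about coordinates. *)
Lemma form_coordl i v : om v (e (iE i)) = co i v * om (e i) (e (iE i)).
Proof.
have : om^~ (e (iE i)) = (fun v => co i v * om (e i) (e (iE i))).
  apply: (scalar_ext hb) => [|c u w|j]; first exact: form_linl.
    by rewrite coord_lin // mulrDl mulrA.
  rewrite coord_basis //; case: (i =P j) => [->|h]; first by rewrite mul1r.
  by rewrite mul0r form_basis0 // => /(can_inj dualK).
by move=> /(congr1 (fun f => f v)).
Qed.

Lemma form_coordr i v : om (e (iE i)) v = co i v * om (e (iE i)) (e i).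
Proof.
have : om (e (iE i)) = (fun v => co i v * om (e (iE i)) (e i)).
  apply: (scalar_ext hb) => [|c u w|j]; first exact: form_linr.
    by rewrite coord_lin // mulrDl mulrA.
  rewrite coord_basis //; case: (i =P j) => [->|h]; first by rewrite mul1r.
  by rewrite mul0r form_basis0 // dualK => /esym.
by move=> /(congr1 (fun f => f v)).
Qed.

Lemma form_ext u v : (forall w, om w u = om w v) -> u = v.
Proof.
move=> h; apply: (coord_ext hb) => i; have := h (e (iE i));
  rewrite (form_coordr i u) (form_coordr i v).
exact: (mulIf (form_dual_neq0 i)).
Qed.

Lemma form_basis_ext (f g : V -> V) : linear f -> linear g ->
  (forall i j, om (f (e i)) (g (e j)) = om (e i) (e j)) ->
  forall u v, om (f u) (g v) = om u v.
Proof.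
move=> lf lg h u v.
have h1 i : om (f (e i)) \o g = om (e i).
  apply: (scalar_ext hb) => [||j]; last exact: h.
    by apply: scalar_comp => //; apply: form_linr.
  exact: form_linr.
have : om^~ (g v) \o f = om^~ v.
  apply: (scalar_ext hb) => [||i].
  - by apply: scalar_comp => //; apply: form_linl.
  - exact: form_linl.
  - exact: (congr1 (fun f => f v) (h1 i)).
by move=> /(congr1 (fun f => f u)).
Qed.

(** [h] is the inverse adjoint of [f]. Isometries are the fixed points of this automorphism of the
    finitary linear group. *)
Definition contragredient (f h : V -> V) := forall a b, om (f a) (h b) = om a b.

Lemma contragredient_ex f : finitary e f ->
  exists2 h, finitary e h & contragredient f h.
Proof.
have adj g : linear g -> finmoved e g ->
    exists g', [/\ linear g', finmoved e g' & forall a b, om (g a) b = om a (g' b)].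
  move=> lg [s0 hs0]; pose s := undup s0.
  have hs i : i \notin s -> g (e i) = e i by rewrite mem_undup; apply: hs0.
  have us : uniq s by apply: undup_uniq.
  (* The sum is the adjoint of g - 1 applied to [e j]. Only [e (iE i)] pairs nontrivially with
     [e i], which dictates its coefficient, and unmoved indices need no correction. *)
  have [g' lg' g'E] := basis_map hb (fun j => e j + \sum_(i <- s)
    (om (g (e i) - e i) (e j) / om (e i) (e (iE i))) *: e (iE i)).
  exists g'; split=> //.
    pose supp w := s2val (cid2 (coord_fin hb w)).
    have suppP w i : co i w != 0 -> i \in supp w.
      by rewrite /supp; case: cid2 => /= x _; apply.
    exists (flatten [seq map iE (supp (g (e i) - e i)) | i <- s]) => j hj.
    rewrite g'E big_seq big1 ?addr0 // => i is_.
    suff -> : om (g (e i) - e i) (e j) = 0 by rewrite mul0r scale0r.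
    rewrite -[j]dualK form_coordl; case: (eqVneq (co (iE j) (g (e i) - e i)) 0) => [->|h].
      by rewrite mul0r.
    case/flatten_mapP: hj; exists i => //; rewrite -[j]dualK; apply: map_f.
    exact: suppP.
  move=> a b.
  have hbas i j : om (g (e i)) (e j) = om (e i) (g' (e j)).
    rewrite g'E (scal_addr (form_linr _)) (scal_sum (form_linr _)).
    have hz t : om (e i) (e (iE t)) = (i == t)%:R * om (e i) (e (iE i)).
      by rewrite form_coordl coord_basis // eq_sym; case: eqP => [->|]; rewrite ?mul0r.
    under eq_bigr do rewrite (scal_scale (form_linr _)) hz.
    have [is_|nis] := boolP (i \in s); last first.
      rewrite hs // big1_seq ?addr0 // => t /andP[_ ts].
      by case: (i =P t) => [it|_]; [rewrite it ts in nis | rewrite mul0r mulr0].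
    rewrite (bigD1_seq i) //= eqxx mul1r divfK ?form_pair_neq0 // big1 ?addr0.
      by rewrite (scal_sub (form_linl _)) addrC subrK.
    by move=> t; rewrite eq_sym => /negPf ->; rewrite mul0r mulr0.
  have h1 i : om (g (e i)) = om (e i) \o g'.
    apply: (scalar_ext hb) => [||j]; last exact: hbas.
      exact: form_linr.
    by apply: scalar_comp => //; apply: form_linr.
  have : om^~ b \o g = om^~ (g' b).
    apply: (scalar_ext hb) => [||i].
    - by apply: scalar_comp => //; apply: form_linl.
    - exact: form_linl.
    - exact: (congr1 (fun f => f b) (h1 i)).
  by move=> /(congr1 (fun f => f a)).
move=> ff; have [f' [[lf' _ mf'] fK f'K]] := finitary_inverse ff.
have [lf _ mf] := ff.
have [h [lh mh hh]] := adj f' lf' mf'; have [h' [lh' mh' hh']] := adj f lf mf.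
exists h; last by move=> a b; rewrite -hh fK.
split=> //; exists h' => v; apply: form_ext => w.
  by rewrite -hh' -hh fK.
by rewrite -hh -hh' f'K.
Qed.

Lemma contragredient_uniq f h h' : bijective f ->
  contragredient f h -> contragredient f h' -> h = h'.
Proof.
move=> [f' _ f'K] ch ch'; apply: funext => v; apply: form_ext => w.
by rewrite -[w]f'K ch ch'.
Qed.

Lemma contragredient_comp f f' h h' :
  contragredient f h -> contragredient f' h' -> contragredient (f \o f') (h \o h').
Proof. by move=> c c' a b; rewrite /= c c'. Qed.

(** In matrix terms, the contragredient is the inverse transposed along the antidiagonal defined by
    [iE], up to nonzero scalars. *)
Lemma contragredient_coord f f' h i j : cancel f' f -> contragredient f h ->
  co i (h (e j)) * om (e (iE i)) (e i) =
  co (iE j) (f' (e (iE i))) * om (e (iE j)) (e j).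
Proof.
move=> f'K c; rewrite -form_coordr -[e (iE i) in LHS]f'K c.
by have := form_coordl (iE j) (f' (e (iE i))); rewrite dualK.
Qed.

Lemma contragredient_coord_neq0 f f' h i j : cancel f' f -> contragredient f h ->
  (co i (h (e j)) != 0) = (co (iE j) (f' (e (iE i))) != 0).
Proof.
move=> f'K c; have := contragredient_coord i j f'K c.
move=> /(congr1 (fun x => x != 0)).
by rewrite !mulf_eq0 !(negPf (form_dual_neq0 _)) !orbF.
Qed.

Lemma contragredient_coord_diag f f' h i : cancel f' f -> contragredient f h ->
  co i (h (e i)) = co (iE i) (f' (e (iE i))).
Proof.
move=> f'K c; have := contragredient_coord i i f'K c.
exact: (mulIf (form_dual_neq0 _)).
Qed.

End Isometric.

(** Here u = (1 + x)/(1 - x). Writing both arguments as values of 1 - x, the two sides differ only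
    in the sign of the cross terms, whose sum vanishes because x is skew. *)
Lemma cayley_preserving x u : linear x -> bijective (fun v => v - x v) ->
  (forall v, u (v - x v) = v + x v) -> skew x -> preserving u.
Proof.
move=> lx [y _ yK] ux; rewrite /skew /preserving.
case kE : k => [//|om iE] sk a b.
have [ll lr] := (form_linl kE, form_linr kE).
rewrite -[a]yK -[b]yK !ux.
rewrite !(scal_addr (ll _), scal_opp (ll _), scal_addr (lr _), scal_opp (lr _)).
by have /eqP := sk (y a) (y b); rewrite addr_eq0 => /eqP ->; ring.
Qed.

Lemma cayley_skew x u : linear u -> bijective (fun v => v + u v) ->
  (forall v, x (v + u v) = u v - v) -> preserving u -> skew x.
Proof.
move=> lu [y _ yK] ux; rewrite /skew /preserving.
case kE : k => [//|om iE] pr a b.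
have [ll lr] := (form_linl kE, form_linr kE).
rewrite -[a]yK -[b]yK !ux.
rewrite !(scal_addr (ll _), scal_opp (ll _), scal_addr (lr _), scal_opp (lr _)).
by rewrite pr; ring.
Qed.

(** Skewness moves exp x across the form as exp(-x). The quadratic term cannot be dropped: root
    vectors that involve the fixed index of [iE] have nonzero square. *)
Lemma exp2_preserving x : linear x -> (forall v, x (x (x v)) = 0) -> skew x ->
  preserving (fun v => v + x v + 2%:R^-1 *: x (x v)).
Proof.
move=> lx x3; rewrite /skew /preserving.
case kE : k => [//|om iE] sk a b.
have [ll lr] := (form_linl kE, form_linr kE).
have sk' u v : om (x u) v = - om u (x v) by apply/eqP; rewrite -addr_eq0 sk.
rewrite !(scal_addr (ll _), scal_addr (lr _), scal_scale (lr _), scal_scale (ll _)).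
rewrite !sk' !x3 (lin_zero lx) !(scal_zero (lr _)).
by field.
Qed.

End Forms.

(** * Levels of the ind-group *)

Section Levels.
Variables (K : closedFieldType) (V : lmodType K) (I : choiceType) (e : I -> V).
Hypothesis hb : is_basis e.
Local Notation co := (coord e).
Local Notation sp := (spans e).
Variables (E : nat -> set I) (k : group_kind V I).
Hypothesis hE : is_filtration E.
Local Notation G := (ambient_group e k).

(** By [stable_onto], a finitary automorphism mapping a coordinate subspace into itself maps it onto
    itself. Stabilizers are therefore described by inclusions alone. *)
Lemma stable_image g (A : set I) : finitary e g ->
  (forall i, A i -> sp A (g (e i))) -> g @` Defs.span e A = Defs.span e A.
Proof.
move=> [lg bg mg] h; apply/seteqP; split=> [_ [v /(span_spans hb) hv <-]|v /(span_spans
  hb) hv].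
  by apply/(span_spans hb); apply: (spans_lin hb lg h).
have [w wA gw] := stable_onto hb lg (bij_inj bg) mg h hv.
by exists w => //; apply/(span_spans hb).
Qed.

Lemma order_stabilizerP (le : rel I) g : reflexive le -> transitive le ->
  antisymmetric le ->
  order_stabilizer e k le g <-> G g /\ tri e le g.
Proof.
move=> rl tl al; split=> [[Gg h]|[Gg h]]; split=> // i.
  have [_ hi] := h i; have : (g @` Defs.span e [set j | le j i]) (g (e i)).
    by exists (e i) => //; apply/(span_spans hb); apply: spans_basis => //=; apply: rl.
  by rewrite hi => /(span_spans hb).
have fg : finitary e g by have [] := (ambientP e k g).1 Gg.
split; apply: stable_image => // j /=.
  move=> [ji nji]; apply: (spans_sub_set (h j) _) => t tj; split; first exact: tl tj ji.
  by move=> ti; apply: nji; apply: al; rewrite ji -ti tj.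
by move=> ji; apply: (spans_sub_set (h j) _) => t tj; apply: tl tj ji.
Qed.

Lemma filtration_le n m i : (n <= m)%N -> E n i -> E m i.
Proof.
case: hE => _ h _ /subnK <-; elim: (m - n)%N => //= d IH /IH.
by rewrite addSn; apply: h.
Qed.

Lemma filtration_seq (s : seq I) : exists n, forall i, i \in s -> E n i.
Proof.
elim: s => [|i s [n hn]]; first by exists 0%N.
have [m him] : exists m, E m i.
  have : (\bigcup_n E n) i by case: hE => _ _ ->.
  by case=> m _ ?; exists m.
exists (maxn m n) => j; rewrite inE => /orP[/eqP ->|/hn].
  exact: filtration_le (leq_maxl _ _) him.
exact: filtration_le (leq_maxr _ _).
Qed.

Lemma levelP n g : level e E k n g <->
  [/\ G g, forall i, ~ E n i -> g (e i) = e i & forall i, E n i -> sp (E n) (g (e i))].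
Proof.
split=> [[Gg h1 h2]|[Gg h1 h2]]; split=> //.
  move=> i hi; have : (g @` Defs.span e (E n)) (g (e i)).
    by exists (e i) => //; apply/(span_spans hb); apply: spans_basis.
  by rewrite h1 => /(span_spans hb).
by apply: stable_image => //; have [] := (ambientP e k g).1 Gg.
Qed.

Lemma level_le n m g : (n <= m)%N -> level e E k n g -> level e E k m g.
Proof.
move=> nm /levelP[Gg h1 h2]; apply/levelP; split=> // i hi.
  by apply: h1 => ni; apply: hi; apply: filtration_le ni.
case: (pselect (E n i)) => [/h2 h|/h1 ->]; last exact: spans_basis.
by apply: (spans_sub_set h _) => j; apply: filtration_le nm.
Qed.

Lemma level_ex g : G g -> exists n, level e E k n g.
Proof.
move=> Gg; have [[lg bg [s hs]] _] := (ambientP e k g).1 Gg.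
pose supp w := s2val (cid2 (coord_fin hb w)).
have suppP w i : co i w != 0 -> i \in supp w.
  by rewrite /supp; case: cid2 => /= x _; apply.
have [n hn] := filtration_seq (s ++ flatten [seq supp (g (e i)) | i <- s]).
exists n; apply/levelP; split=> // i hi.
  by apply: hs; apply/negP => is_; apply: hi; apply: hn; rewrite mem_cat is_.
have [is_|/hs ->] := boolP (i \in s); last exact: spans_basis.
move=> j hj; apply: hn; rewrite mem_cat; apply/orP; right.
by apply/flatten_mapP; exists i => //; apply: suppP.
Qed.

Lemma level_comp n f g : level e E k n f -> level e E k n g -> level e E k n (f \o g).
Proof.
move=> /levelP[Gf f1 f2] /levelP[Gg g1 g2]; apply/levelP; split.
- exact: ambient_comp.
- by move=> i hi /=; rewrite g1 ?f1.
- move=> i hi /=; have [[lf _ _] _] := (ambientP e k f).1 Gf.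
  by apply: (spans_lin hb lf f2); apply: g2.
Qed.

Lemma level_cancel n f g : level e E k n f -> cancel f g -> cancel g f -> level e E k n g.
Proof.
move=> [Gf f1 f2] fK gK; split.
- exact: ambient_cancel Gf fK gK.
- rewrite -{1}f1; apply/seteqP; split=> [_ [_ [v hv <-] <-]|v hv]; first by rewrite fK.
  by exists (f v); [exists v | rewrite fK].
- by move=> i /f2 h; rewrite -{1}h fK.
Qed.

End Levels.

Section Monomial.
Variables (K : closedFieldType) (V : lmodType K) (I : choiceType) (e : I -> V).
Hypothesis hb : is_basis e.

Definition monomial (n : V -> V) (s : I -> I) :=
  forall i, exists2 c : K, c != 0 & n (e i) = c *: e (s i).

Lemma monomial_comp n m s t : linear n -> monomial n s -> monomial m t ->
  monomial (n \o m) (s \o t).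
Proof.
move=> ln hn hm i; have [c c0 hc] := hm i; have [d d0 hd] := hn (t i).
by exists (c * d); rewrite ?mulf_neq0 //= hc (lin_scale ln) hd scalerA.
Qed.

Lemma monomial_inj n s : linear n -> injective n -> monomial n s -> injective s.
Proof.
move=> ln ni hn i j sij; have [c c0 hc] := hn i; have [d d0 hd] := hn j.
apply/eqP; apply: contraT => ij.
have : n (d *: e i) = n (c *: e j).
  by rewrite !(lin_scale ln) hc hd sij !scalerA mulrC.
move=> /ni /(congr1 (coord e i)); rewrite !coordZ // !coord_basis // eqxx (negPf ij).
by rewrite mulr1 mulr0 => /eqP; rewrite (negPf d0).
Qed.

Lemma monomial_inverse n n' s s' : linear n' -> cancel n n' -> monomial n s ->
  cancel s' s ->
  monomial n' s'.
Proof.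
move=> ln' nK hn s'K i; have [c c0 hc] := hn (s' i); exists c^-1.
  by rewrite invr_eq0.
rewrite -[e (s' i)]nK hc s'K (lin_scale ln') scalerA mulVf // scale1r //.
Qed.

End Monomial.

(** * Bruhat decomposition *)

Section Bruhat.
Variables (K : closedFieldType) (V : lmodType K) (I : choiceType) (e : I -> V).
Hypothesis hb : is_basis e.
Local Notation co := (coord e).
Local Notation sp := (spans e).
Implicit Types (r : I -> I -> Prop).

Definition strict (le : rel I) i j := le i j /\ i <> j.

(** For [s'] inverse to the permutation of n, these are the root positions of the intersection of U
    with n U' n^-1, where U is the unipotent group of [le] and U' is opposite to that of [le1]. *)
Definition inversion (le le1 : rel I) (s' : I -> I) i j :=
  [/\ le i j, i <> j & le1 (s' j) (s' i)].

Definition unitri r (u : V -> V) := forall j, sp (r^~ j) (u (e j) - e j).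

Definition total_order (le : rel I) :=
  [/\ reflexive le, antisymmetric le, transitive le & total le].

Lemma strict_trans le : total_order le ->
  forall i j l, strict le i j -> strict le j l -> strict le i l.
Proof.
move=> [_ al tl _] i j l [ij nij] [jl njl]; split; first exact: tl ij jl.
by move=> il; apply: nij; apply: al; rewrite ij il.
Qed.

Lemma inversion_trans le le1 s' : total_order le -> total_order le1 ->
  forall i j l, inversion le le1 s' i j -> inversion le le1 s' j l ->
  inversion le le1 s' i l.
Proof.
move=> tle [_ _ tl1 _] i j l [ij nij ji1] [jl njl lj1].
have [il nil] := strict_trans tle (conj ij nij) (conj jl njl).
by split=> //; apply: tl1 lj1 ji1.
Qed.

Lemma unitri_sub r r' u : (forall i j, r i j -> r' i j) -> unitri r u -> unitri r' u.
Proof. by move=> h hu j; apply: (spans_sub_set (hu j) _) => i; apply: h. Qed.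

Lemma unitri_tri r u : unitri r u -> tri e (fun i j => r i j \/ i = j) u.
Proof.
move=> hu j; rewrite -[u _](subrK (e j)); apply: spans_add => //.
  by apply: (spans_sub_set (hu j) _) => i; left.
by apply: spans_basis => //; right.
Qed.

Arguments unitri_tri [r u] _ j _ _.

Let refl_closure_trans r : (forall i j l, r i j -> r j l -> r i l) ->
  forall x y z, r x y \/ x = y -> r y z \/ y = z -> r x z \/ x = z.
Proof.
by move=> tr x y z [xy|->] // [yz|<-]; left => //; apply: tr xy yz.
Qed.

Lemma unitri_comp r u v : linear u -> (forall i j l, r i j -> r j l -> r i l) ->
  unitri r u -> unitri r v -> unitri r (u \o v).
Proof.
move=> lu tr hu hv j; rewrite /= (_ : _ - _ = u (v (e j) - e j) + (u (e j) - e j)).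
  apply: spans_add => //; apply: (spans_lin hb lu) (hv j) => i ij.
  by apply: (spans_sub_set (unitri_tri hu i) _) => t [ti|->//]; apply: tr ti ij.
by rewrite (lin_sub lu) addrA subrK.
Qed.

Lemma unitri_inverse r u u' : (forall i j l, r i j -> r j l -> r i l) ->
  finitary e u -> cancel u u' -> cancel u' u -> unitri r u -> unitri r u'.
Proof.
move=> tr fu uK u'K hu j; have [lu _ _] := fu.
have lu' : linear u' by apply: linear_inverse lu uK u'K.
have -> : u' (e j) - e j = - u' (u (e j) - e j).
  by rewrite (lin_sub lu') uK opprB.
have tu' := tri_inverse hb (fun x => or_intror (erefl x)) (refl_closure_trans tr)
  fu uK u'K (unitri_tri hu).
apply: spans_opp => //; apply: (spans_lin hb lu') (hu j) => i ij.
by apply: (spans_sub_set (tu' i) _) => t [ti|->//]; apply: tr ti ij.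
Qed.

(** Bijectivity comes for free: 1 - u is strictly triangular and kills all but finitely many basis
    vectors, so it is nilpotent. *)
Lemma unitri_finitary le r u : total_order le -> (forall i j, r i j -> strict le i j) ->
  linear u -> finmoved e u -> unitri r u -> finitary e u.
Proof.
move=> [rl al tl _] rle lu mu hu; split=> //.
have [s hs] := mu; pose y v := v - u v.
have ly : linear y.
  by move=> c v w; rewrite /y lu opprD addrACA scalerBr.
have ys i : i \notin s -> y (e i) = 0 by move=> /hs h; rewrite /y h subrr.
have hy : tri e (fun i j => le i j /\ i <> j) y.
  move=> j; rewrite /y -opprB; apply: spans_opp => //.
  by apply: (spans_sub_set (hu j) _) => i; apply: rle.
have := one_sub_bij ly (strict_nilpotent hb tl al ly ys hy).
by congr bijective; apply: funext => v; rewrite /y opprB addrC subrK.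
Qed.

Lemma finitary_support (g : V -> V) : finitary e g -> exists S : seq I,
  [/\ uniq S, forall i, i \notin S -> g (e i) = e i &
      forall i, i \in S -> sp (fun j => j \in S) (g (e i))].
Proof.
move=> [lg bg [s hs]].
pose supp w := s2val (cid2 (coord_fin hb w)).
have suppP w i : co i w != 0 -> i \in supp w.
  by rewrite /supp; case: cid2 => /= x _; apply.
exists (undup (s ++ flatten [seq supp (g (e i)) | i <- s])).
split; first exact: undup_uniq.
  by move=> i; rewrite mem_undup mem_cat negb_or => /andP[/hs].
move=> i iS; have [is_|/hs ->] := boolP (i \in s); last exact: spans_basis.
move=> j hj; rewrite mem_undup mem_cat; apply/orP; right.
by apply/flatten_mapP; exists i => //; apply: suppP.
Qed.

Lemma leading_ex (le : rel I) v : total_order le -> v != 0 ->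
  exists2 i, co i v != 0 & sp (le^~ i) v.
Proof.
move=> [rl al tl ttl] v0; have [s0 us sv] := coord_fin hb v.
have mx (s : seq I) : s = [::] \/ exists2 i, i \in s & forall j, j \in s -> le j i.
  elim: s => [|x s [->|[i is_ hi]]]; first by left.
    by right; exists x; rewrite ?inE // => j; rewrite inE => /eqP ->.
  right; have /orP[xi|ix] := ttl x i.
    by exists i; rewrite ?inE ?is_ ?orbT // => j; rewrite inE => /orP[/eqP ->//|/hi].
  exists x; rewrite ?inE ?eqxx // => j; rewrite inE => /orP[/eqP ->//|/hi ji].
  exact: tl ji ix.
case: (mx [seq i <- s0 | co i v != 0]) => [h|[i]].
  case/eqP: v0; apply: (coord_ext hb) => i; rewrite coord0 //; apply/eqP.
  apply: contraT => hi; have : i \in [seq i <- s0 | co i v != 0].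
    by rewrite mem_filter hi sv.
  by rewrite h.
rewrite mem_filter => /andP[hi _] him; exists i => // j hj.
by apply: him; rewrite mem_filter hj sv.
Qed.

Section Echelon.
Variables (le le1 : rel I) (g : V -> V).
Hypotheses (tle : total_order le) (tle1 : total_order le1).
Hypotheses (lg : linear g) (ig : injective g).
Let lt1 : rel I := fun i j => le1 i j && (i != j).

(** The pivots are cleared in increasing order of [l]. Subtracting a multiple of [z j] to clear
    pivot [s j] leaves the earlier pivots clear, since [g (z j)] vanishes there. *)
Let eliminate (l : seq I) (z : I -> V) (s : I -> I) (A : I -> Prop) :
  pairwise lt1 l ->
  (forall i, i \in l -> sp A (z i) /\ co (s i) (g (z i)) != 0) ->
  (forall i j, i \in l -> j \in l -> lt1 i j -> co (s i) (g (z j)) = 0) ->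
  forall z0, exists2 z1, sp A (z1 - z0) & forall i, i \in l -> co (s i) (g z1) = 0.
Proof.
move=> + + + z0; elim/last_ind: l => [|l j IH].
  by exists z0 => //; rewrite subrr; apply: spans_zero.
rewrite pairwise_rcons => /andP[/allP lj pl] h1 h2.
have sub i : i \in l -> i \in rcons l j by rewrite mem_rcons inE => ->; rewrite orbT.
have jj : j \in rcons l j by rewrite mem_rcons mem_head.
have [||z1 hz1 hz] := IH pl; first by move=> i /sub /h1.
  by move=> i i' /sub hi /sub hi'; apply: h2.
have [Aj cj] := h1 j jj.
exists (z1 - (co (s j) (g z1) / co (s j) (g (z j))) *: z j).
  by rewrite addrAC; apply: spans_sub => //; apply: spans_scale.
move=> i; rewrite mem_rcons inE (lin_sub lg) (lin_scale lg) coordB // coordZ //.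
have [->|ij] /= := eqVneq i j; first by rewrite divfK // subrr.
by move=> il; rewrite hz // (h2 i j (sub _ il) jj (lj _ il)) mulr0 subr0.
Qed.

(** Column reduction of [g]: [z j] is [e j] corrected by earlier vectors so that its image avoids
    all earlier pivots, and the new pivot [s j] is the [le]-largest coordinate of that image. *)
Lemma echelon (l : seq I) : pairwise lt1 l -> exists (z : I -> V) (s : I -> I),
  (forall i, i \in l -> [/\ co i (z i) = 1, sp (fun j => j \in l /\ le1 j i) (z i),
     co (s i) (g (z i)) != 0 & sp (le^~ (s i)) (g (z i))]) /\
  (forall i j, i \in l -> j \in l -> lt1 i j -> co (s i) (g (z j)) = 0).
Proof.
have [rl1 al1 tl1 _] := tle1.
elim/last_ind: l => [|l j IH]; first by exists (fun=> 0), id.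
rewrite pairwise_rcons => /andP[/allP lj pl].
have [z [s [h1 h2]]] := IH pl.
have nj : j \notin l by apply/negP => /lj; rewrite /lt1 eqxx andbF.
have [|//|z1 Az1 hz1] := @eliminate l z s (fun t => t \in l) pl _ _ (e j).
  move=> i il; have [_ zi ci _] := h1 i il; split=> //.
  by apply: (spans_sub_set zi _) => t [].
have cz1 : co j z1 = 1.
  have : co j (z1 - e j) = 0.
    by apply/eqP; apply: contraNT nj; apply: Az1.
  by rewrite coordB // coord_basis // eqxx => /subr0_eq.
have [|i ci hi] := leading_ex tle (v := g z1).
  apply/eqP => gz; have /ig z10 : g z1 = g 0 by rewrite gz (lin_zero lg).
  by move: cz1; rewrite z10 coord0 // => /esym/eqP; rewrite oner_eq0.
exists (fun t => if t == j then z1 else z t), (fun t => if t == j then i else s t).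
have neq t : t \in l -> t == j = false by move=> tl; apply: contraNF nj => /eqP <-.
split=> [t|t t'].
  rewrite mem_rcons inE; have [->|tj] /= := eqVneq t j => [_|tl].
    split=> //; rewrite -[z1](subrK (e j)); apply: spans_add => //.
      apply: (spans_sub_set Az1 _) => t' t'l; rewrite mem_rcons inE t'l orbT; split=> //.
      by have /andP[] := lj t' t'l.
    by apply: spans_basis => //; rewrite mem_rcons mem_head; split.
  have [? zt ? ?] := h1 t tl; split=> //.
  by apply: (spans_sub_set zt _) => t' [t'l t't]; rewrite mem_rcons inE t'l orbT.
rewrite !mem_rcons !inE; have [->|tj] /= := eqVneq t j; have [->|t'j] /= := eqVneq t' j.
- by rewrite /lt1 eqxx andbF.
- move=> _ /lj /andP[t'j' _] /andP[jt' _].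
  by case/eqP: t'j; apply: al1; rewrite t'j' jt'.
- by move=> tl _ _; apply: hz1.
- exact: h2.
Qed.

End Echelon.

(** An injective self-map of a finite list is onto; extended by the identity it is a finitary
    permutation, inverted by looking up positions. *)
Lemma seq_inverse (S : seq I) (s : I -> I) : uniq S -> {in S &, injective s} ->
  (forall i, i \in S -> s i \in S) ->
  exists s', [/\ cancel (fun i => if i \in S then s i else i) s',
     cancel s' (fun i => if i \in S then s i else i) &
     forall i, i \notin S -> s' i = i].
Proof.
move=> uS inj_s sS; pose f i := if i \in S then s i else i.
have fS i : (f i \in S) = (i \in S) by rewrite /f; case: ifP => // /sS ->.
have fI : injective f.
  move=> i j; case: (boolP (i \in S)) => iS; case: (boolP (j \in S)) => jS.
  - by rewrite /f iS jS; apply: inj_s.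
  - by move=> ij; move: jS; rewrite -fS -ij fS iS.
  - by move=> ij; move: iS; rewrite -fS ij fS jS.
  - by rewrite /f (negPf iS) (negPf jS).
have surj i : i \in S -> i \in map f S.
  have u : uniq (map f S) by rewrite map_inj_uniq.
  have sub : {subset map f S <= S} by move=> _ /mapP[j jS ->]; rewrite fS.
  have sz : (size S <= size (map f S))%N by rewrite size_map.
  by have [_ ->] := uniq_min_size u sub sz.
pose s' i := if i \in S then nth i S (index i (map f S)) else i.
have fs' : cancel s' f.
  move=> i; rewrite /s'; case: (boolP (i \in S)) => iS; last by rewrite /f (negPf iS).
  have h : (index i (map f S) < size S)%N by rewrite -(size_map f) index_mem surj.
  by rewrite -(nth_map i i f h) nth_index // surj.
exists s'; split=> //; last by move=> i /negPf h; rewrite /s' h.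
by move=> i; apply: fI; rewrite fs'.
Qed.

Definition bruhat_form (le le1 : rel I) g u n q (s s' : I -> I) :=
  [/\ [/\ finitary e u, finitary e n & finitary e q],
      [/\ cancel s s', cancel s' s & monomial e n s],
      unitri (inversion le le1 s') u, unitri (strict le1) q &
      g = u \o n \o q].

Lemma bruhat_exists le le1 g : total_order le -> total_order le1 -> finitary e g ->
  exists u n q s s', bruhat_form le le1 g u n q s s'.
Proof.
move=> tle tle1 fg; have [lg bg _] := fg.
have [S [uS gfix gS]] := finitary_support fg.
have [rl1 al1 tl1 ttl1] := tle1; have [rl al tl ttl] := tle.
pose l := sort le1 S.
have memlS i : (i \in l) = (i \in S) by rewrite mem_sort.
have [|z [s [h1 h2]]] := echelon tle tle1 lg (bij_inj bg) (l := l).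
  have -> : (fun i j => le1 i j && (i != j)) = [rel i j | le1 i j && (i != j)] by [].
  rewrite (pairwise_relI le1 [rel i j | i != j]) -uniq_pairwise sort_uniq uS andbT.
  by rewrite -(sorted_pairwise tl1) sort_sorted.
have zS i : i \in S -> sp (fun j => j \in S) (z i).
  by rewrite -memlS => /h1[_ h _ _]; apply: (spans_sub_set h _) => j []; rewrite memlS.
have gzS i : i \in S -> sp (fun j => j \in S) (g (z i)).
  by move=> /zS; apply: (spans_lin hb lg).
have sS i : i \in S -> s i \in S.
  by move=> iS; have := iS; rewrite -memlS => /h1[_ _ + _]; exact: gzS.
have sI : {in S &, injective s}.
  have aux i j : i \in S -> j \in S -> s i = s j -> le1 i j -> i = j.
    rewrite -!memlS => iS jS sij ij; apply/eqP; apply: contraT => nij.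
    have [_ _ + _] := h1 j jS; rewrite -sij (h2 i j) ?eqxx //.
    by rewrite ij nij.
  move=> i j iS jS sij; have /orP[/aux->//|/aux h] := ttl1 i j.
  by apply/esym/h.
have [s' [sK s'K s'fix]] := seq_inverse uS sI sS.
pose f i := if i \in S then s i else i.
have s'S i : (s' i \in S) = (i \in S).
  by rewrite -{2}[i]s'K; case: ifP => // /sS ->.
pose c i := if i \in S then co (s i) (g (z i)) else 1.
have c0 i : c i != 0.
  by rewrite /c; case: ifP => [|_]; [rewrite -memlS => /h1[] | rewrite oner_eq0].
(* The factors are read off the echelon form: q' takes [e i] to [z i], n takes [e i] to the pivot
   line with the pivot coefficient, and u takes [e (s i)] to [g (z i)] divided by that coefficient.
   Thus g q' = u n, and q inverts q'. *)
have [n ln nE] := basis_map hb (fun i => c i *: e (f i)).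
have [u lu uE] := basis_map hb (fun i => if i \in S then (c (s' i))^-1 *: g (z
  (s' i)) else e i).
have [q' lq' q'E] := basis_map hb (fun i => if i \in S then z i else e i).
have mon : monomial e n f by move=> i; exists (c i).
have [n' ln' n'E] := basis_map hb (fun i => (c (s' i))^-1 *: e (s' i)).
have fn : finitary e n.
  split=> //; last by exists S => i /negPf iS; rewrite nE /c /f iS scale1r.
  exists n' => v.
    suff : n' \o n = id by move=> /(congr1 (fun h => h v)).
    apply: (linear_ext hb) => [||i] //=; first exact: linear_comp.
    by rewrite nE (lin_scale ln') n'E sK scalerA divff // scale1r.
  suff : n \o n' = id by move=> /(congr1 (fun h => h v)).
  apply: (linear_ext hb) => [||i] //=; first exact: linear_comp.
  by rewrite n'E (lin_scale ln) nE scalerA mulVf // scale1r /f s'K.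
(* Column j of u is a normalized [g (z (s' j))]: it lies [le]-below its pivot j, and it vanishes at
   the pivots of all indices [le1]-before [s' j]. What survives off the diagonal are inversions. *)
have hu : unitri (inversion le le1 s') u.
  move=> j; rewrite uE; case: ifPn => [jS|_]; last by rewrite subrr; apply: spans_zero.
  have s'jS : s' j \in S by rewrite s'S.
  have fs'j : s (s' j) = j by have := s'K j; rewrite s'jS.
  have := s'jS; rewrite -memlS => /h1[_ _ p1 p2].
  rewrite fs'j in p1 p2.
  have cE : c (s' j) = co j (g (z (s' j))) by rewrite /c s'jS fs'j.
  move=> i; rewrite coordB // coordZ // coord_basis // => hi.
  have nij : i <> j.
    by move=> ij; move: hi; rewrite ij eqxx cE mulVf ?subrr ?eqxx.
  move: hi; rewrite (introF eqP nij) subr0 mulf_eq0 negb_or => /andP[_ hi].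
  split=> //; first exact: p2.
  have iS : i \in S := gzS _ s'jS _ hi.
  have s'iS : s' i \in S by rewrite s'S.
  have fs'i : s (s' i) = i by have := s'K i; rewrite s'iS.
  have /orP[//|h] := ttl1 (s' j) (s' i).
  move: hi; rewrite -{1}fs'i h2 ?memlS ?eqxx // h /=.
  by apply/eqP => /(can_inj s'K).
have fu : finitary e u.
  apply: (unitri_finitary tle _ lu _ hu) => [i j [ij nij _] //|].
  by exists S => i /negPf iS; rewrite uE iS.
have hq' : unitri (strict le1) q'.
  move=> j; rewrite q'E; case: ifPn => [jS|_]; last by rewrite subrr; apply: spans_zero.
  have := jS; rewrite -memlS => /h1[p1 p2 _ _] i; rewrite coordB // coord_basis // => hi.
  have nij : i <> j by move=> ij; move: hi; rewrite ij eqxx p1 subrr eqxx.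
  by move: hi; rewrite (introF eqP nij) subr0 => /p2[].
have fq' : finitary e q'.
  apply: (unitri_finitary tle1 _ lq' _ hq') => [i j //|].
  by exists S => i /negPf iS; rewrite q'E iS.
have [q [fq q'K qK]] := finitary_inverse fq'.
exists u, n, q, f, s'; split=> //.
  by apply: (unitri_inverse (strict_trans tle1) fq' q'K qK hq').
have -> : g = (g \o q') \o q by apply: funext => v /=; rewrite qK.
congr (_ \o _); apply: (linear_ext hb) => [||i]; try exact: linear_comp.
rewrite /= q'E nE (lin_scale lu) uE /f /c; case: ifPn => [iS|iS].
  rewrite sS // scalerA -{1}(sK i) iS.
  by rewrite -[s' (s i)](_ : i = _) ?iS ?divff ?scale1r //; [move: (c0 i);
    rewrite /c iS | have := sK i; rewrite iS].
by rewrite (negPf iS) scale1r gfix.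
Qed.

Lemma monomial_coord n s i : linear n -> injective s -> monomial e n s ->
  exists2 c : K, c != 0 & forall v, co (s i) (n v) = c * co i v.
Proof.
move=> ln si hn; have [c c0 hc] := hn i; exists c => // v.
suff : co (s i) \o n = (fun v => c * co i v) by move=> /(congr1 (fun h => h v)).
apply: (scalar_ext hb) => [|a x y|j] /=.
- exact: scalar_comp (coord_scalar hb _) ln.
- by rewrite coord_lin // mulrDr mulrCA.
have [d d0 hd] := hn j; rewrite hd coordZ // !coord_basis // (inj_eq si).
by case: (i =P j) => [ij|]; rewrite ?mulr0 // !mulr1; move: hc;
  rewrite ij hd => /(congr1 (co (s j))); rewrite !coordZ // coord_basis // eqxx !mulr1.
Qed.

(** Evaluate both sides at [e j] and read coordinate [s j]: on the right it is a diagonal entry of q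
    up to a unit, while the left side is supported below [s1 j]. Used in both directions, this shows
    that the permutations agree. *)
Lemma bruhat_perm_le (le : rel I) b n n1 q s s1 j : linear n -> linear b ->
  tri e le b -> injective s -> monomial e n s ->
  monomial e n1 s1 -> b \o n1 = n \o q -> co j (q (e j)) != 0 -> le (s j) (s1 j).
Proof.
move=> ln lb hbt si hn hn1 E cj; have [c c0 hc] := monomial_coord j ln si hn.
have [d d0 hd] := hn1 j.
apply: (hbt (s1 j)); have := congr1 (fun h => co (s j) (h (e j))) E.
rewrite /= hd (lin_scale lb) coordZ // hc => h.
have : c * co j (q (e j)) != 0 by rewrite mulf_neq0.
by rewrite -h mulf_eq0 negb_or => /andP[].
Qed.

Lemma unitri_diag r u j : (forall i, ~ r i i) -> unitri r u -> co j (u (e j)) = 1.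
Proof.
move=> ir hu; have [|/hu/ir//] := eqVneq (co j (u (e j) - e j)) 0.
by rewrite coordB // coord_basis // eqxx => /subr0_eq.
Qed.

Lemma unitri_off r u i j : unitri r u -> i <> j -> co i (u (e j)) != 0 -> r i j.
Proof.
by move=> hu nij h; apply: hu; rewrite coordB // coord_basis // (introF eqP nij) subr0.
Qed.

(** Put b = u^-1 u1 and Q = q q1^-1, so that b n1 = n Q. Comparing diagonals gives s = s1. An
    off-diagonal entry of Q at (i, j) needs i strictly before j for [le1], whereas the matching
    entry of b sits at an inversion and needs the opposite, so both are the identity. *)
Lemma bruhat_unique le le1 g u n q s s' u1 n1 q1 s1 s1' :
  total_order le -> total_order le1 ->
  bruhat_form le le1 g u n q s s' -> bruhat_form le le1 g u1 n1 q1 s1 s1' ->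
  [/\ s = s1, u = u1, n = n1 & q = q1].
Proof.
move=> tle tle1; have [rl al tl _] := tle; have [rl1 al1 tl1 _] := tle1.
have key g0 u0 n0 q0 s0 s0' u2 n2 q2 s2 s2' :
    bruhat_form le le1 g0 u0 n0 q0 s0 s0' -> bruhat_form le le1 g0 u2 n2 q2 s2 s2' ->
    exists b Q, [/\ b \o n2 = n0 \o Q, u0 \o b = u2, Q \o q2 = q0,
      unitri (strict le) b & unitri (strict le1) Q] /\ (s0' = s2' ->
      unitri (inversion le le1 s0') b) /\ (linear b /\ linear Q).
  move=> [[fu fn fq] [sK s'K hn] hu hq gE] [[fu1 fn1 fq1] [s1K s1'K hn1] hu1 hq1 gE1].
  have [u' [fu' uK u'K]] := finitary_inverse fu.
  have [q' [fq' qK q'K]] := finitary_inverse fq1.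
  have [[[[lu' _ _] [lq _ _]] [lu2 _ _]] [lq' _ _]] := (fu', fq, fu1, fq').
  exists (u' \o u2), (q0 \o q'); split; [split|split].
  - apply: funext => v /=; have := congr1 (fun h => h (q' v)) (etrans (esym gE) gE1).
    by rewrite /= q'K => <-; rewrite uK.
  - by apply: funext => v /=; rewrite u'K.
  - by apply: funext => v /=; rewrite qK.
  - apply: unitri_comp => //; first exact: strict_trans.
      apply: unitri_inverse fu uK u'K _; first exact: strict_trans.
      by apply: unitri_sub hu => i j [].
    by apply: unitri_sub hu1 => i j [].
  - apply: unitri_comp => //; first exact: strict_trans.
    by apply: unitri_inverse fq1 qK q'K _; first exact: strict_trans.
  - move=> ss; rewrite -ss in hu1; apply: unitri_comp => //; first exact: inversion_trans.
    by apply: unitri_inverse fu uK u'K _ => //; apply: inversion_trans.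
  - by split; apply: linear_comp.
have irr le' i : ~ strict le' i i by case.
have perm g0 u0 n0 q0 s0 s0' u2 n2 q2 s2 s2' j :
    bruhat_form le le1 g0 u0 n0 q0 s0 s0' -> bruhat_form le le1 g0 u2 n2 q2 s2 s2' ->
    le (s0 j) (s2 j).
  move=> h h'; have [b [Q [[E _ _ hB hQ] [_ [lB lQ]]]]] := key _ _ _ _ _ _ _ _ _ _ _ h h'.
  have [[_ [ln _ _] _] [/can_inj si _ hn] _ _ _] := h.
  have [_ [_ _ hn1] _ _ _] := h'.
  apply: (bruhat_perm_le ln lB _ si hn hn1 E).
    move=> i; apply: (spans_sub_set (unitri_tri hB i) _) => t [[]//|->]; exact: rl.
  by rewrite (unitri_diag (r := strict le1)) ?oner_eq0 //; apply: irr.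
move=> h h1.
have ss1 : s = s1.
  apply: funext => j; apply: al.
  by rewrite (perm _ _ _ _ _ _ _ _ _ _ _ j h h1) (perm _ _ _ _ _ _ _ _ _ _ _ j h1 h).
have [[_ [ln bn _] _] [sK s'K hn] _ _ _] := h.
have [[_ [ln1 bn1 _] _] [s1K s1'K hn1] _ _ _] := h1.
have ss1' : s' = s1'.
  by apply: funext => i; apply: (can_inj sK); rewrite s'K ss1 s1'K.
have [b [Q [[E1 E2 E3 _ hQ] [/(_ ss1') hB [lB lQ]]]]] := key _ _ _ _ _ _ _ _ _ _ _ h h1.
have off i j : i <> j -> co (s i) (b (e (s j))) = 0 /\ co i (Q (e j)) = 0.
  move=> nij; have [d d0 hd] := hn1 j; have [c c0 hc] :=
    monomial_coord i ln (can_inj sK) hn.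
  have := congr1 (fun h => co (s i) (h (e j))) E1.
  rewrite /= hd -ss1 (lin_scale lB) coordZ // hc => E0.
  case: (eqVneq (co i (Q (e j))) 0) => [z|nz].
    split=> //; apply/eqP; move/eqP: E0; rewrite z mulr0 mulf_eq0 (negPf d0).
    by [].
  have nz' : co (s i) (b (e (s j))) != 0.
    have : d * co (s i) (b (e (s j))) != 0 by rewrite E0 mulf_neq0.
    by rewrite mulf_eq0 negb_or => /andP[].
  have [ij _] := unitri_off hQ nij nz.
  have nsij : s i <> s j by move=> /(can_inj sK).
  have [_ _] := unitri_off hB nsij nz'; rewrite !sK => ji.
  by case: nij; apply: al1; rewrite ij ji.
have bid : b = id.
  apply: (linear_ext hb) => // j; rewrite -[j]s'K; apply: (coord_ext hb) => i.
  rewrite -[i]s'K coord_basis // (inj_eq (can_inj sK)).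
  case: (s' i =P s' j) => [->|/off[] //].
  by rewrite (unitri_diag (r := inversion le le1 s')) // => t [].
have Qid : Q = id.
  apply: (linear_ext hb) => // j; apply: (coord_ext hb) => i; rewrite coord_basis //.
  case: (i =P j) => [->|/off[] //].
  by rewrite (unitri_diag (r := strict le1)) // => t [].
by split; rewrite -?E2 -?E3 ?bid ?Qid //; move: E1; rewrite bid Qid.
Qed.

End Bruhat.

Arguments unitri_tri [K V I e] _ [r u] _ j _ _.

(** * Decomposition of isometries *)

Section IsometricBruhat.
Variables (K : closedFieldType) (V : lmodType K) (I : choiceType) (e : I -> V).
Hypothesis hb : is_basis e.
Local Notation co := (coord e).
Local Notation sp := (spans e).
Variables (E : nat -> set I) (k : group_kind V I).
Hypothesis adm : admissible e E k.
Local Notation G := (ambient_group e k).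

Lemma compatible_total le : compatible_order k le -> total_order le.
Proof. by case. Qed.

Lemma compatible_dual om iE le i j : k = Isometry om iE -> compatible_order k le ->
  le i j = le (iE j) (iE i).
Proof. by move=> -> [_ _ _ _]; apply. Qed.

Lemma monomial_respects_dual n s : preserving k n -> monomial e n s -> respects_dual k s.
Proof.
rewrite /preserving /respects_dual; case kE : k => [//|om iE] pn hn i.
have [c c0 hc] := hn i; have [d d0 hd] := hn (iE i).
have := pn (e i) (e (iE i)); rewrite hc hd.
rewrite (scal_scale (form_linl adm kE _)) (scal_scale (form_linr adm kE _)) => h.
apply: contrapT => ns; have := form_pair_neq0 hb adm kE i.
by rewrite -h (form_basis0 adm kE ns) !mulr0 eqxx.
Qed.

Lemma contragredient_unitri om iE r u u' h : k = Isometry om iE ->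
  (forall i, ~ r i i) -> cancel u u' -> cancel u' u -> unitri e r u' ->
    contragredient om u h ->
  unitri e (fun i j => r (iE j) (iE i)) h.
Proof.
move=> kE ir uK u'K hu c j i; rewrite coordB // coord_basis //.
case: (i =P j) => [->|nij].
  rewrite (contragredient_coord_diag hb adm kE _ u'K c) (unitri_diag hb _ ir hu).
  by rewrite subrr eqxx.
rewrite subr0 (contragredient_coord_neq0 hb adm kE _ _ u'K c) => h0.
by apply: (unitri_off hb hu _ h0) => /(can_inj (dualK adm kE)) /esym.
Qed.

(** Because [iE] reverses both orders, the contragredients of the three factors form another
    decomposition of the same isometry. By uniqueness each factor equals its own contragredient. *)
Lemma bruhat le le1 g : compatible_order k le -> compatible_order k le1 -> G g ->
  exists u n q s s', [/\ G u, G n & G q] /\ bruhat_form e le le1 g u n q s s'.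
Proof.
move=> cle cle1 /ambientP[fg pg].
have [tle tle1] := (compatible_total cle, compatible_total cle1).
have [u [n [q [s [s' h]]]]] := bruhat_exists hb tle tle1 fg.
exists u, n, q, s, s'; split=> //.
have [[fu fn fq] [sK s'K hn] hu hq gE] := h.
suff [pu pn pq] : [/\ preserving k u, preserving k n & preserving k q].
  by split; apply/ambientP.
rewrite /preserving; case kE : k => [//|om iE].
have [hu_ fhu cu] := contragredient_ex hb adm kE fu.
have [hn_ fhn cn] := contragredient_ex hb adm kE fn.
have [hq_ fhq cq] := contragredient_ex hb adm kE fq.
have [u' [fu' uK u'K]] := finitary_inverse fu.
have [n' [fn' nK n'K]] := finitary_inverse fn.
have [q' [fq' qK q'K]] := finitary_inverse fq.
have dK := dualK adm kE.
suff hh : bruhat_form e le le1 g hu_ hn_ hq_ (iE \o s \o iE) (iE \o s' \o iE).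
  have [_ eu en eq] := bruhat_unique hb tle tle1 h hh.
  by split; [rewrite -eu in cu | rewrite -en in cn | rewrite -eq in cq].
have irr (le' : rel I) i : ~ strict le' i i by case.
split=> //.
- split=> [i|i|i] /=; first by rewrite dK sK dK.
    by rewrite dK s'K dK.
  have [lhn _ _] := fhn; have [ln' _ _] := fn'.
  have := monomial_inverse ln' nK hn s'K => hn'.
  have cneq t : (co t (hn_ (e i)) != 0) = (t == iE (s (iE i))).
    rewrite (contragredient_coord_neq0 hb adm kE _ _ n'K cn).
    have [c c0 hc] := hn' (iE t); rewrite hc coordZ // coord_basis //.
    rewrite mulf_eq0 (negPf c0) /=.
    have -> : (iE i == s' (iE t)) = (t == iE (s (iE i))).
      apply/eqP/eqP => [->|->]; first by rewrite s'K dK.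
      by rewrite dK sK.
    by case: (t == _); rewrite ?oner_eq0 ?eqxx.
  exists (co (iE (s (iE i))) (hn_ (e i))); first by rewrite cneq.
  apply: (coord_ext hb) => t; rewrite coordZ // coord_basis //.
  case: (t =P _) => [->|/eqP]; first by rewrite mulr1.
  by rewrite -cneq negbK => /eqP ->; rewrite mulr0.
- have hu' := unitri_inverse hb (inversion_trans (s' := s') tle tle1) fu uK u'K hu.
  have irr' i : ~ inversion le le1 s' i i by case.
  have hc := contragredient_unitri kE irr' uK u'K hu' cu.
  apply: (unitri_sub _ hc) => i j [ij nij ji].
  split=> /=; first by rewrite (compatible_dual _ _ kE cle).
    by move=> ij'; apply: nij; rewrite ij'.
  by rewrite (compatible_dual _ _ kE cle1) !dK.
- have hq' := unitri_inverse hb (strict_trans tle1) fq qK q'K hq.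
  have hc := contragredient_unitri kE (irr le1) qK q'K hq' cq.
  apply: (unitri_sub _ hc) => i j [ij nij].
  by split; [rewrite (compatible_dual _ _ kE cle1) | move=> ij'; apply: nij; rewrite ij'].
have pg' : contragredient om g g by move: pg; rewrite /preserving kE.
apply: (contragredient_uniq hb adm kE _ pg'); first by have [] := fg.
by rewrite gE; do 2!apply: contragredient_comp => //.
Qed.

End IsometricBruhat.

(** * Root subgroups *)

Section Roots.
Variables (K : closedFieldType) (V : lmodType K) (I : choiceType) (e : I -> V).
Hypothesis hb : is_basis e.
Local Notation co := (coord e).
Local Notation sp := (spans e).
Variables (E : nat -> set I) (k : group_kind V I).
Hypothesis adm : admissible e E k.
Hypothesis two0 : 2%:R != 0 :> K.
Local Notation G := (ambient_group e k).

Definition nonfixed (i : I) := if k is Isometry _ iE then iE i <> i else True.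

(** The reflection of the Weyl group attached to the pair: commuting with the involution forces the
    dual indices to be exchanged too. *)
Definition swap (c d x : I) : I :=
  match k with
  | General => if x == c then d else if x == d then c else x
  | Isometry _ iE =>
      if x == c then d else if x == d then c
      else if x == iE c then iE d else if x == iE d then iE c else x
  end.

(** The elementary matrix at (c, d), minus its adjoint in the isometric case, which makes it
    skew. *)
Definition root_vector (c d : I) (v : V) : V :=
  match k with
  | General => co d v *: e c
  | Isometry om iE =>
      co d v *: e c - (om (e c) v / om (e d) (e (iE d))) *: e (iE d)
  end.

Definition expo (x : V -> V) (v : V) : V := v + x v + 2%:R^-1 *: x (x v).

(** Characterized by all compatible orders that put c below d, not by a formula: this covers pairs
    without a root vector, and it passes to conjugates by monomial elements by transporting the
    order. *)
Definition root_group (c d : I) (g : V -> V) :=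
  G g /\ forall le, compatible_order k le -> le c d -> tri e le g.

Lemma linear_root c d : linear (root_vector c d).
Proof.
move=> a u v; rewrite /root_vector; case kE : k => [|om iE].
  by rewrite coord_lin // scalerDl scalerA.
rewrite coord_lin // (form_linr adm kE) mulrDl !scalerDl -mulrA -!scalerA.
by rewrite scalerBr opprD addrACA.
Qed.

Lemma root_skew c d : skew k (root_vector c d).
Proof.
rewrite /skew /root_vector; case kE : k => [//|om iE] u v.
have [ll lr] := (form_linl adm kE, form_linr adm kE).
rewrite !(scal_sub (ll _), scal_sub (lr _), scal_scale (ll _), scal_scale (lr _)).
rewrite (form_coordl hb adm kE d u) (form_coordr hb adm kE d v).
have [s ss hs] := form_sign adm kE.
have := form_pair_neq0 hb adm kE d.
rewrite [om (e (iE d)) (e d)]hs [om (e c) u]hs => w0.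
set w := om (e d) (e (iE d)) in w0 *.
have -> : s * om u (e c) / w * (co d v * (s * w)) =
  (s * s) * (om u (e c) * co d v) by field.
have -> : om (e c) v / w * (co d u * w) = om (e c) v * co d u by field.
by rewrite ss; ring.
Qed.

Lemma root_basis c d j : root_vector c d (e j) =
  match k with
  | General => (d == j)%:R *: e c
  | Isometry om iE => (d == j)%:R *: e c -
      (if j == iE c then om (e c) (e (iE c)) / om (e d) (e (iE d)) else 0) *: e (iE d)
  end.
Proof.
rewrite /root_vector coord_basis //; case kE : k => [//|om iE].
case: (j =P iE c) => [->//|h]; rewrite (form_basis0 adm kE h).
by rewrite mul0r.
Qed.

Lemma root_support c d (r : I -> I -> Prop) : r c d ->
  (if k is Isometry _ iE then r (iE d) (iE c) else True) ->
  forall j, sp (r^~ j) (root_vector c d (e j)).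
Proof.
move=> rcd rdc j; rewrite root_basis; move: rdc; case kE : k => [|om iE] rdc.
  case: eqP => [<-|_]; rewrite ?scale1r ?scale0r; last exact: spans_zero.
  exact: spans_basis.
apply: spans_sub => //.
  case: eqP => [<-|_]; rewrite ?scale1r ?scale0r; last exact: spans_zero.
  exact: spans_basis.
case: eqP => [->|_]; rewrite ?scale0r; last exact: spans_zero.
by apply: spans_scale => //; apply: spans_basis.
Qed.

Lemma root_finite c d : exists s : seq I, forall i, i \notin s -> root_vector c d (e i) = 0.
Proof.
exists (d :: if k is Isometry _ iE then [:: iE c] else [::]) => i.
rewrite root_basis; case kE : k => [|om iE].
  by rewrite inE eq_sym => /negPf ->; rewrite scale0r.
by rewrite !inE negb_or eq_sym => /andP[/negPf -> /negPf ->]; rewrite !scale0r subrr.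
Qed.

(** A nonzero cube would need the images of both [e c] and [e (iE d)] to be nonzero, hence c and d
    both fixed by the involution, which has at most one fixed point. *)
Lemma root_cube c d v : c <> d -> root_vector c d (root_vector c d (root_vector c d v)) = 0.
Proof.
move=> ncd; have lr := linear_root c d.
have [h1 [h2 h3]] : exists t, root_vector c d (e c) =
  t *: (if k is Isometry om iE then e (iE d) else 0) /\
   (if k is Isometry om iE then forall i, iE i <> i ->
     i = c -> t = 0 else True).
  rewrite root_basis; case kE : k => [|om iE].
    by exists 0; rewrite eq_sym (introF eqP ncd) !scale0r.
  rewrite eq_sym (introF eqP ncd) scale0r sub0r -scaleNr.
  exists (- (if c == iE c then om (e c) (e (iE c)) / om (e d) (e (iE d)) else 0)).
  split=> // i ni ic; rewrite -ic; case: eqP => [h|]; rewrite ?oppr0 //.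
  by case: ni.
move: h2 h3; case kE : k => [|om iE] h2 h3.
  rewrite [root_vector c d v]/root_vector kE (lin_scale lr) h2 !scaler0.
  exact: lin_zero.
have [t' [h2' h3']] : exists t', root_vector c d (e (iE d)) = t' *: e c /\
    (iE d <> d -> t' = 0).
  rewrite root_basis kE.
  rewrite (inj_eq (can_inj (dualK adm kE))) eq_sym [d == c]eq_sym
    (introF eqP ncd) scale0r subr0.
  exists (iE d == d)%:R; split=> // h; by rewrite (introF eqP h).
rewrite {3}/root_vector kE (lin_sub lr) !(lin_scale lr) h2 h2'.
rewrite (lin_sub lr) !(lin_scale lr) h2 h2'.
have [tt'|] : t' = 0 \/ h1 = 0.
  case: (pselect (iE d = d)) => hd; last by left; apply: h3'.
  right; case: (pselect (iE c = c)) => hc; last by apply: (h3 c).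
  by case: ncd; apply: (dual_fix adm kE).
  by rewrite tt' !(scaler0, scale0r) subr0.
by move=> ->; rewrite !(scaler0, scale0r) subr0.
Qed.

Lemma expo_ambient x : linear x -> (forall v, x (x (x v)) = 0) -> skew k x ->
  (exists s : seq I, forall i, i \notin s -> x (e i) = 0) -> G (expo x).
Proof.
move=> lx x3 sx [s hs].
have le_ y : linear y -> linear (expo y).
  move=> ly; apply: linear_add; first exact: linear_add.
  by apply: linear_mulz; apply: (linear_comp ly ly).
apply/ambientP; split; last exact: (exp2_preserving adm two0).
split; first exact: le_.
- have lNx : linear (fun v => - x v) by move=> a u v; rewrite lx opprD scalerN.
  have key y z : linear y -> (forall v, z v = - y v) -> (forall v, y (y (y v)) = 0) ->
      cancel (expo y) (expo z).
    move=> ly hz y3 v; rewrite /expo !hz !(lin_addr ly, lin_opp ly, lin_scale ly, y3).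
    rewrite !(lin_zero ly, scaler0, addr0, opprK, oppr0).
    apply: (coord_ext hb) => i; rewrite !(coordD, coordZ, coordN) //; by field.
  exists (expo (fun v => - x v)); first exact: key.
  apply: (key (fun v => - x v)) => //= v; rewrite ?opprK //.
  by rewrite !(lin_opp lx) x3 !oppr0.
- exists s => i /hs h; rewrite /expo h (lin_zero lx) scaler0 !addr0 //.
Qed.

Lemma expo_tri x (r : I -> I -> Prop) : linear x -> (forall i, r i i) ->
  (forall i j l, r i j -> r j l -> r i l) ->
  (forall j, sp (r^~ j) (x (e j))) -> tri e r (expo x).
Proof.
move=> lx rr rt hx j; apply: spans_add => //; first apply: spans_add => //.
  by apply: spans_basis.
by apply: spans_scale => //; apply: (tri_spans hb lx rt hx).
Qed.

Definition rexp c d t := expo (fun v => t *: root_vector c d v).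

Lemma linear_rexp c d t : linear (rexp c d t).
Proof.
have lx : linear (fun v => t *: root_vector c d v) by apply/linear_mulz/linear_root.
apply: linear_add; first exact: linear_add.
by apply: linear_mulz; apply: (linear_comp lx lx).
Qed.

Lemma rexpE c d t v : rexp c d t v =
  v + t *: root_vector c d v + (t * t / 2%:R) *: root_vector c d (root_vector c d v).
Proof.
rewrite /rexp /expo (lin_scale (linear_root c d)) !scalerA.
by congr (_ + _ *: _); field.
Qed.

Lemma rexp_ambient c d t : c <> d -> G (rexp c d t).
Proof.
move=> ncd; have lr := linear_root c d; apply: expo_ambient.
- exact: linear_mulz.
- by move=> v; rewrite !(lin_scale lr) root_cube // !scaler0.
- have := root_skew c d; rewrite /skew; case kE : k => [//|om iE] h u v.
  rewrite (scal_scale (form_linl adm kE _)) (scal_scale (form_linr adm kE _)).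
  by rewrite -mulrDr h mulr0.
- by have [s hs] := root_finite c d; exists s => i /hs ->; rewrite scaler0.
Qed.

Lemma rexp_tri c d t (r : I -> I -> Prop) : (forall i, r i i) ->
  (forall i j l, r i j -> r j l -> r i l) -> r c d ->
  (if k is Isometry _ iE then r (iE d) (iE c) else True) -> tri e r (rexp c d t).
Proof.
move=> rr rt rcd rdc; apply: expo_tri => //; first exact/linear_mulz/linear_root.
by move=> j; apply: spans_scale => //; apply: root_support.
Qed.

Lemma rexp_root_group c d t : c <> d -> root_group c d (rexp c d t).
Proof.
move=> ncd; split; first exact: rexp_ambient.
move=> le cle cd; have [rl al tl _] := compatible_total cle.
apply: rexp_tri => // [i j l ij jl|]; first exact: tl ij jl.
by case kE : k => [//|om iE]; rewrite -(compatible_dual _ _ kE cle).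
Qed.

(* For a symmetric form, the elementary matrix sending a basis vector to its
   dual is self-adjoint, so this pair carries no root vector. *)
Lemma root_degenerate c d : co c (root_vector c d (e d)) = 0 -> c <> d ->
  exists om iE o, [/\ k = Isometry om iE, c = iE d,
    forall u v, om u v = om v u, iE o = o & nonfixed c].
Proof.
move=> + ncd; rewrite root_basis eqxx /nonfixed; case kE : k => [|om iE].
  by rewrite scale1r coord_basis // eqxx => /eqP; rewrite oner_eq0.
rewrite scale1r; have [cd|ncd'] := eqVneq d (iE c); last first.
  by rewrite scale0r subr0 coord_basis // eqxx => /eqP; rewrite oner_eq0.
have dK := dualK adm kE.
rewrite cd dK coordB // coordZ // coord_basis // eqxx mulr1 => h.
exists om, iE; have nf : iE c <> c by move=> h'; apply: ncd; rewrite cd h'.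
have symm : forall u v, om u v = om v u.
  move: adm; rewrite kE => -[_ _ [//|hs] _ _].
  move: h; rewrite (hs (e c)) mulNr divff; last by rewrite (form_dual_neq0 hb adm kE).
  by rewrite opprK => h; case/eqP: two0.
have [o oo _] : exists2 i0, iE i0 = i0 & forall n, E n i0.
  by move: adm; rewrite kE => -[_ _ _ _ [_]]; apply.
by exists o; split=> //; rewrite dK.
Qed.

(** An order-reversing involution puts its fixed index in the middle of the order. *)
Lemma fixed_between om iE le c o : k = Isometry om iE -> compatible_order k le ->
  iE o = o -> le c (iE c) -> le c o /\ le o (iE c).
Proof.
move=> kE cle oo cc; have [rl al tl ttl] := compatible_total cle.
have sym : le c o = le o (iE c) by rewrite (compatible_dual _ _ kE cle) oo.
rewrite -sym; suff : le c o by [].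
have /orP[//|oc] := ttl c o.
have : le (iE c) o by move: oc; rewrite (compatible_dual _ _ kE cle) oo.
by move=> co_; apply: tl cc co_.
Qed.

Let basis_monomial n s t : monomial e n s -> s =1 t -> monomial e n t.
Proof. by move=> hn st i; rewrite -st. Qed.

Ltac solve_vector :=
  apply: (coord_ext hb) => ?; rewrite /= ?mulr1n ?mulr0n !(coordD, coordZ, coordN) //=;
  rewrite ?mulr1n ?mulr0n; field; repeat (apply/andP; split); by [].

(* The triple is exp(x_cd) exp(- x_dc) exp(x_cd), up to scalars. If d = iE c and
   the form is symmetric then x_cd = 0, and one uses instead the root joining
   c to the fixed index o. *)
Lemma rank_one c d : c <> d -> nonfixed c -> nonfixed d ->
  exists X Y X', [/\ root_group c d X, root_group d c Y, root_group c d X' &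
    monomial e (X \o Y \o X') (swap c d)].
Proof.
move=> ncd nc nd; have ndc : d <> c by move=> h; apply: ncd.
have dcF : (d == c) = false by apply/eqP.
have cdF : (c == d) = false by apply/eqP.
have off X Y i : linear X -> X (e i) = e i -> Y (e i) = e i ->
    exists2 a : K, a != 0 & (X \o Y \o X) (e i) = a *: e i.
  by move=> lX hX hY; exists 1; rewrite ?oner_eq0 //= hX hY hX scale1r.
case kE : k => [|om iE].
  exists (rexp c d 1), (rexp d c (-1)), (rexp c d 1).
  split; try exact: rexp_root_group.
  have X i : rexp c d 1 (e i) = e i + (d == i)%:R *: e c.
    rewrite rexpE root_basis kE (lin_scale (linear_root _ _)) root_basis kE.
    by rewrite dcF !(scale0r, scaler0, addr0) scale1r.
  have Y i : rexp d c (-1) (e i) = e i - (c == i)%:R *: e d.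
    rewrite rexpE root_basis kE (lin_scale (linear_root _ _)) root_basis kE.
    by rewrite cdF !(scale0r, scaler0, addr0) scaleN1r.
  have lX := linear_rexp c d 1; have lY := linear_rexp d c (-1).
  move=> i; rewrite /swap kE; case: (i =P c) => [->|/eqP ic].
    exists (-1); rewrite ?oppr_eq0 ?oner_eq0 //=.
    rewrite X dcF scale0r addr0 Y eqxx.
    rewrite !(lin_sub lX, lin_addr lX, lin_scale lX, X) dcF eqxx.
    by solve_vector.
  case: (i =P d) => [->|/eqP id_].
    exists 1; rewrite ?oner_eq0 //=.
    rewrite X eqxx !(lin_addr lY, lin_scale lY, Y) eqxx cdF.
    rewrite !(lin_sub lX, lin_addr lX, lin_scale lX, X) dcF eqxx.
    by solve_vector.
  apply: off => //; first by rewrite X eq_sym (negPf id_) scale0r addr0.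
  by rewrite Y eq_sym (negPf ic) scale0r subr0.
have dK := dualK adm kE.
move: nc nd; rewrite /nonfixed kE => nc nd.
have wc0 := form_pair_neq0 hb adm kE c; have wd0 := form_pair_neq0 hb adm kE d.
have rE a b i : root_vector a b (e i) = (b == i)%:R *: e a -
    (if i == iE a then om (e a) (e (iE a)) / om (e b) (e (iE b)) else 0) *: e (iE b).
  by rewrite root_basis kE.
have iff a b : (iE a == b) = (a == iE b).
  by apply/eqP/eqP => [<-|->]; rewrite dK.
have ccF : (iE c == c) = false by apply/eqP.
have ddF : (iE d == d) = false by apply/eqP.
have ccF' : (c == iE c) = false by rewrite eq_sym.
have ddF' : (d == iE d) = false by rewrite eq_sym.
(* In the generic case c, d and their duals are four distinct indices and the root vectors have
   square zero. The ratio ka accounts for basis vectors whose pairings are not normalized. *)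
have [dc|ndc'] := eqVneq d (iE c); last first.
  have cdF2 : (c == iE d) = false by apply: contraNF ndc' => /eqP ->; rewrite dK.
  have dcF2 : (d == iE c) = false by apply/negbTE.
  have [ka ka0 [kaE kaV]] : exists2 ka, ka != 0 &
      om (e c) (e (iE c)) / om (e d) (e (iE d)) = ka /\
      om (e d) (e (iE d)) / om (e c) (e (iE c)) = ka^-1.
    exists (om (e c) (e (iE c)) / om (e d) (e (iE d)));
      first by rewrite mulf_neq0 ?invr_eq0.
    by rewrite invf_div.
  exists (rexp c d 1), (rexp d c (-1)), (rexp c d 1).
  split; try exact: rexp_root_group.
  have X i : rexp c d 1 (e i) = e i + (d == i)%:R *: e c -
      (if i == iE c then ka else 0) *: e (iE d).
    rewrite rexpE (_ : root_vector c d (root_vector c d (e i)) = 0) ?scaler0 ?addr0.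
      by rewrite rE scale1r addrA kaE.
    rewrite rE (lin_sub (linear_root c d)) !(lin_scale (linear_root c d)) !rE.
    rewrite dcF ccF' (inj_eq (can_inj dK)) dcF ddF'.
    by rewrite !(scale0r, scaler0, subr0).
  have Y i : rexp d c (-1) (e i) = e i - (c == i)%:R *: e d +
      (if i == iE d then ka^-1 else 0) *: e (iE c).
    rewrite rexpE (_ : root_vector d c (root_vector d c (e i)) = 0) ?scaler0 ?addr0.
      by rewrite rE scaleN1r opprB addrA addrAC kaV.
    rewrite rE (lin_sub (linear_root d c)) !(lin_scale (linear_root d c)) !rE.
    rewrite cdF ddF' (inj_eq (can_inj dK)) cdF ccF'.
    by rewrite !(scale0r, scaler0, subr0).
  have lX := linear_rexp c d 1; have lY := linear_rexp d c (-1).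
  have sF := (dcF, cdF, ccF', ddF', cdF2, dcF2, inj_eq (can_inj dK), iff, dK, eqxx).
  move=> i; rewrite /swap kE; case: (i =P c) => [->|/eqP ic].
    exists (-1); rewrite ?oppr_eq0 ?oner_eq0 //=.
    rewrite X !(lin_sub lY, lin_addr lY, lin_scale lY, Y) !sF.
    rewrite !(lin_sub lX, lin_addr lX, lin_scale lX, lin_opp lX, X) !sF.
    by solve_vector.
  case: (i =P d) => [->|/eqP id_].
    exists 1; rewrite ?oner_eq0 //=.
    rewrite X !(lin_sub lY, lin_addr lY, lin_scale lY, Y) !sF.
    rewrite !(lin_sub lX, lin_addr lX, lin_scale lX, lin_opp lX, X) !sF.
    by solve_vector.
  case: (i =P iE c) => [->|/eqP ic'].
    exists (- ka); rewrite ?oppr_eq0 //=.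
    rewrite X !(lin_sub lY, lin_addr lY, lin_scale lY, Y) !sF.
    rewrite !(lin_sub lX, lin_addr lX, lin_scale lX, lin_opp lX, X) !sF.
    by solve_vector.
  case: (i =P iE d) => [->|/eqP id'].
    exists (ka^-1); rewrite ?invr_eq0 //=.
    rewrite X !(lin_sub lY, lin_addr lY, lin_scale lY, Y) !sF.
    rewrite !(lin_sub lX, lin_addr lX, lin_scale lX, lin_opp lX, X) !sF.
    by solve_vector.
  apply: off => //.
    by rewrite X eq_sym (negPf id_) (negPf ic') !scale0r subr0 addr0.
  by rewrite Y eq_sym (negPf ic) (negPf id') !scale0r subr0 addr0.
have swE i : (if i == c then d else if i == d then c else i) = swap c d i.
  rewrite /swap kE; case: (i =P c) => // nic; case: (i =P d) => // nid.
  by rewrite -dc (introF eqP nid) dc dK (introF eqP nic).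
(* Now d is dual to c and both terms of the root vector occupy the same matrix entry: either they
   add up to a multiple a of an elementary matrix, which is scaled away, or they cancel. *)
have [deg|neq] := eqVneq (co c (root_vector c d (e d))) 0; last first.
  pose a := co c (root_vector c d (e d)).
  have rEc i : root_vector c d (e i) = ((d == i)%:R * a) *: e c.
    have -> : a = 1 - om (e c) (e (iE c)) / om (e d) (e (iE d)).
      rewrite /a rE eqxx {1}dc eqxx scale1r dc dK coordB // coordZ // coord_basis // eqxx
        mulr1.
      by rewrite -dc.
    rewrite rE dc dK [i == _]eq_sym; case: eqP => [_|_];
      last by rewrite !scale0r mul0r scale0r subr0.
    by rewrite mul1r scalerBl.
  have a0 : a != 0 by [].
  have cd : c = iE d by rewrite dc dK.
  have [b b0 rEd] : exists2 b, b != 0 & forall i, root_vector d c (e i) =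
    ((c == i)%:R * b) *: e d.
    exists (1 - om (e d) (e (iE d)) / om (e c) (e (iE c))).
      apply/eqP => h; move/eqP: a0; apply; rewrite /a rE eqxx {1}dc eqxx scale1r dc dK
        coordB // coordZ // coord_basis // eqxx mulr1.
      rewrite -dc.
      have -> : om (e c) (e d) / om (e d) (e c) = (om (e d) (e c) / om (e c) (e d))^-1.
        by rewrite invf_div.
      move: h; rewrite -dc -cd => /subr0_eq <-.
      by rewrite invr1 subrr.
    move=> i; rewrite rE -cd [i == _]eq_sym; case: eqP => [_|_];
      last by rewrite !scale0r mul0r scale0r subr0.
    by rewrite mul1r scalerBl !scale1r -dc.
  exists (rexp c d a^-1), (rexp d c (- b^-1)), (rexp c d a^-1).
  split; try exact: rexp_root_group.
  apply: (basis_monomial _ swE).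
  have X i : rexp c d a^-1 (e i) = e i + (d == i)%:R *: e c.
    rewrite rexpE rEc (lin_scale (linear_root _ _)) rEc.
    by rewrite dcF !(mul0r, scale0r, scaler0, addr0) scalerA mulrCA mulVf // mulr1.
  have Y i : rexp d c (- b^-1) (e i) = e i - (c == i)%:R *: e d.
    rewrite rexpE rEd (lin_scale (linear_root _ _)) rEd.
    by rewrite cdF !(mul0r, scale0r, scaler0, addr0) scalerA mulrCA mulNr mulVf // mulrN1
      scaleNr.
  have lX := linear_rexp c d a^-1; have lY := linear_rexp d c (- b^-1).
  move=> i; case: (i =P c) => [->|/eqP ic].
    exists (-1); rewrite ?oppr_eq0 ?oner_eq0 //=.
    rewrite X dcF scale0r addr0 Y eqxx.
    rewrite !(lin_sub lX, lin_addr lX, lin_scale lX, X) dcF eqxx.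
    by solve_vector.
  case: (i =P d) => [->|/eqP id_].
    exists 1; rewrite ?oner_eq0 //=.
    rewrite X eqxx !(lin_addr lY, lin_scale lY, Y) eqxx cdF.
    rewrite !(lin_sub lX, lin_addr lX, lin_scale lX, X) dcF eqxx.
    by solve_vector.
  apply: off => //; first by rewrite X eq_sym (negPf id_) scale0r addr0.
  by rewrite Y eq_sym (negPf ic) scale0r subr0.
have [om' [iE' [o [kE' _ symm oo _]]]] := root_degenerate deg ncd.
move: kE'; rewrite kE => -[omE iEE]; rewrite -{}omE in symm; rewrite -{}iEE in oo.
have nco : c <> o by move=> h; apply: nc; rewrite h.
have noc : o <> c by move=> h; apply: nco.
have ocF : (o == c) = false by apply/eqP.
have coF : (c == o) = false by apply/eqP.
have ocF' : (o == iE c) = false by rewrite -[o in LHS]oo (inj_eq (can_inj dK)).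
have coF' : (iE c == o) = false by rewrite eq_sym.
have w00 : om (e o) (e o) != 0 by have := form_pair_neq0 hb adm kE o; rewrite oo.
have [ka ka0 [kaE kaV]] : exists2 ka, ka != 0 &
    om (e c) (e (iE c)) / om (e o) (e o) = ka /\ om (e o) (e o) / om (e c) (e (iE c)) =
      ka^-1.
  exists (om (e c) (e (iE c)) / om (e o) (e o)); first by rewrite mulf_neq0 ?invr_eq0.
  by rewrite invf_div.
have rg1 t : root_group c d (rexp c o t).
  split; first exact: rexp_ambient.
  move=> le cle; have [rl al tl _] := compatible_total cle; rewrite dc => cd.
  have [h1 h2] := fixed_between kE cle oo cd.
  apply: rexp_tri => // [i j l ij jl|]; first exact: tl ij jl.
  by rewrite kE oo.
have rg2 t : root_group d c (rexp o c t).
  split; first exact: rexp_ambient.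
  move=> le cle; have [rl al tl _] := compatible_total cle; rewrite dc => cd.
  have cd' : le (iE c) (iE (iE c)) by rewrite dK.
  have [h1 h2] := fixed_between kE cle oo cd'.
  rewrite dK in h2.
  apply: rexp_tri => // [i j l ij jl|]; first exact: tl ij jl.
  by rewrite kE oo.
(* With x, y the root vectors of (c, o) and (o, c), the commutator [x, y] has eigenvalue 1 on [e c],
   where a coroot has eigenvalue 2 in this three-dimensional representation. So x and 2 y form the
   standard sl2 pair, whence the factor 2. *)
exists (rexp c o 1), (rexp o c (- 2%:R)), (rexp c o 1); split=> //.
apply: (basis_monomial _ swE).
have lX := linear_rexp c o 1; have lY := linear_rexp o c (- 2%:R).
have lx := linear_root c o; have ly := linear_root o c.
have sF := (ocF, coF, ccF', ccF, ocF', coF', dK, eqxx, inj_eq (can_inj dK), oo).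
have X i : rexp c o 1 (e i) = e i + (o == i)%:R *: e c -
    (if i == iE c then ka else 0) *: e o -
    (if i == iE c then ka / 2%:R else 0) *: e c.
  rewrite rexpE !rE (lin_sub lx) !(lin_scale lx) !rE !sF kaE.
  by case: (i == iE c); case: (o == i); solve_vector.
have Y i : rexp o c (- 2%:R) (e i) = e i - (2%:R * (c == i)%:R) *: e o
    + (if i == o then 2%:R * ka^-1 else 0) *: e (iE c)
    - (2%:R * ka^-1 * (c == i)%:R) *: e (iE c).
  rewrite rexpE !rE (lin_sub ly) !(lin_scale ly) !rE !sF kaV.
  by case: (i == o); case: (c == i); solve_vector.
move=> i; case: (i =P c) => [->|/eqP ic].
  exists (- (2%:R * ka^-1)); first by rewrite oppr_eq0 mulf_neq0 ?invr_eq0.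
  rewrite /= X !sF !(lin_sub lY, lin_addr lY, lin_scale lY, Y) !sF.
  rewrite !(lin_sub lX, lin_addr lX, lin_scale lX, lin_opp lX, X) !sF dc.
  by solve_vector.
case: (i =P d) => [->|/eqP id_].
  exists (- (ka / 2%:R)); first by rewrite oppr_eq0 mulf_neq0 ?invr_eq0.
  rewrite dc /= X !sF !(lin_sub lY, lin_addr lY, lin_scale lY, Y) !sF.
  rewrite !(lin_sub lX, lin_addr lX, lin_scale lX, lin_opp lX, X) !sF.
  by solve_vector.
case: (i =P o) => [->|/eqP io].
  exists (-1); rewrite ?oppr_eq0 ?oner_eq0 //=.
  rewrite /= X !sF !(lin_sub lY, lin_addr lY, lin_scale lY, Y) !sF.
  rewrite !(lin_sub lX, lin_addr lX, lin_scale lX, lin_opp lX, X) !sF.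
  by solve_vector.
have oiF : (o == i) = false by rewrite eq_sym; apply/negbTE.
have ciF : (c == i) = false by rewrite eq_sym; apply/negbTE.
rewrite -dc in X Y; apply: off => //.
  by rewrite X oiF (negPf id_) !scale0r !subr0 addr0.
by rewrite Y ciF (negPf io) !(mulr0, scale0r) !subr0 addr0.
Qed.

End Roots.

(** * Parabolic subgroups *)

Section Permutations.
Variable I : choiceType.

(** Pigeonhole: if nothing entered [D], the moved points outside [D] together with y would be mapped
    injectively into the moved points outside [D]. *)
Lemma crosses_back (D : I -> Prop) (s : I -> I) (S : seq I) y :
  injective s -> (forall i, i \notin S -> s i = i) -> D y -> ~ D (s y) ->
  exists2 z, ~ D z & D (s z).
Proof.
move=> si sS0 Dy nDsy; pose T := undup S.
have uT : uniq T by apply: undup_uniq.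
have sS i : i \notin T -> s i = i by rewrite mem_undup; apply: sS0.
have sT i : i \in T -> s i \in T.
  by apply: contraLR => /[dup] h /sS /si => ssi; rewrite ssi in h.
apply: contrapT => no.
have up z : ~ D z -> ~ D (s z) by move=> nz sz; apply: no; exists z.
pose A := [seq z <- T | ~~ `[<D z>]].
have AP z : reflect (~ D z /\ z \in T) (z \in A).
  rewrite mem_filter; apply: (iffP andP) => [[/asboolPn]|[/asboolPn]] //.
have yT : y \in T by apply: contraT => /sS h; case: nDsy; rewrite h.
have sub : {subset map s (y :: A) <= A}.
  move=> _ /mapP[z + ->]; rewrite inE => /orP[/eqP ->|/AP[yz zT]].
    by apply/AP; split=> //; apply: sT.
  by apply/AP; split; [apply: up | apply: sT].
have u : uniq (map s (y :: A)).
  rewrite map_inj_uniq //= filter_uniq // andbT.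
  by apply/negP => /AP[].
by have := uniq_leq_size u sub; rewrite size_map ltnn.
Qed.

Lemma descends_back (le : rel I) (s : I -> I) (S : seq I) y : total_order le ->
  injective s -> (forall i, i \notin S -> s i = i) -> strict le y (s y) ->
  exists2 z, strict le y z & le (s z) y.
Proof.
move=> [rl al _ ttl] si sS [ysy nysy].
have [|z nzy szy] := crosses_back (D := fun z => le z y) si sS (rl y).
  by move=> syy; apply: nysy; apply: al; rewrite ysy.
exists z => //; split; first by have /orP[] := ttl y z.
by move=> yz; apply: nzy; rewrite yz.
Qed.

End Permutations.

Ltac swap_cases := repeat match goal with
  |- context [if ?x == ?y then _ else _] =>
    match x with
    | context [if _ then _ else _] => fail 1
    | _ => case: (x =P y) => ?
    end
  end.

Section Parabolic.
Variables (K : closedFieldType) (V : lmodType K) (I : choiceType) (e : I -> V).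
Hypothesis hb : is_basis e.
Local Notation co := (coord e).
Local Notation sp := (spans e).
Variables (E : nat -> set I) (k : group_kind V I).
Hypothesis adm : admissible e E k.
Hypothesis two0 : 2%:R != 0 :> K.
Local Notation G := (ambient_group e k).
Local Notation nfx := (nonfixed k).
Local Notation swp := (swap k).

Lemma monomial_perm n s : G n -> monomial e n s ->
  exists s' (S : seq I), [/\ cancel s s', cancel s' s & forall i, i \notin S -> s i = i].
Proof.
move=> /ambientP[fn _] hn; have [ln bn _] := fn.
have [S [uS nfix nS]] := finitary_support hb fn.
have si := monomial_inj hb ln (bij_inj bn) hn.
have sE i : co (s i) (n (e i)) != 0.
  by have [c c0 ->] := hn i; rewrite coordZ // coord_basis // eqxx mulr1.
have sfix i : i \notin S -> s i = i.
  move=> /nfix h; have := sE i; rewrite h coord_basis //.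
  by case: (s i =P i) => // _; rewrite eqxx.
have sS i : i \in S -> s i \in S by move=> iS; apply: nS iS _ (sE i).
have [s' [sK s'K _]] := seq_inverse uS (in2W si) sS.
exists s', S; split=> // i.
  by have := sK i; case: (boolP (i \in S)) => // /sfix ->.
by have := s'K i; case: (boolP (s' i \in S)) => // /sfix ->.
Qed.

Lemma respects_dual_inverse s s' : cancel s s' -> cancel s' s ->
  respects_dual k s -> respects_dual k s'.
Proof.
rewrite /respects_dual; case: k => // om iE sK s'K h i.
by rewrite -[in LHS](s'K i) -h sK.
Qed.

Lemma nonfixed_perm s s' i : cancel s s' -> respects_dual k s ->
  nfx i -> nfx (s i).
Proof.
rewrite /respects_dual /nonfixed; case: k => // om iE sK h ni.
by rewrite -h => /(can_inj sK).
Qed.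

Lemma fixed_perm s s' i : cancel s s' -> respects_dual k s ->
  ~ nfx i -> s i = i.
Proof.
rewrite /respects_dual /nonfixed; case kE : k => [|om iE] sK h; first by case.
move=> /contrapT hi; apply: (dual_fix adm kE) => //.
by rewrite -h hi.
Qed.

Lemma compatible_transport (le : rel I) s s' : cancel s s' -> cancel s' s ->
  respects_dual k s -> compatible_order k le ->
  compatible_order k (fun i j => le (s' i) (s' j)).
Proof.
move=> sK s'K hs [rl al tl ttl dl]; split=> //.
- by move=> i j /al /(can_inj s'K).
- by move=> i j l; apply: tl.
have := respects_dual_inverse sK s'K hs; rewrite /respects_dual.
by case: k dl => // om iE dl h i j; rewrite !h -dl.
Qed.

Lemma conjugate_tri n n' s s' g (r : I -> I -> Prop) : linear g -> linear n' ->
  cancel n n' -> cancel n' n -> monomial e n s -> cancel s s' -> cancel s' s ->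
  tri e (fun i j => r (s' i) (s' j)) g -> tri e r (n' \o g \o n).
Proof.
move=> lg ln' nK n'K hn sK s'K hg j /=; have [c c0 ->] := hn j.
rewrite (lin_scale lg) (lin_scale ln'); apply: spans_scale => //.
have hn' := monomial_inverse ln' nK hn s'K.
apply: (spans_lin hb ln') (hg (s j)) => i; rewrite sK => ij.
by have [d _ ->] := hn' i; apply: spans_scale => //; apply: spans_basis.
Qed.

Lemma swapC c d : nfx c -> nfx d -> swp c d = swp d c.
Proof.
rewrite /swap /nonfixed; case kE : k => [|om iE] nc nd; apply: funext => x.
  by swap_cases; congruence.
have dK := dualK adm kE.
have := dK c; have := dK d; have := dK x.
by swap_cases; congruence.
Qed.

Lemma swap_dual om iE c d : k = Isometry om iE -> nfx c -> nfx d ->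
  swp (iE c) (iE d) = swp c d.
Proof.
rewrite /swap /nonfixed => kE; rewrite kE => nc nd; apply: funext => x.
have dK := dualK adm kE.
have := dK c; have := dK d; have := dK x.
by swap_cases; congruence.
Qed.

Lemma swap_involutive c d : nfx c -> nfx d -> involutive (swp c d).
Proof.
rewrite /swap /nonfixed; case kE : k => [|om iE] nc nd x.
  by swap_cases; congruence.
have dK := dualK adm kE.
have := dK c; have := dK d; have := dK x.
by swap_cases; congruence.
Qed.

Lemma swap_respects_dual c d : nfx c -> nfx d -> respects_dual k (swp c d).
Proof.
rewrite /swap /nonfixed /respects_dual; case kE : k => [//|om iE] nc nd x.
have dK := dualK adm kE.
have := dK c; have := dK d; have := dK x.
by swap_cases; congruence.
Qed.

Lemma swapL c d : swp c d c = d.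
Proof. by rewrite /swap; case: k => *; rewrite eqxx. Qed.

Lemma swapR c d : swp c d d = c.
Proof. by rewrite /swap; case: k => *; rewrite eqxx; case: eqP. Qed.

(** Conjugates of reflections by reflections in the Weyl group of rank two; needed when the middle
    index in [weyl_convex] is a dual index. *)
Lemma swap_conj om iE c d : k = Isometry om iE -> nfx c -> nfx d ->
  c <> d -> d <> iE c ->
  [/\ swp d (iE d) \o swp c d \o swp d (iE d) = swp c (iE d),
      swp c (iE c) \o swp c d \o swp c (iE c) = swp c (iE d),
      swp c d \o swp c (iE c) \o swp c d = swp d (iE d) &
      swp c d \o swp d (iE d) \o swp c d = swp c (iE c)].
Proof.
rewrite /swap /nonfixed => kE; rewrite kE => nc nd ncd ncd'.
have dK := dualK adm kE.
by split; apply: funext => x /=; have := dK c; have := dK d; have := dK x;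
  swap_cases; congruence.
Qed.

Lemma swap_off c d x : x <> c -> x <> d ->
  (if k is Isometry _ iE then x <> iE c /\ x <> iE d else True) -> swp c d x = x.
Proof.
rewrite /swap; case: k => [|om iE] xc xd; first by swap_cases.
by move=> [? ?]; swap_cases.
Qed.

Section Stable.
Variables (P : set (V -> V)) (le0 : rel I).
Hypotheses (gP : is_group P) (PG : P `<=` G) (cle0 : compatible_order k le0).
Hypothesis BP : forall g, G g -> tri e le0 g -> P g.

(** The permutations realized inside P, that is, the Weyl group of P. *)
Definition weyl s := exists2 n, P n & monomial e n s.

Lemma weyl_comp s t : weyl s -> weyl t -> weyl (s \o t).
Proof.
move=> [n Pn hn] [m Pm hm]; have [_ PM _] := gP; exists (n \o m); first exact: PM.
have [[ln _ _] _] := (ambientP e k n).1 (PG Pn).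
exact: monomial_comp.
Qed.

Lemma root_group_parabolic a b g : root_group e k a b g -> le0 a b -> P g.
Proof. by move=> [Gg h] ab; apply: BP => //; apply: h. Qed.

(** Both root groups of the pair (s a, s b) lie in P: one because it is triangular for [le0], the
    other because n conjugates the root group of (a, b) onto it. The reflection is a product of
    their elements by [rank_one]. *)
Lemma weyl_inversion s a b : weyl s -> nfx a -> nfx b -> a <> b ->
  le0 a b -> le0 (s b) (s a) -> weyl (swp (s a) (s b)).
Proof.
move=> [n Pn hn] na nb nab ab sba; have Gn := PG Pn.
have [fn pn] := (ambientP e k n).1 Gn; have [ln _ _] := fn.
have [s' [_ [sK s'K _]]] := monomial_perm Gn hn.
have hs := monomial_respects_dual hb adm pn hn.
have nsab : s a <> s b by move=> /(can_inj sK).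
have [X [Y [X' [hX hY hX' hm]]]] := rank_one hb adm two0 nsab
  (nonfixed_perm sK hs na) (nonfixed_perm sK hs nb).
have [_ PM PV] := gP; have [n' Pn' [nK n'K]] := PV _ Pn.
have conj Z : root_group e k (s a) (s b) Z -> P Z.
  move=> [GZ hZ]; have [[lZ _ _] _] := (ambientP e k Z).1 GZ.
  have [[ln' _ _] _] := (ambientP e k n').1 (PG Pn').
  have -> : Z = n \o (n' \o Z \o n) \o n'.
    by apply: funext => v /=; rewrite !n'K.
  apply: (PM _ _ (PM _ _ Pn _) Pn'); apply: BP.
    by apply: ambient_comp; [apply: ambient_comp; [apply: PG|] |].
  apply: (conjugate_tri (r := le0) lZ ln' nK n'K hn sK s'K).
  apply: (hZ (fun i j => le0 (s' i) (s' j))); last by rewrite !sK.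
  exact: compatible_transport.
exists (X \o Y \o X') => //.
exact: (PM _ _ (PM _ _ (conj _ hX) (root_group_parabolic hY sba)) (conj _ hX')).
Qed.

Let le0_anti i j : le0 i j -> le0 j i -> i = j.
Proof. by case: cle0 => _ h _ _ _ ij ji; apply: h; rewrite ij ji. Qed.
Let le0_trans i j l : le0 i j -> le0 j l -> le0 i l.
Proof. by case: cle0 => _ _ h _ _; apply: h. Qed.
Let le0_tot i j : le0 i j \/ le0 j i.
Proof. by case: cle0 => _ _ _ h _; apply/orP/h. Qed.
Let le0_dual om iE i j : k = Isometry om iE -> le0 i j -> le0 (iE j) (iE i).
Proof. by move=> kE; rewrite (compatible_dual i j kE cle0). Qed.

(** If the reflection fixes d, it inverts both (c, d) and (d, e'), and [weyl_inversion] applies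
    twice. If d is the dual of c or of e', only a pair of mutually dual indices is inverted, and the
    missing reflections are obtained by conjugation. *)
Lemma weyl_convex c d e' : strict le0 c d -> strict le0 d e' ->
  nfx c -> nfx d -> nfx e' -> weyl (swp c e') -> weyl (swp d e') /\ weyl (swp c d).
Proof.
move=> [cd ncd] [de nde] nc nd ne W.
have ce := le0_trans cd de.
have nce : c <> e' by move=> h; subst; apply: ncd; apply: le0_anti.
have [gen|[om [iE [kE dd]]]] : (if k is Isometry _ iE then d <> iE c /\ d <> iE e' else
  True)
    \/ exists om iE, k = Isometry om iE /\ (d = iE c \/ d = iE e').
  case kE : k => [|om iE]; first by left.
  case: (pselect (d = iE c)) => h1; first by right; exists om, iE; split; [|left].
  case: (pselect (d = iE e')) => h2; first by right; exists om, iE; split; [|right].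
  by left.
  have fd : swp c e' d = d by apply: swap_off => // h; apply: ncd.
  have h1 := weyl_inversion W nc nd ncd cd.
  have h2 := weyl_inversion W nd ne nde de.
  rewrite swapL fd in h1; rewrite swapR fd in h2.
  by split; [rewrite swapC //; apply: h1 | rewrite swapC //; apply: h2].
have dK := dualK adm kE.
have nfd x : nfx x -> iE x <> x by rewrite /nonfixed kE.
have nfd' x : nfx x -> nfx (iE x).
  by rewrite /nonfixed kE => h /esym h'; apply: h; rewrite {1}h' dK.
have nec' : e' <> iE c.
  move=> h; case: dd => h'; first by apply: nde; rewrite h h'.
  by apply: ncd; rewrite h' h dK.
have [c1 c2 c3 c4] := swap_conj kE nc ne nce nec'.
have WC := weyl_comp.
have sDC x y : nfx x -> nfx y -> swp (iE x) (iE y) = swp x y := swap_dual kE.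
have se : swp c e' (iE c) = iE e'.
  by rewrite /swap kE; have := nfd _ nc; swap_cases; congruence.
have sc : swp c e' (iE e') = iE c.
  rewrite /swap kE; have := nfd _ ne; have := dK c; have := dK e'.
  by swap_cases; congruence.
case: dd => dE.
  have Wee : weyl (swp e' (iE e')).
    have := weyl_inversion W nc (nfd' _ nc) (fun h => nfd _ nc (esym h)).
    rewrite swapL se -dE; apply=> //.
    by have := le0_dual kE ce; rewrite -{1}dE => h; apply: le0_trans h de.
  have Wcc : weyl (swp c (iE c)).
    by rewrite -c4; apply: (WC (_ \o _)) => //; apply: WC.
  split; last by rewrite dE.
  rewrite dE -(sDC (iE c) e') //; last exact: nfd'.
  by rewrite dK -c1; apply: (WC (_ \o _)) => //; apply: WC.
have Wcc : weyl (swp c (iE c)).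
  have := weyl_inversion W (nfd' _ ne) ne (nfd _ ne).
  rewrite swapR sc -dE swapC //; last exact: nfd'.
  apply=> //.
  have := le0_dual kE ce; rewrite -dE => h.
  exact: le0_trans cd h.
have Wee : weyl (swp e' (iE e')).
  by rewrite -c3; apply: (WC (_ \o _)) => //; apply: WC.
split; first by rewrite dE swapC //; apply: nfd'.
by rewrite dE -c2; apply: (WC (_ \o _)) => //; apply: WC.
Qed.

End Stable.

End Parabolic.

(** * The preorder of a parabolic subgroup *)

Section ParabolicStabilizer.
Variables (K : closedFieldType) (V : lmodType K) (I : choiceType) (e : I -> V).
Hypothesis hb : is_basis e.
Local Notation co := (coord e).
Local Notation sp := (spans e).
Variables (E : nat -> set I) (k : group_kind V I).
Hypothesis adm : admissible e E k.
Hypothesis two0 : 2%:R != 0 :> K.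
Local Notation G := (ambient_group e k).
Local Notation nfx := (nonfixed k).
Local Notation swp := (swap k).
Variables (P : set (V -> V)) (le0 : rel I).
Hypotheses (gP : is_group P) (PG : P `<=` G) (cle0 : compatible_order k le0).
Hypothesis BP : forall g, G g -> tri e le0 g -> P g.
Local Notation weyl := (weyl e P).

Definition gen_rel (i j : I) := forall A : I -> Prop,
  (forall p, P p -> forall a, A a -> sp A (p (e a))) -> A j -> A i.

Let le0_total : total_order le0 := compatible_total cle0.
Let le0_refl : reflexive le0. Proof. by case: cle0. Qed.
Let le0_anti i j : le0 i j -> le0 j i -> i = j.
Proof. by case: cle0 => _ h _ _ _ ij ji; apply: h; rewrite ij ji. Qed.
Let le0_trans i j l : le0 i j -> le0 j l -> le0 i l.
Proof. by case: cle0 => _ _ h _ _; apply: h. Qed.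
Let le0_tot i j : le0 i j \/ le0 j i.
Proof. by case: cle0 => _ _ _ h _; apply/orP/h. Qed.

Lemma weyl_perm s : weyl s -> exists s' (S : seq I), [/\ cancel s s', cancel s' s,
  forall i, i \notin S -> s i = i & respects_dual k s].
Proof.
move=> [n Pn hn]; have [s' [S [h1 h2 h3]]] := monomial_perm hb (PG Pn) hn.
exists s', S; split=> //; apply: (monomial_respects_dual hb adm _ hn).
by have [_] := (ambientP e k n).1 (PG Pn).
Qed.

Let convex := weyl_convex hb adm two0 gP PG cle0 BP.
Let inversion_swap := weyl_inversion hb adm two0 gP PG cle0 BP.

(** Since s is finitary and moves y up, it moves some z above y down to y or lower. The pair (y, z)
    is inverted, so the reflection of (s z, s y) is in P, and convexity shrinks it to (y, s y). *)
Lemma weyl_cross s y : weyl s -> nfx y -> strict le0 y (s y) -> weyl (swp y (s y)).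
Proof.
move=> W ny ysy; have [s' [S [sK s'K sS hs]]] := weyl_perm W.
have [z [yz nyz] szy] := descends_back le0_total (can_inj sK) sS ysy.
have [ysy1 nysy] := ysy.
have nz : nfx z.
  apply: contrapT => h; have sz := fixed_perm adm sK hs h.
  by apply: nyz; apply: le0_anti => //; rewrite -sz.
have szsy := le0_trans szy ysy1.
have W2 := inversion_swap W ny nz nyz yz szsy.
have nsz := nonfixed_perm sK hs nz; have nsy := nonfixed_perm sK hs ny.
rewrite (swapC adm) // in W2.
have [szE|nszE] := pselect (s z = y); first by rewrite -{1}szE.
by have [] := convex (conj szy nszE) (conj ysy1 nysy) nsz ny nsy W2.
Qed.

(** Explicit candidate for [gen_rel y j] on nonfixed indices: at most one reflection of P is
    needed. *)
Definition below y j := le0 y j \/ weyl (swp j y).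

(** If y and j are exchanged by a reflection of P, compose it with s to start from j itself. If y is
    below j and s y above, [weyl_cross] exchanges y with s y and convexity cuts at j. *)
Lemma below_weyl s y j : weyl s -> nfx y -> nfx j -> below y j -> below (s y) j.
Proof.
move=> W ny nj; have [s' [S [sK s'K sS hs]]] := weyl_perm W.
have nsy := nonfixed_perm sK hs ny.
have direct t l : weyl t -> nfx l -> below (t l) l.
  move=> Wt nl; have [tl|nlt] := pselect (le0 (t l) l); first by left.
  right; apply: weyl_cross => //; have [lt|//] := le0_tot l (t l).
  by split=> // lE; apply: nlt; rewrite -lE.
move=> [yj|Wyj]; last first.
  have := direct _ _ (weyl_comp gP PG W Wyj) nj.
  by rewrite /= swapL.
have [syj|nsyj] := pselect (le0 (s y) j); first by left.
have [//|jsy] := le0_tot (s y) j.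
have [yE|nyj] := pselect (y = j); first by rewrite yE; apply: direct.
have nys : y <> s y by move=> h; apply: nsyj; rewrite -h.
have W2 := weyl_cross W ny (conj (le0_trans yj jsy) nys).
right; have [] := convex (conj yj nyj) (conj jsy _) ny nj nsy W2 => //.
by move=> h; apply: nsyj; rewrite -h.
Qed.

Lemma below_down x y j : le0 x y -> nfx x -> nfx y -> nfx j -> below y j -> below x j.
Proof.
move=> xy nx ny nj [yj|W]; first by left; apply: le0_trans xy yj.
have [xj|nxj] := pselect (le0 x j); first by left.
have [//|jx] := le0_tot x j.
have njx : j <> x by move=> h; apply: nxj; rewrite h.
have [<-|nxy] := pselect (y = x); first by right.
by right; have [] := convex (conj jx njx) (conj xy (fun h => nxy (esym h))) nj nx ny W.
Qed.

Lemma bruhat_parabolic g : G g -> exists u m q s,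
  [/\ P u, P q, monomial e m s, g = u \o m \o q & [/\ G m, tri e le0 u & tri e le0 q]].
Proof.
move=> Gg; have [u [m [q [s [s' [[Gu Gm Gq] [_ [_ _ hm] hu hq ->]]]]]]] :=
  bruhat hb adm cle0 cle0 Gg.
have tu : tri e le0 u.
  by move=> j; apply: (spans_sub_set (unitri_tri hb hu j) _) => i [[]//|->].
have tq : tri e le0 q.
  by move=> j; apply: (spans_sub_set (unitri_tri hb hq j) _) => i [[]//|->].
by exists u, m, q, s; split=> //; apply: BP.
Qed.

Lemma parabolic_inverse g : P g -> exists g', [/\ P g', cancel g g' & cancel g' g].
Proof. by move=> Pg; have [_ _ /(_ _ Pg)[g' ? [? ?]]] := gP; exists g'. Qed.

Lemma gen_rel_weyl i j : gen_rel i j -> nfx i -> nfx j -> ~ le0 i j -> weyl (swp j i).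
Proof.
move=> ij ni nj nij.
pose A y := nfx y /\ below y j \/
  ~ nfx y /\ exists y', [/\ nfx y', below y' j & le0 y y'].
have Adown x y : le0 x y -> A y -> A x.
  move=> xy [[ny yj]|[ny [z [nz zj yz]]]]; case: (pselect (nfx x)) => nx.
  - by left; split=> //; apply: below_down xy _ _ _ yj.
  - by right; split=> //; exists y.
  - by left; split=> //; apply: below_down (le0_trans xy yz) _ _ _ zj.
  - by right; split=> //; exists z; split=> //; apply: le0_trans xy yz.
have Atri g : tri e le0 g -> forall a, A a -> sp A (g (e a)).
  by move=> hg a Aa; apply: (spans_sub_set (hg a) _) => t ta; apply: Adown ta Aa.
have lin g : P g -> linear g by move=> /PG /ambientP[[]].
case: (ij A) => [p Pp a Aa||[]//|[]//].
  have [u [m [q [s [Pu Pq hm pE [Gm tu tq]]]]]] := bruhat_parabolic (PG Pp).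
  have [u' [Pu' uK u'K]] := parabolic_inverse Pu.
  have [q' [Pq' qK q'K]] := parabolic_inverse Pq.
  have Pm : P m.
    have -> : m = u' \o p \o q' by apply: funext => v; rewrite pE /= q'K uK.
    by have [_ PM _] := gP; apply: (PM _ _ (PM _ _ Pu' Pp) Pq').
  have W : weyl s by exists m.
  have [s' [S [sK s'K sS hs]]] := weyl_perm W.
  have As y : A y -> A (s y).
    move=> [[ny yj]|[ny h]].
      left; split; first exact: nonfixed_perm hs ny.
      exact: below_weyl.
    by right; rewrite (fixed_perm adm sK hs ny).
  rewrite pE /=; apply: (spans_lin hb (lin _ Pu) (Atri _ tu)).
  apply: (spans_lin hb (lin _ Pm)) (Atri _ tq _ Aa) => t At.
  by have [c _ ->] := hm t; apply: spans_scale => //; apply: spans_basis => //; apply: As.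
  by left; split=> //; left.
by move=> _ [].
Qed.

Lemma gen_rel_refl i : gen_rel i i. Proof. by []. Qed.

Lemma gen_rel_trans i j l : gen_rel i j -> gen_rel j l -> gen_rel i l.
Proof. by move=> ij jl A hA Al; apply: ij => //; apply: jl. Qed.

Lemma parabolic_tri g : P g -> tri e gen_rel g.
Proof. by move=> Pg j i hi A hA Aj; apply: hA Pg _ Aj _ hi. Qed.

(** The root element of the pair links i to j inside P. A pair without a root vector is linked in
    two steps through the fixed index, which lies between its two members. *)
Lemma le_gen_rel i j : le0 i j -> gen_rel i j.
Proof.
have eff a b : le0 a b -> a <> b -> co a (root_vector e k a b (e b)) != 0 -> gen_rel a b.
  move=> ab nab c0.
  have tr t : tri e le0 (rexp e k a b t).
    by have [_] := rexp_root_group hb adm two0 t nab; apply.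
  (* The entry is t x + t^2 y / 2. If it vanished at t = 1 and t = -1, the difference would give 2 x
     = 0. *)
  have [t ht] : exists t, co a (rexp e k a b t (e b)) != 0.
    apply: contrapT => no.
    have z t : co a (rexp e k a b t (e b)) = 0.
      by apply/eqP; apply: contrapT => /negP h; apply: no; exists t.
    have zE t : t * co a (root_vector e k a b (e b)) +
        t * t / 2%:R * co a (root_vector e k a b (root_vector e k a b (e b))) = 0.
      rewrite -[RHS](z t) (rexpE hb adm two0) !coordD // !coordZ // coord_basis //.
      by rewrite (introF eqP nab) add0r.
    move/eqP: c0; apply; have h1 := zE 1; have h2 := zE (-1).
    set x := co a (root_vector _ _ _ _ _) in h1 h2 *;
      set y := co a (root_vector _ _ _ _ _) in h1 h2.
    have : 2%:R * x = (1 * x + 1 * 1 / 2%:R * y) - (-1 * x + -1 * -1 / 2%:R * y) by field.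
    by rewrite h1 h2 subrr => /eqP; rewrite mulf_eq0 (negPf two0) => /eqP.
  move=> A hA Ab.
  exact: (hA _ (BP (rexp_ambient hb adm two0 t nab) (tr t)) _ Ab _ ht).
move=> ij; have [->//|nij] := pselect (i = j).
have [h|] := eqVneq (co i (root_vector e k i j (e j))) 0; last exact: eff.
have [om [iE [o [kE iD symm fixo ni]]]] := root_degenerate hb adm two0 h nij.
have dK := dualK adm kE.
have jD : j = iE i by rewrite iD dK.
have [io oj] : le0 i o /\ le0 o j.
  by rewrite jD; apply: (fixed_between kE cle0 fixo); rewrite -jD.
have nio : i <> o.
  by move=> h'; apply: nij; rewrite jD h' fixo.
have noj : o <> j by move=> h'; apply: nij; rewrite iD -h' fixo.
apply: (gen_rel_trans (j := o)).
  apply: eff => //; apply/eqP => /(root_degenerate hb adm two0)/(_ nio).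
  move=> [om1 [iE1 [o1 [kE1 iD1 _ _ _]]]]; move: kE1; rewrite kE => -[_ iEE].
  by rewrite -iEE fixo in iD1.
apply: eff => //; apply/eqP => /(root_degenerate hb adm two0)/(_ noj).
move=> [om1 [iE1 [o1 [kE1 oD1 _ _ _]]]]; move: kE1; rewrite kE => -[_ iEE].
by apply: noj; rewrite -iEE in oD1; rewrite -fixo oD1 dK.
Qed.

Lemma gen_rel_total i j : gen_rel i j \/ gen_rel j i.
Proof. by case: (le0_tot i j) => h; [left|right]; apply: le_gen_rel. Qed.

(** An isometry is its own contragredient, so the complement of the dual of a P-stable index set is
    again P-stable, P being closed under inverses. *)
Lemma gen_rel_dual om iE i j : k = Isometry om iE -> gen_rel i j ->
  gen_rel (iE j) (iE i).
Proof.
move=> kE ij A hA Ai; apply: contrapT => nA; have dK := dualK adm kE.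
have := ij (fun x => ~ A (iE x)); apply=> //.
move=> p Pp a nAa i' hi' Ai'; have [p' [Pp' pK p'K]] := parabolic_inverse Pp.
have [_ pp] := (ambientP e k p).1 (PG Pp).
have c : contragredient om p p by move: pp; rewrite /preserving kE.
apply: nAa; move: hi'; rewrite (contragredient_coord_neq0 hb adm kE _ _ p'K c).
exact: hA.
Qed.

(** Induction on the moved indices: a reflection of P composed with m fixes one more index, and a
    diagonal element lies in P already. *)
Let monomial_parabolic (S : seq I) : forall m s, G m -> monomial e m s ->
  tri e gen_rel m -> (forall i, i \notin S -> s i = i) -> P m.
Proof.
elim: S => [|l S IH] m s Gm hm tm sS.
  apply: BP => // j; have [c _ ->] := hm j; rewrite sS //.
  by apply: spans_scale => //; apply: spans_basis.
have [sl|nsl] := pselect (s l = l).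
  apply: IH Gm hm tm _ => i iS; have [->//|il] := eqVneq i l.
  by apply: sS; rewrite inE negb_or il.
have [fm pm] := (ambientP e k m).1 Gm.
have hs := monomial_respects_dual hb adm pm hm.
have [s' [_ [sK s'K _]]] := monomial_perm hb Gm hm.
have nl : nfx l by apply: contrapT => /(fixed_perm adm sK hs).
have nsl' := nonfixed_perm sK hs nl.
have R1 : gen_rel (s l) l.
  by apply: tm; have [c c0 ->] := hm l; rewrite coordZ // coord_basis // eqxx mulr1.
have [m' [fm' mK m'K]] := finitary_inverse fm.
have R2 : gen_rel l (s l).
  have tm' := tri_inverse hb gen_rel_refl gen_rel_trans fm mK m'K tm.
  have [lm' _ _] := fm'.
  have hm' := monomial_inverse lm' mK hm s'K.
  apply: tm'; have [c c0 ->] := hm' (s l).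
  by rewrite sK coordZ // coord_basis // eqxx mulr1.
(* The indices l and s l are related in both directions, and [le0] fails in one of them; there
   [gen_rel_weyl] supplies the reflection. *)
have [n Pn hn] : weyl (swp l (s l)).
  have [h|h] := pselect (le0 (s l) l); last exact: gen_rel_weyl.
  rewrite (swapC adm) //; apply: gen_rel_weyl => // h'; apply: nsl.
  exact: le0_anti.
have [[ln _ _] _] := (ambientP e k n).1 (PG Pn).
have [n' [Pn' nK n'K]] := parabolic_inverse Pn.
have : P (n \o m).
  apply: (IH _ (swp l (s l) \o s)).
  - exact: ambient_comp (PG Pn) Gm.
  - exact: monomial_comp.
  - apply: (tri_comp hb ln gen_rel_trans) => //; exact: parabolic_tri.
  move=> i iS /=; have [->|/eqP il] := eqVneq i l; first by rewrite swapR.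
  have si : s i = i by apply: sS; rewrite inE negb_or; move/eqP: il => ->.
  rewrite si /swap; move: hs; rewrite /respects_dual; case kE : k => [|om iE] hs.
    rewrite (introF eqP il); case: eqP => // isl.
    by case: il; apply: (can_inj sK); rewrite si.
  rewrite (introF eqP il); have dK := dualK adm kE.
  have isl : i <> s l by move=> isl; apply: il; apply: (can_inj sK); rewrite si.
  rewrite (introF eqP isl).
  have fixd x : s x = x -> s (iE x) = iE x by move=> sx; rewrite hs sx.
  case: eqP => [iE1|_].
    by case: nsl; have := fixd _ si; rewrite iE1 dK.
  case: eqP => [iE1|//].
  by case: nsl; apply: (can_inj sK); have := fixd _ si; rewrite iE1 dK.
move=> Pnm; have -> : m = n' \o (n \o m) by apply: funext => v /=; rewrite nK.
by have [_ PM _] := gP; apply: PM.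
Qed.

(** The outer Bruhat factors of g lie in P, so the monomial factor is again triangular for
    [gen_rel], and [monomial_parabolic] applies to it. *)
Lemma parabolicP g : P g <-> G g /\ tri e gen_rel g.
Proof.
split=> [Pg|[Gg tg]]; first by split; [apply: PG | apply: parabolic_tri].
have [u [m [q [s [Pu Pq hm gE [Gm tu tq]]]]]] := bruhat_parabolic Gg.
have [u' [Pu' uK u'K]] := parabolic_inverse Pu.
have [q' [Pq' qK q'K]] := parabolic_inverse Pq.
have [_ PM _] := gP.
have lin h : G h -> linear h by move=> /ambientP[[]].
have Pm : P m.
  have [s' [S [sK s'K sS]]] := monomial_perm hb Gm hm.
  apply: (monomial_parabolic (S := S) Gm hm _ sS).
  have -> : m = u' \o g \o q' by apply: funext => v; rewrite gE /= q'K uK.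
  apply: (tri_comp hb _ gen_rel_trans); last exact: parabolic_tri.
    by apply: linear_comp; apply: lin => //; apply: PG.
  apply: (tri_comp hb _ gen_rel_trans) => //; last exact: parabolic_tri.
  by apply: lin; apply: PG.
by rewrite gE; apply: (PM _ _ (PM _ _ Pu Pm) Pq).
Qed.

End ParabolicStabilizer.

(** * Finitary changes of order *)

Section OrderIsomorphism.
Variable I : choiceType.
Implicit Types (le : rel I) (S : seq I).

(** If a point is moved up, [descends_back] yields a higher point whose image is no higher than the
    first point, against monotonicity. If it is moved down, the inverse moves a point up. *)
Lemma order_automorphism_id le (r r' : I -> I) S : total_order le ->
  cancel r r' -> cancel r' r -> (forall i, i \notin S -> r i = i) ->
  (forall i j, le i j = le (r i) (r j)) -> forall i, r i = i.
Proof.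
move=> tle; have [rl al tl ttl] := tle.
have aux (t t' : I -> I) y : cancel t t' -> (forall i, i \notin S -> t i = i) ->
    (forall i j, le i j = le (t i) (t j)) -> strict le y (t y) -> False.
  move=> tK tS ht ysy; have [z [yz nyz] tzy] := descends_back tle (can_inj tK) tS ysy.
  case: ysy => yty nyty; apply: nyty; apply: al; rewrite yty /=.
  by apply: tl tzy; rewrite -ht.
move=> rK r'K rS hr i; apply: contrapT => nri.
have /orP[ir|ri] := ttl i (r i).
  by apply: (aux r r' i rK rS hr); split=> // h; apply: nri.
apply: (aux r' r (r i) r'K _ _).
- by move=> j jS; rewrite -{1}(rS j jS) rK.
- by move=> a b; rewrite [RHS]hr !r'K.
- by rewrite rK.
Qed.

Lemma nth_sorted_down le (p : pred I) x0 (l : seq I) : transitive le -> sorted le l ->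
  (forall x y, le x y -> p y -> p x) ->
  forall i, (i < size l)%N -> p (nth x0 l i) = (i < count p l)%N.
Proof.
move=> tl; elim: l => //= a l IH sl hp i.
have pl := path_sorted sl; have al := order_path_min tl sl.
have z : p a = false -> count p l = 0%N.
  move=> pa; apply/eqP; rewrite -leqn0 leqNgt -has_count; apply/hasPn => y yl.
  by apply: contraFN pa; apply: hp; apply: (allP al).
case: i => [_|i] /=; first by case E : (p a) => //; rewrite z.
rewrite ltnS => il; rewrite IH //; case E : (p a); first by rewrite add1n ltnS.
by rewrite z // !ltn0.
Qed.

(** The k-th element of [S] for [le] goes to the k-th element for [le2]. *)
Lemma sort_isomorphism le le2 S : total_order le -> total_order le2 -> uniq S ->
  (forall x y, ~ (x \in S /\ y \in S) -> le x y = le2 x y) ->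
  exists s s', [/\ cancel s s', cancel s' s, forall i, i \notin S -> s i = i &
    forall x y, le x y = le2 (s x) (s y)].
Proof.
move=> [rl al tl ttl] [rl2 al2 tl2 ttl2] uS agree.
pose l := sort le S; pose l2 := sort le2 S.
have sl : sorted le l by apply: sort_sorted.
have sl2 : sorted le2 l2 by apply: sort_sorted.
have ul : uniq l by rewrite sort_uniq.
have ul2 : uniq l2 by rewrite sort_uniq.
have ml i : (i \in l) = (i \in S) by rewrite mem_sort.
have ml2 i : (i \in l2) = (i \in S) by rewrite mem_sort.
have szl : size l = size S by rewrite size_sort.
have szl2 : size l2 = size S by rewrite size_sort.
pose t i := nth i l2 (index i l).
have idx i : i \in S -> (index i l < size S)%N by rewrite -szl index_mem ml.
have tS i : i \in S -> t i \in S by move=> iS; rewrite -ml2 mem_nth // szl2 idx.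
have tE x0 i : i \in S -> t i = nth x0 l2 (index i l).
  by move=> iS; apply: set_nth_default; rewrite szl2 idx.
have tI : {in S &, injective t}.
  move=> i j iS jS; rewrite (tE i) // (tE i j) // => /eqP.
  rewrite nth_uniq ?szl2 ?idx // => /eqP h.
  by rewrite -(nth_index i (s := l) (x := i)) ?ml // h nth_index // ml.
have [s' [sK s'K _]] := seq_inverse uS tI tS.
exists (fun i => if i \in S then t i else i), s'; split=> //.
  by move=> i /negPf ->.
(* For y outside [S], x is below y exactly when its rank is less than the number of elements of [S]
   below y. That number is the same for both orders. *)
have mixed x y : x \in S -> y \notin S -> le x y = le2 (t x) y.
  move=> xS yS; rewrite -{1}(nth_index x (s := l) (x := x)) ?ml //.
  rewrite (nth_sorted_down (p := le^~ y) x tl sl) ?szl ?idx //; last by move=> a b;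
    apply: tl.
  rewrite (nth_sorted_down (p := le2^~ y) x tl2 sl2) ?szl2 ?idx //; last by move=> a b;
    apply: tl2.
  rewrite !count_sort; congr (_ < _)%N; apply: eq_in_count => z zS.
  by apply: agree => -[_ yS']; rewrite yS' in yS.
have flip le' x y : reflexive le' -> antisymmetric le' -> total le' -> x != y ->
  le' y x = ~~ le' x y.
  move=> r a tt; apply: contraNeq; have := tt x y.
  case E1 : (le' x y); case E2 : (le' y x) => //= _ _.
  by apply/eqP; apply: a; rewrite E1 E2.
move=> x y; case: ifPn => xS; case: ifPn => yS.
- rewrite (tE x) // (tE x y) //.
  have hom (le' : rel I) (m : seq I) : reflexive le' -> antisymmetric le' ->
    transitive le' ->
      sorted le' m -> uniq m -> forall i j, (i < size m)%N -> (j < size m)%N ->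
      le' (nth x m i) (nth x m j) = (i <= j)%N.
    move=> r a tr sm um i j im jm; apply/idP/idP; last exact: sorted_leq_nth.
    apply: contraLR; rewrite -ltnNge => ji; apply/negP => h.
    have h2 : le' (nth x m j) (nth x m i) by apply: sorted_leq_nth => //; apply: ltnW.
    have /eqP : nth x m i = nth x m j by apply: a; rewrite h h2.
    by rewrite nth_uniq // => /eqP ij; rewrite ij ltnn in ji.
  rewrite (hom le2) ?szl2 ?idx // -(hom le l) ?szl ?idx //.
  by rewrite !nth_index ?ml.
- exact: mixed.
- have nxy : y != x by apply: contraNneq xS => <-.
  have nty : t y != x by apply: contraNneq xS => <-; apply: tS.
  by rewrite (flip le y x) // (flip le2 (t y) x) // mixed.
- by apply: agree => -[xS']; rewrite xS' in xS.
Qed.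

(** Signed distance from an origin o, where the distance from x to y counts the half-open interval
    that contains x and omits y, so that distances add up. *)
Lemma interval_embedding le : total_order le ->
  (forall x y, exists s : seq I, forall z, le x z -> le z y -> z \in s) ->
  exists f : I -> int, forall i j, le i j = (f i <= f j).
Proof.
move=> [rl al tl ttl] fin.
have [o|no] := pselect (inhabited I); last first.
  by exists (fun=> 0) => i; case: no.
case: o => o.
have fin' x y : {s : seq I | uniq s /\ forall z, (z \in s) = [&& le x z, le z y & z != y]}.
  apply: cid; have [s hs] := fin x y.
  exists [seq z <- undup s | [&& le x z, le z y & z != y]]; split.
    by rewrite filter_uniq // undup_uniq.
  move=> z; rewrite mem_filter mem_undup.
  by case: (boolP (le x z)) => //= xz; case: (boolP (le z y)) => //= zy; rewrite hs ?andbT.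
pose c x y := size (sval (fin' x y)).
have cadd x y z : le x y -> le y z -> (c x z = c x y + c y z)%N.
  move=> xy yz; rewrite /c -size_cat; apply: perm_size; apply: uniq_perm.
  - by case: (svalP (fin' x z)).
  - case: (svalP (fin' x y)) => u1 h1; case: (svalP (fin' y z)) => u2 h2.
    rewrite cat_uniq u1 u2 andbT; apply/hasPn => t; rewrite h1 h2 => /and3P[yt _ _].
    by apply/negP => /and3P[_ ty /eqP]; apply; apply: al; rewrite ty yt.
  move=> t; rewrite mem_cat.
  rewrite (svalP (fin' x y)).2 (svalP (fin' y z)).2 (svalP (fin' x z)).2.
  apply/idP/idP; last first.
    case/orP => /and3P[h1 h2 h3].
      have h4 := tl _ _ _ h2 yz; rewrite h1 h4 /=.
      by apply: contraNneq h3 => tz; apply/eqP; apply: al; rewrite h2 tz yz.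
    by rewrite (tl _ _ _ xy h1) h2 h3.
  move=> /and3P[h1 h2 h3]; have /orP[ty|yt] := ttl t y; last by rewrite yt h2 h3 orbT.
  have [tE|ny] := eqVneq t y; last by rewrite h1 ty.
  by rewrite tE rl -tE h2 h3 orbT.
have c0 x y : le x y -> c x y = 0%N -> x = y.
  move=> xy /size0nil h; apply/eqP; apply: contraT => nxy.
  by have := (svalP (fin' x y)).2 x; rewrite h rl xy nxy.
pose f x : int := if le o x then (c o x)%:Z else - (c x o)%:Z.
have mono x y : le x y -> f y = f x + (c x y)%:Z.
  rewrite /f => xy; case: (boolP (le o x)) => ox.
    by rewrite (tl _ _ _ ox xy) (cadd o x y) // PoszD.
  have xo : le x o by have := ttl o x; rewrite (negPf ox).
  case: (boolP (le o y)) => oy; first by rewrite (cadd x o y) // PoszD addKr.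
  have yo : le y o by have := ttl o y; rewrite (negPf oy).
  by rewrite (cadd x y o) // PoszD opprD addrAC addNr add0r.
exists f => i j; apply/idP/idP => [ij|]; first by rewrite (mono i j) // Num.Theory.lerDl.
have /orP[//|ji] := ttl i j; rewrite (mono j i) // Num.Theory.gerDl => h.
have : c j i = 0%N by case: (c j i) h.
by move=> /(c0 _ _ ji) ->; apply: rl.
Qed.

End OrderIsomorphism.

(** * Cells *)

Section Realization.
Variables (K : closedFieldType) (V : lmodType K) (I : choiceType) (e : I -> V).
Hypothesis hb : is_basis e.
Local Notation co := (coord e).
Local Notation sp := (spans e).
Variables (E : nat -> set I) (k : group_kind V I).
Hypothesis adm : admissible e E k.
Local Notation G := (ambient_group e k).

(** The scalar that repairs the pairing is put on one member of each dual pair and 1 on the other;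
    the order serves only to choose the member. *)
Lemma monomial_realization le s s' (S : seq I) : compatible_order k le ->
  cancel s s' -> cancel s' s -> (forall i, i \notin S -> s i = i) ->
  respects_dual k s -> exists2 m, G m & monomial e m s.
Proof.
move=> [rl al tl ttl _] sK s'K sS hs.
pose c i : K := if k is Isometry om iE then
  if (i != iE i) && le i (iE i) then
    om (e i) (e (iE i)) / om (e (s i)) (e (iE (s i))) else 1 else 1.
have c0 i : c i != 0.
  rewrite /c; case kE : k => [|om iE]; first exact: oner_neq0.
  case: ifP => _; last exact: oner_neq0.
  by rewrite mulf_neq0 ?invr_eq0 //; apply: (form_pair_neq0 hb adm kE).
have cS i : i \notin S -> c i = 1.
  move=> iS; rewrite /c sS //; case kE : k => [//|om iE].
  by rewrite divff ?if_same //; apply: (form_pair_neq0 hb adm kE).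
have [m lm mE] := basis_map hb (fun i => c i *: e (s i)).
have [m' lm' m'E] := basis_map hb (fun i => (c (s' i))^-1 *: e (s' i)).
have mm : monomial e m s by move=> i; exists (c i).
exists m => //; apply/ambientP; split.
  split=> //; last by exists S => i iS; rewrite mE cS // sS // scale1r.
  exists m' => v.
    suff : m' \o m = id by move=> /(congr1 (fun h => h v)).
    apply: (linear_ext hb) => [||i] //=; first exact: linear_comp.
    by rewrite mE (lin_scale lm') m'E sK scalerA divff // scale1r.
  suff : m \o m' = id by move=> /(congr1 (fun h => h v)).
  apply: (linear_ext hb) => [||i] //=; first exact: linear_comp.
  by rewrite m'E (lin_scale lm) mE scalerA mulVf // scale1r s'K.
move: hs; rewrite /preserving /respects_dual; case kE : k => [//|om iE] hs.
have [ll lr] := (form_linl adm kE, form_linr adm kE).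
have dK := dualK adm kE.
apply: (form_basis_ext hb adm kE lm lm) => i j.
rewrite !mE (scal_scale (ll _)) (scal_scale (lr _)).
have [->|/eqP nj] := eqVneq j (iE i); last first.
  rewrite (form_basis0 adm kE nj) (form_basis0 adm kE) ?mulr0 //.
  by rewrite -hs => /(can_inj sK).
have wi := form_pair_neq0 hb adm kE.
rewrite hs /c kE dK; have [iE1|ni] := eqVneq i (iE i).
  have si : s i = i by apply: (dual_fix adm kE) => //; rewrite -hs -iE1.
  by rewrite -iE1 ?eqxx /= !mul1r si -iE1.
rewrite /=; have /orP[h|h] := ttl i (iE i).
  rewrite h (negPf (_ : ~~ le (iE i) i)) ?mul1r ?divfK //.
  by apply: contraNN ni => h'; apply/eqP/al; rewrite h h'.
rewrite h (negPf (_ : ~~ le i (iE i))); last first.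
  by apply: contraNN ni => h'; apply/eqP/al; rewrite h h'.
rewrite mul1r hs dK.
have [t tt ht] := form_sign adm kE.
have t0 : t != 0 by apply/eqP => z; move: tt; rewrite z mul0r => /esym/eqP;
  rewrite oner_eq0.
rewrite (ht (e i)) (ht (e (s i))); have := wi (s i); have := wi i.
by move=> h1 h2; field; apply/andP.
Qed.

End Realization.

Section Cells.
Variables (K : closedFieldType) (V : lmodType K) (I : choiceType) (e : I -> V).
Hypothesis hb : is_basis e.
Local Notation co := (coord e).
Local Notation sp := (spans e).
Variables (E : nat -> set I) (k : group_kind V I).
Hypothesis adm : admissible e E k.
Hypothesis two0 : 2%:R != 0 :> K.
Local Notation G := (ambient_group e k).
Variables (P : set (V -> V)) (le0 : rel I).
Hypotheses (gP : is_group P) (PG : P `<=` G) (cle0 : compatible_order k le0).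
Hypothesis BP : forall g, G g -> tri e le0 g -> P g.
Variable le : rel I.
Hypothesis cle : compatible_order k le.
Local Notation R := (gen_rel e P).
Local Notation B := (order_stabilizer e k le).

Definition monomial_element n s s' :=
  [/\ G n, monomial e n s, cancel s s' & cancel s' s].

Definition orbit_of g : set (set (V -> V)) := [set coset P (b \o g) | b in B].

Definition cell_rel (s' : I -> I) i j := [/\ le i j, i <> j & ~ R (s' i) (s' j)].

Definition sub_order (s : I -> I) := forall x y, le (s x) (s y) -> R x y.

Let PP := parabolicP hb adm two0 gP PG cle0 BP.
Let Rtrans := @gen_rel_trans K V I e P.
Let Rtot := gen_rel_total hb adm two0 cle0 BP.

Let tle : total_order le := compatible_total cle.
Let le_refl x : le x x. Proof. by case: cle => h _ _ _ _; apply: h. Qed.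
Let le_anti x y : le x y -> le y x -> x = y.
Proof. by case: cle => _ h _ _ _ h1 h2; apply: h; rewrite h1 h2. Qed.
Let le_trans x y z : le x y -> le y z -> le x z.
Proof. by case: cle => _ _ h _ _; apply: h. Qed.
Let le_tot x y : le x y \/ le y x.
Proof. by case: cle => _ _ _ h _; apply/orP/h. Qed.

Lemma borelP g : B g <-> G g /\ tri e le g.
Proof. by have [rl al tl _] := tle; apply: order_stabilizerP. Qed.

Lemma ambient_linear g : G g -> linear g.
Proof. by move=> /ambientP[[]]. Qed.

Lemma borel_comp f g : B f -> B g -> B (f \o g).
Proof.
move=> /borelP[Gf tf] /borelP[Gg tg]; apply/borelP; split; first exact: ambient_comp.
by apply: (tri_comp hb (ambient_linear Gf) _ tf tg); apply: le_trans.
Qed.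

Lemma borel_inverse g : B g -> exists g', [/\ B g', cancel g g' & cancel g' g].
Proof.
move=> /borelP[Gg tg]; have [g' [Gg' gK g'K]] := ambient_inverse Gg.
exists g'; split=> //; apply/borelP; split=> //.
have [fg _] := (ambientP e k g).1 Gg.
by apply: (tri_inverse hb _ _ fg gK g'K tg) => //; apply: le_trans.
Qed.

Lemma borel_id : B id.
Proof.
apply/borelP; split; first exact: ambient_id.
by move=> j; apply: spans_basis => //; apply: le_refl.
Qed.

Lemma cosetP f g : coset P f = coset P g <-> exists2 p, P p & f = g \o p.
Proof.
have [P1 PM _] := gP; split=> [fg|[p Pp ->]].
  have : coset P f f by exists id.
  by rewrite fg => -[p Pp <-]; exists p.
apply/seteqP; split=> _ [q Pq <-]; first by exists (p \o q) => //; apply: PM.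
have [p' [Pp' pK p'K]] := parabolic_inverse gP Pp.
exists (p' \o q); first exact: PM.
by apply: funext => v /=; rewrite p'K.
Qed.

Lemma orbit_eq g b p : B b -> P p -> orbit_of (b \o g \o p) = orbit_of g.
Proof.
move=> Bb Pp; have [b' [Bb' bK b'K]] := borel_inverse Bb.
have cp h : coset P (h \o p) = coset P h by apply/cosetP; exists p.
apply/seteqP; split=> _ [c Bc <-].
  exists (c \o b); first exact: borel_comp.
  by rewrite -[LHS]cp.
exists (c \o b'); first exact: borel_comp.
rewrite -[RHS]cp; congr coset; apply: funext => v /=; by rewrite bK.
Qed.

Lemma unitri_le r u : (forall i j, r i j -> le i j) -> unitri e r u -> tri e le u.
Proof.
move=> rle hu j; apply: (spans_sub_set (unitri_tri hb hu j) _) => i [/rle//|->].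
exact: le_refl.
Qed.

Lemma orbit_monomial g : G g ->
  exists n s s', monomial_element n s s' /\ orbit_of g = orbit_of n.
Proof.
move=> Gg; have [u [n [q [s [s' [[Gu Gn Gq] [_ [sK s'K hn] hu hq gE]]]]]]] :=
  bruhat hb adm cle cle0 Gg.
exists n, s, s'; split; first by split.
rewrite gE; apply: orbit_eq.
  by apply/borelP; split=> //; apply: unitri_le hu => i j [].
apply: BP => // j; apply: (spans_sub_set (unitri_tri hb hq j) _) => i [[]//|->].
by case: cle0 => h _ _ _ _; apply: h.
Qed.

Lemma monomial_dual n s s' : monomial_element n s s' -> respects_dual k s.
Proof.
move=> [Gn hn _ _]; have [_ pn] := (ambientP e k n).1 Gn.
exact: (monomial_respects_dual hb adm pn hn).
Qed.

Lemma monomial_conj_coord n n' s s' g i j : monomial_element n s s' ->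
  cancel n n' -> cancel n' n ->
  (co i (n' (g (n (e j)))) != 0) = (co (s i) (g (n (e j))) != 0).
Proof.
move=> [Gn hn sK s'K] nK n'K; have ln := ambient_linear Gn.
have [c c0 hc] := monomial_coord hb i ln (can_inj sK) hn.
by rewrite -{2}[g _]n'K hc mulf_eq0 (negPf c0).
Qed.

(** The preorder of P, with ties broken by [le] pulled back along s. Inside a tie class nothing is
    inverted, so the inversions relative to this order are exactly the pairs of [cell_rel]. *)
Definition refined_order (s : I -> I) : rel I := fun i j =>
  `[<R i j>] && (~~ `[<R j i>] || le (s i) (s j)).

Lemma refined_compatible s s' : cancel s s' -> respects_dual k s ->
  compatible_order k (refined_order s).
Proof.
move=> sK hs; have rT i j : `[<R i j>] \/ `[<R j i>].
  by case: (Rtot i j) => h; [left|right]; apply/asboolP.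
split.
- by move=> i; rewrite /refined_order le_refl orbT andbT; apply/asboolP.
- move=> i j /andP[/andP[/asboolP ij h1] /andP[/asboolP ji h2]].
  move: h1 h2; rewrite (asboolT ij) (asboolT ji) /= => h1 h2.
  by apply: (can_inj sK); apply: le_anti.
- move=> j i l /andP[/asboolP ij h1] /andP[/asboolP jl h2].
  have il := Rtrans ij jl; rewrite /refined_order (asboolT il) /=.
  have [li|nli] := pselect (R l i); last by rewrite (asboolF nli).
  have ji := Rtrans jl li; have lj := Rtrans li ij.
  move: h1 h2; rewrite (asboolT ji) (asboolT lj) /= => h1 h2.
  by rewrite (le_trans h1 h2) orbT.
- move=> i j; rewrite /refined_order.
  have [ij|nij] := pselect (R i j); have [ji|nji] := pselect (R j i).
  + by rewrite (asboolT ij) (asboolT ji) /=; have [->|->] := le_tot (s i) (s j);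
    rewrite ?orbT.
  + by rewrite (asboolT ij) (asboolF nji).
  + by rewrite (asboolT ji) (asboolF nij).
  + by case: (Rtot i j).
case kE : k => [//|om iE] i j; rewrite /refined_order.
have dK := dualK adm kE.
have Rd a b : `[<R a b>] = `[<R (iE b) (iE a)>].
  apply/asboolP/asboolP; first exact: (gen_rel_dual hb adm gP PG kE).
  by move=> /(gen_rel_dual hb adm gP PG kE); rewrite !dK.
move: hs; rewrite /respects_dual kE => hs.
by rewrite -!Rd !hs -(compatible_dual _ _ kE cle).
Qed.

Lemma cell_rel_trans s' i j l : cell_rel s' i j -> cell_rel s' j l -> cell_rel s' i l.
Proof.
move=> [ij nij Rij] [jl njl Rjl]; split; first exact: le_trans ij jl.
  by move=> il; apply: nij; apply: le_anti => //; rewrite il.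
move=> Ril; apply: Rij; case: (Rtot (s' j) (s' l)) => // lj.
exact: Rtrans Ril lj.
Qed.

Lemma monomial_tri n n' s s' m : monomial_element n s s' -> cancel n n' -> cancel n' n ->
  monomial e m s -> forall r : I -> I -> Prop, (forall i, r i i) -> tri e r (n' \o m).
Proof.
move=> [Gn hn sK s'K] nK n'K hm r rr j /=.
have ln' := linear_inverse (ambient_linear Gn) nK n'K.
have hn' := monomial_inverse ln' nK hn s'K.
have [c _ ->] := hm j; have [d _ hd] := hn' (s j).
rewrite (lin_scale ln') hd sK.
by apply: spans_scale => //; apply: spans_scale => //; apply: spans_basis.
Qed.

(** Decompose b n relative to [le] and the refined order. Its permutation is again s, so u is
    supported on the cell and n^-1 m q is triangular for the preorder, hence in P. *)
Lemma cell_surjective n s s' b : monomial_element n s s' -> B b ->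
  exists u, [/\ G u, unitri e (cell_rel s') u & coset P (b \o n) = coset P (u \o n)].
Proof.
move=> hn Bb; have [Gn mn sK s'K] := hn; have [Gb tb] := (borelP b).1 Bb.
have cle1 := refined_compatible sK (monomial_dual hn).
have [u [m [q [s1 [s1' [[Gu Gm Gq] h]]]]]] := bruhat hb adm cle cle1 (ambient_comp Gb Gn).
have [[fu fm fq] [s1K s1'K mm] hu hq bE] := h.
have [u' [Gu' uK u'K]] := ambient_inverse Gu.
have [q' [fq' qK q'K]] := finitary_inverse fq.
have [b' [/borelP[Gb' tb'] bK b'K]] := borel_inverse Bb.
have tu : tri e le u by apply: unitri_le hu => i j [].
have tu' : tri e le u'.
  by apply: (tri_inverse hb _ _ fu uK u'K tu) => //; apply: le_trans.
have lin := ambient_linear.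
have irr i : ~ strict (refined_order s) i i by case.
have bE' v : b (n v) = u (m (q v)) by have := congr1 (fun h => h v) bE.
(* Both n = (b^-1 u) m q and its rearrangement (u^-1 b) n = m q have the shape required by
   [bruhat_perm_le], one for each inequality. *)
have ss1 : s1 = s.
  apply: funext => j; apply: le_anti.
    apply: (@bruhat_perm_le _ _ _ _ hb le (u' \o b) m n q s1 s j) => //.
    - by case: fm.
    - by apply: linear_comp; apply: lin.
    - by apply: (tri_comp hb (lin _ Gu') _ tu' tb); apply: le_trans.
    - exact: can_inj s1K.
    - by apply: funext => v /=; rewrite bE' uK.
    - by rewrite (unitri_diag hb _ irr hq) oner_eq0.
  apply: (@bruhat_perm_le _ _ _ _ hb le (b' \o u) n m q' s s1 j) => //.
  - exact: lin.
  - by apply: linear_comp; apply: lin.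
  - by apply: (tri_comp hb (lin _ Gb') _ tb' tu); apply: le_trans.
  - exact: can_inj sK.
  - by apply: funext => v /=; rewrite -[in LHS](q'K v) -bE' bK.
  have hq' := unitri_inverse hb (strict_trans (compatible_total cle1)) fq qK q'K hq.
  by rewrite (unitri_diag hb _ irr hq') oner_eq0.
have ss1' : s1' = s'.
  by apply: funext => i; apply: (can_inj sK); rewrite s'K -ss1 s1'K.
exists u; split=> //.
  apply: unitri_sub hu => i j [ij nij]; rewrite ss1' => /andP[_ /orP[/asboolPn h2|]].
    by [].
  by rewrite !s'K => ji; case: nij; apply: le_anti.
have [n' [Gn' nK n'K]] := ambient_inverse Gn.
apply/cosetP; exists ((n' \o m) \o q).
  apply/PP; split; first exact: (ambient_comp (ambient_comp Gn' Gm) Gq).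
  apply: (tri_comp hb _ Rtrans).
  - by apply: linear_comp; apply: lin.
  - have mm' : monomial e m s by rewrite -ss1.
    by apply: (monomial_tri hn nK n'K mm') => i; apply: gen_rel_refl.
  - move=> j; apply: (spans_sub_set (unitri_tri hb hq j) _) => i [[/andP[/asboolP]]//|->//].
by apply: funext => v /=; rewrite n'K bE'.
Qed.

(** The quotient w = v^-1 u is supported on the cell, where the preorder fails, while n^-1 w n is in
    P and is supported where the preorder holds. Only the diagonal remains. *)
Lemma cell_injective n s s' u v : monomial_element n s s' -> G u -> G v ->
  unitri e (cell_rel s') u -> unitri e (cell_rel s') v ->
  coset P (u \o n) = coset P (v \o n) -> u = v.
Proof.
move=> hn Gu Gv hu hv /cosetP[p /PP[Gp tp] hp]; have [Gn mn sK s'K] := hn.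
have [v' [Gv' vK v'K]] := ambient_inverse Gv.
have [n' [Gn' nK n'K]] := ambient_inverse Gn.
have [fv _] := (ambientP e k v).1 Gv.
have lin := ambient_linear.
have hw : unitri e (cell_rel s') (v' \o u).
  apply: unitri_comp => //; [exact: lin | exact: cell_rel_trans|].
  by apply: unitri_inverse fv vK v'K hv => //; apply: cell_rel_trans.
have hp' x : u (n x) = v (n (p x)) by have := congr1 (fun h => h x) hp.
suff w1 : v' \o u = id.
  by apply: funext => x; have := congr1 (fun h => v (h x)) w1; rewrite /= v'K.
apply: (linear_ext hb) => // [|j]; first by apply: linear_comp; apply: lin.
apply: (coord_ext hb) => i; rewrite coord_basis //.
have irr t : ~ cell_rel s' t t by case.
have [<-|nij] := eqVneq i j; first exact: (unitri_diag hb _ irr hw).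
apply/eqP; apply: contraT => c0.
have [_ _ nR] := unitri_off hb hw (elimN eqP nij) c0.
case: nR; apply: tp; have [c c0' hc] := mn (s' j).
have h : p (e (s' j)) = n' (v' (u (n (e (s' j))))) by rewrite hp' vK nK.
rewrite h (monomial_conj_coord (v' \o u) _ _ hn nK n'K) s'K hc s'K.
by rewrite (lin_scale (linear_comp (lin _ Gv') (lin _ Gu))) coordZ // mulf_neq0.
Qed.

Lemma cell_borel s' u : G u -> unitri e (cell_rel s') u -> B u.
Proof. by move=> Gu hu; apply/borelP; split=> //; apply: unitri_le hu => i j []. Qed.

(** For the converse, n^-1 B n is the stabilizer of [le] pulled back along s. Once it lies in P,
    [le_gen_rel] applies with that order in place of [le0]. *)
Lemma sub_order_conj n n' s s' : monomial_element n s s' -> cancel n n' -> cancel n' n ->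
  sub_order s <-> (forall b, B b -> P (n' \o b \o n)).
Proof.
move=> hn nK n'K; have [Gn mn sK s'K] := hn; have lin := ambient_linear.
have Gn' := ambient_cancel Gn nK n'K.
split=> [h b /borelP[Gb tb]|h x y].
  apply/PP; split; first exact: (ambient_comp (ambient_comp Gn' Gb) Gn).
  apply: (conjugate_tri hb (r := R) (lin _ Gb) (lin _ Gn') nK n'K mn sK s'K).
  by move=> j; apply: (spans_sub_set (tb j) _) => i ij; apply: h; rewrite !s'K.
have cls := compatible_transport s'K sK
  (respects_dual_inverse sK s'K (monomial_dual hn)) cle.
move=> xy; apply: (le_gen_rel hb adm two0 cls) xy => g Gg tg.
have -> : g = n' \o (n \o g \o n') \o n by apply: funext => v /=; rewrite !nK.
apply: h; apply/borelP; split; first exact: (ambient_comp (ambient_comp Gn Gg) Gn').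
have mn' := monomial_inverse (lin _ Gn') nK mn s'K.
exact: (conjugate_tri hb (r := le) (lin _ Gg) (lin _ Gn) n'K nK mn' s'K sK).
Qed.

Lemma orbit_point g g' : G g -> cancel g g' -> cancel g' g ->
  (exists x, orbit_of g = [set x]) <-> (forall b, B b -> P (g' \o b \o g)).
Proof.
move=> Gg gK g'K; split=> [[x hx] b Bb|h].
  have h1 : orbit_of g (coset P (b \o g)) by exists b.
  have h2 : orbit_of g (coset P (id \o g)) by exists id => //; apply: borel_id.
  move: h1 h2; rewrite hx /= => h1 h2.
  have /cosetP[p Pp hp] : coset P (b \o g) = coset P (id \o g) by rewrite h1 h2.
  rewrite (_ : _ \o _ = p) //; apply: funext => v /=.
  by rewrite -[b _]/((b \o g) v) hp /= gK.
exists (coset P g); apply/seteqP; split=> [_ [b Bb <-]|_ ->] /=.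
  by apply/cosetP; exists (g' \o b \o g); [apply: h | apply: funext => v /=; rewrite g'K].
by exists id => //; apply: borel_id.
Qed.

Lemma monomial_orbit_point n s s' : monomial_element n s s' ->
  (exists x, orbit_of n = [set x]) <-> sub_order s.
Proof.
move=> hn; have [Gn _ _ _] := hn; have [n' [Gn' nK n'K]] := ambient_inverse Gn.
rewrite (orbit_point Gn nK n'K); split=> h; first exact/(sub_order_conj hn nK n'K).
exact/(sub_order_conj hn nK n'K).
Qed.

Lemma conjugate_orbit_point :
  conjugate_into G B P <-> exists2 g, G g & exists x, orbit_of g = [set x].
Proof.
split=> [[g [g' [Gg [gK g'K] h]]]|[g Gg]].
  exists g'; first exact: ambient_cancel Gg gK g'K.
  apply/(orbit_point _ g'K gK) => //; exact: ambient_cancel Gg gK g'K.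
have [g' [Gg' gK g'K]] := ambient_inverse Gg.
by move=> /(orbit_point Gg gK g'K) h; exists g', g; split.
Qed.

(** Let t = s2^-1 s1. If t moved j out of the indices below j for the preorder, some z would enter
    in exchange by [crosses_back]. The second point orbit gives s2 (t z) below s2 (t j), that is s1
    z below s1 j, and the first then puts z below j. *)
Lemma orbit_point_unique n1 s1 s1' n2 s2 s2' :
  monomial_element n1 s1 s1' -> monomial_element n2 s2 s2' ->
  sub_order s1 -> sub_order s2 -> coset P n1 = coset P n2.
Proof.
move=> h1 h2 o1 o2; have [Gn1 m1 s1K s1'K] := h1; have [Gn2 m2 s2K s2'K] := h2.
have [n2' [Gn2' nK n'K]] := ambient_inverse Gn2; have lin := ambient_linear.
apply/cosetP; exists (n2' \o n1); last by apply: funext => v /=; rewrite n'K.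
have Gm : G (n2' \o n1) by apply: ambient_comp.
pose t := s2' \o s1.
have mt : monomial e (n2' \o n1) t.
  by apply: monomial_comp => //; [apply: lin | apply: (monomial_inverse
    (lin _ Gn2') nK m2 s2'K)].
have [t' [S [tK t'K tS]]] := monomial_perm hb Gm mt.
apply/PP; split=> // j; have [c c0 ->] := mt j; apply: spans_scale => //.
apply: spans_basis => //; apply: contrapT => ntj.
have [|z nz tz] := crosses_back (D := fun y => R y j) (can_inj tK) tS _ ntj;
  first exact: gen_rel_refl.
have h : le (s2 (t z)) (s2 (t j)).
  have [//|h] := le_tot (s2 (t z)) (s2 (t j)).
  by case: ntj; apply: Rtrans tz; apply: o2.
by apply: nz; apply: o1; move: h; rewrite /t /= !s2'K.
Qed.

(** Transporting the refined order by s gives [le2], which differs from [le] only on the finitely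
    many cell pairs. A finitary t carries [le] to [le2], and t^-1 s has no inversions left. *)
Lemma finite_cell_point n s s' : monomial_element n s s' ->
  (exists S : seq (I * I), forall i j, cell_rel s' i j -> (i, j) \in S) ->
  exists n2 s2 s2', monomial_element n2 s2 s2' /\ sub_order s2.
Proof.
move=> hn [L hL]; have [Gn mn sK s'K] := hn; have hs := monomial_dual hn.
have cle1 := refined_compatible sK hs.
have cle2 := compatible_transport sK s'K hs cle1.
set le2 := (fun i j => _) in cle2.
have le2E x y : le2 x y = `[<R (s' x) (s' y)>] && (~~ `[<R (s' y) (s' x)>] || le x y).
  by rewrite /le2 /refined_order !s'K.
pose S0 := [seq p.1 | p <- L] ++ [seq p.2 | p <- L].
pose S := undup (S0 ++ if k is Isometry _ iE then [seq iE i | i <- S0] else [::]).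
have inS i j : cell_rel s' i j -> i \in S /\ j \in S.
  move=> /hL hij; rewrite !mem_undup !mem_cat; split; apply/orP; left; apply/orP.
    by left; apply/mapP; exists (i, j).
  by right; apply/mapP; exists (i, j).
have agree x y : ~ (x \in S /\ y \in S) -> le x y = le2 x y.
  move=> nS; rewrite le2E; apply/idP/andP => [xy|[/asboolP Rxy h]].
    split; last by rewrite xy orbT.
    apply/asboolP; apply: contrapT => nR; apply: nS; apply: inS; split=> //.
    by move=> h; apply: nR; rewrite h; apply: gen_rel_refl.
  case/orP: h => // /asboolPn nR; have [//|yx] := le_tot x y.
  case: nS; rewrite and_comm; apply: inS; split=> //.
  by move=> h; apply: nR; rewrite h; apply: gen_rel_refl.
have [t [t' [tK t'K tS ht]]] :=
  sort_isomorphism tle (compatible_total cle2) (undup_uniq _) agree.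
(* Conjugating t by the duality gives another finitary isomorphism between the same orders; the two
   agree since a finitary order automorphism is trivial. *)
have dt : respects_dual k t.
  rewrite /respects_dual; case kE : k => [//|om iE] i; have dK := dualK adm kE.
  have Sd j : j \notin S -> iE j \notin S.
    apply: contraNN; rewrite !mem_undup !mem_cat kE => /orP[h|/mapP[x hx]].
      by apply/orP; right; apply/mapP; exists (iE j); rewrite ?dK // mem_cat.
    by move=> /(can_inj dK) ->; rewrite -mem_cat hx.
  pose r := t' \o (iE \o t \o iE); pose r' := (iE \o t' \o iE) \o t.
  have := order_automorphism_id (r := r) (r' := r') (S := S) tle.
  move=> /(_ _ _ _ _ (iE i)) h; have := congr1 t (h _ _ _ _).
  rewrite /r /= t'K dK => <- //.
  - by move=> x; rewrite /r /r' /= t'K dK tK dK.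
  - by move=> x; rewrite /r /r' /= dK t'K dK tK.
  - by move=> x xS; rewrite /r /= tS ?Sd // dK -{1}(tS _ xS) tK.
  - move=> x y; rewrite [RHS]ht /r /= !t'K.
    rewrite (compatible_dual _ _ kE cle) ht.
    by rewrite [LHS](compatible_dual _ _ kE cle2).
have [m Gm mm] := monomial_realization hb adm cle tK t'K tS dt.
have [m' [Gm' mK m'K]] := ambient_inverse Gm; have lin := ambient_linear.
exists (m' \o n), (t' \o s), (s' \o t); split.
  split; first exact: ambient_comp.
  - apply: monomial_comp => //; first exact: lin.
    exact: (monomial_inverse (lin _ Gm') mK mm t'K).
  - by move=> x /=; rewrite t'K sK.
  - by move=> x /=; rewrite s'K tK.
by move=> x y /=; rewrite ht !t'K le2E !sK => /andP[/asboolP].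
Qed.

End Cells.

(** * Morphisms and charts *)

Section GeneratedAlgebra.
Variables (K : fieldType) (T : Type) (gens : set (T -> K)).
Local Notation alg := (generated_algebra gens).

Lemma alg_sum (J : Type) (r : seq J) (F : J -> T -> K) :
  (forall j, alg (F j)) -> alg (fun x => \sum_(j <- r) F j x).
Proof.
move=> hF; elim: r => [|j r IH].
  rewrite (_ : (fun _ => _) = fun=> 0); first exact: GenConst.
  by apply: funext => x; rewrite big_nil.
rewrite (_ : (fun _ => _) = fun x => F j x + \sum_(i <- r) F i x).
  exact: GenAdd.
by apply: funext => x; rewrite big_cons.
Qed.

Lemma alg_prod (J : Type) (r : seq J) (F : J -> T -> K) :
  (forall j, alg (F j)) -> alg (fun x => \prod_(j <- r) F j x).
Proof.
move=> hF; elim: r => [|j r IH].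
  rewrite (_ : (fun _ => _) = fun=> 1); first exact: GenConst.
  by apply: funext => x; rewrite big_nil.
rewrite (_ : (fun _ => _) = fun x => F j x * \prod_(i <- r) F i x).
  exact: GenMul.
by apply: funext => x; rewrite big_cons.
Qed.

Lemma alg_det n (M : T -> 'M[K]_n) : (forall i j, alg (fun x => M x i j)) ->
  alg (fun x => \det (M x)).
Proof.
move=> hM; rewrite /determinant; apply: alg_sum => s.
by apply: GenMul; [apply: GenConst | apply: alg_prod => i; apply: hM].
Qed.

Lemma alg_adj n (M : T -> 'M[K]_n) i j : (forall i j, alg (fun x => M x i j)) ->
  alg (fun x => (\adj (M x)) i j).
Proof.
move=> hM; rewrite (_ : (fun _ => _) = fun x => cofactor (M x) j i); last first.
  by apply: funext => x; rewrite mxE.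
rewrite /cofactor; apply: GenMul; first exact: GenConst.
apply: alg_det => a b; rewrite (_ : (fun _ => _) = fun x => M x (lift j a) (lift i b)) //.
by apply: funext => x; rewrite !mxE.
Qed.

Definition fraction_on (W : set T) (f : T -> K) := exists a b,
  [/\ alg a, alg b & forall x, W x -> b x != 0 /\ f x = a x / b x].

Lemma fraction_alg W f : alg f -> fraction_on W f.
Proof.
move=> hf; exists f, (fun=> 1); split=> //; first exact: GenConst.
by move=> x _; rewrite oner_eq0 divr1.
Qed.

Lemma fraction_add W f g : fraction_on W f -> fraction_on W g ->
  fraction_on W (fun x => f x + g x).
Proof.
move=> [a [b [ha hb hf]]] [c [d [hc hd hg]]].
exists (fun x => a x * d x + c x * b x), (fun x => b x * d x).
split; [by apply: GenAdd; apply: GenMul | exact: GenMul|] => x Wx.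
have [b0 ->] := hf x Wx; have [d0 ->] := hg x Wx.
by rewrite mulf_neq0 //; split=> //; rewrite addf_div.
Qed.

Lemma fraction_mul W f g : fraction_on W f -> fraction_on W g ->
  fraction_on W (fun x => f x * g x).
Proof.
move=> [a [b [ha hb hf]]] [c [d [hc hd hg]]].
exists (fun x => a x * c x), (fun x => b x * d x).
split; [exact: GenMul | exact: GenMul|] => x Wx.
have [b0 ->] := hf x Wx; have [d0 ->] := hg x Wx.
by rewrite mulf_neq0 //; split=> //; rewrite mulf_div.
Qed.

Lemma fraction_sum W (J : Type) (r : seq J) (F : J -> T -> K) :
  (forall j, fraction_on W (F j)) -> fraction_on W (fun x => \sum_(j <- r) F j x).
Proof.
move=> hF; elim: r => [|j r IH].
  rewrite (_ : (fun _ => _) = fun=> 0); first by apply: fraction_alg; apply: GenConst.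
  by apply: funext => x; rewrite big_nil.
rewrite (_ : (fun _ => _) = fun x => F j x + \sum_(i <- r) F i x).
  exact: fraction_add.
by apply: funext => x; rewrite big_cons.
Qed.

Lemma fraction_sub W W' f : W' `<=` W -> fraction_on W f -> fraction_on W' f.
Proof. by move=> h [a [b [ha hb hf]]]; exists a, b; split=> // x /h /hf. Qed.

Lemma zariski_open D a : alg a -> opens (zariski D gens) [set x | D x /\ a x != 0].
Proof.
move=> ha; exists [set a]; first by move=> _ ->.
apply/seteqP; split=> x [Dx h]; split=> //; first by exists a.
by case: h => _ ->.
Qed.

Lemma zariski_openT D : opens (zariski D gens) D.
Proof.
exists [set fun=> 1]; first by move=> _ ->; apply: GenConst.
apply/seteqP; split=> x; last by case.
by move=> Dx; split=> //; exists (fun=> 1) => //; rewrite oner_eq0.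
Qed.

Lemma fraction_regular D W f : opens (zariski D gens) W -> fraction_on W f ->
  regular (zariski D gens) W f.
Proof.
move=> oW [a [b [ha hb hf]]] /= x Wx.
by exists W, a, b; split.
Qed.

End GeneratedAlgebra.

Section Morphisms.
Variable K : fieldType.

Lemma morphism_comp (T T' T'' : Type) (X : Defs.space K T) (Y : Defs.space K T')
    (Z : Defs.space K T'') f g :
  morphism X Y f -> morphism Y Z g -> morphism X Z (g \o f).
Proof.
move=> [f1 f2 f3] [g1 g2 g3].
have E U : (g \o f) @^-1` U `&` points X = f @^-1` (g @^-1` U `&` points Y) `&` points X.
  apply/seteqP; split=> x /=; first by move=> [h Xx]; split=> //; split=> //; apply: f1.
  by move=> [[h _] Xx].
split.
- by move=> x /f1 /g1.
- by move=> U /g2 /f2; rewrite E.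
- by move=> U h oU rU; rewrite E; apply: (f3 _ (h \o g)); [apply: g2 | apply: g3].
Qed.

Lemma pullback_alg (T T' : Type) (gens : set (T -> K)) (gens' : set (T' -> K))
    (f : T -> T') :
  (forall a, gens' a -> generated_algebra gens (a \o f)) ->
  forall a, generated_algebra gens' a -> generated_algebra gens (a \o f).
Proof.
move=> h a; elim=> [c|b /h //|b c _ hb _ hc|b c _ hb _ hc].
- exact: GenConst.
- exact: (GenAdd hb hc).
- exact: (GenMul hb hc).
Qed.

Lemma zariski_morphism (T T' : Type) (D : set T) (gens : set (T -> K)) (D' : set T')
    (gens' : set (T' -> K)) (f : T -> T') :
  (forall x, D x -> D' (f x)) ->
  (forall a, gens' a -> generated_algebra gens (a \o f)) ->
  morphism (zariski D gens) (zariski D' gens') f.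
Proof.
move=> fD /pullback_alg hf.
have op U : opens (zariski D' gens') U -> opens (zariski D gens) (f @^-1` U `&` D).
  move=> [S hS ->]; exists [set a \o f | a in S]; first by move=> _ [a /hS /hf ? <-].
  apply/seteqP; split=> x /=.
    by move=> [[_ [a Sa ax]] Dx]; split=> //; exists (a \o f) => //; exists a.
  by move=> [Dx [_ [a Sa <-] ax]]; split=> //; split; [apply: fD | exists a].
split=> // U h oU rU /= x [Ux Dx].
have [W [a [b [oW Wx WU [ha hb] hW]]]] := rU _ Ux.
exists (f @^-1` W `&` D), (a \o f), (b \o f); split=> //.
- exact: op.
- by move=> y [/WU ? ?].
- by split; apply: hf.
- by move=> y [/hW].
Qed.

Lemma quotient_morphism (T T' : Type) (X : Defs.space K T) (pi : T -> T') :
  morphism X (quotient_space X pi) pi.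
Proof. by split=> [x Xx|U [_]|U h _]; first by exists x. Qed.

Lemma subspace_morphism (T T' : Type) (D : set T) (gens : set (T -> K))
    (Y : Defs.space K T')
    (A : set T') f :
  morphism (zariski D gens) Y f -> (forall x, D x -> A (f x)) ->
  morphism (zariski D gens) (subspace Y A) f.
Proof.
move=> [f1 f2 f3] fA; split.
- by move=> x Dx; split; [apply: f1 | apply: fA].
- move=> _ [U oU <-].
  rewrite (_ : _ `&` _ = f @^-1` U `&` points (zariski D gens)); first exact: f2.
  apply/seteqP; split=> x [] /=; first by move=> [].
  by move=> Ux Dx; split=> //; split=> //; apply: fA.
- move=> U h oU rU /= x [Ux Dx].
  have [W [g [oW rW Wx WU hg]]] := rU _ Ux.
  have [W' [a [b [oW' W'x W'W ab hW']]]] := f3 _ _ oW rW x (conj Wx Dx).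
  exists W', a, b; split=> //.
    by move=> y /W'W [Wy Dy]; split=> //; apply: WU; split=> //; apply: fA.
  move=> y W'y; have [? <-] := hW' _ W'y; split=> //=; have [Wy Dy] := W'W _ W'y.
  by apply: hg => //; apply: fA.
Qed.

Definition row_coordinates d : set ('rV[K]_d -> K) :=
  [set f | exists i : 'I_d, f = fun x : 'rV[K]_d => x 0 i].

Lemma fraction_comp (T : Type) (gens : set (T -> K)) (W : set T) d (t : T -> 'rV[K]_d) :
  (forall i, fraction_on gens W (fun x => t x 0 i)) ->
  forall p, generated_algebra (@row_coordinates d) p -> fraction_on gens W (p \o t).
Proof.
move=> ht p; elim=> [c|_ [i ->]|a b _ ha _ hb|a b _ ha _ hb].
- by apply: fraction_alg; apply: GenConst.
- exact: ht.
- exact: fraction_add ha hb.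
- exact: fraction_mul ha hb.
Qed.

(** The locus where [De] does not vanish is a union of fibres, so t descends to an open subset of
    the quotient. A map on A that lifts to t is then locally the restriction of functions regular on
    open sets of the whole quotient, as the induced structure requires. *)
Lemma quotient_chart_morphism (T T' : Type) (D : set T) (gens : set (T -> K)) (pi : T -> T')
    (A : set T') d (f : T' -> 'rV[K]_d) (De : T -> K) (t : T -> 'rV[K]_d) :
  generated_algebra gens De ->
  (forall i, fraction_on gens [set x | D x /\ De x != 0] (fun x => t x 0 i)) ->
  (forall x y, D x -> D y -> pi x = pi y -> De x != 0 -> De y != 0 /\ t x = t y) ->
  (forall x, D x -> A (pi x) -> De x != 0 /\ f (pi x) = t x) ->
  morphism (subspace (quotient_space (zariski D gens) pi) A) (affine_space K d) f.
Proof.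
move=> hDe ht inv hA.
pose W0 := [set x | D x /\ De x != 0].
pose lifts c x := [/\ D x, De x != 0 & pi x = c].
pose h c := if pselect (exists x, lifts c x) is left H then t (projT1 (cid H)) else 0.
have hE x : W0 x -> h (pi x) = t x.
  move=> [Dx x0]; rewrite /h; case: pselect => [H|]; last by case; exists x.
  by case: (cid H) => y [Dy y0 yx] /=; case: (inv y x Dy Dx yx y0).
(* An open set of the quotient whose trace on A is the preimage of V under f. *)
pose ext (V : set 'rV[K]_d) := [set c | (exists x, lifts c x) /\ V (h c)].
have extE V x : D x -> ext V (pi x) <-> De x != 0 /\ V (t x).
  move=> Dx; split=> [[[y [Dy y0 yx]] ]|[x0 Vx]].
    have [x0 _] := inv y x Dy Dx yx y0.
    by rewrite hE.
  by split; [exists x | rewrite hE].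
have preE V : pi @^-1` ext V `&` D = [set x | D x /\ De x != 0 /\ V (t x)].
  apply/seteqP; split=> x /=; first by move=> [h1 Dx]; split=> //; apply/extE.
  by move=> [Dx h1]; split=> //; apply/extE.
have open_ext V : opens (affine_space K d) V ->
    opens (quotient_space (zariski D gens) pi) (ext V).
  move=> [S hS VE]; split.
    by move=> c [[x [Dx _ xc]] _]; exists x.
  rewrite [points _]/= preE.
  (* If a polynomial p defining V pulls back to a/b, the product of [De] and a is a polynomial
     upstairs with the required nonvanishing locus. *)
  exists [set q | generated_algebra gens q /\ exists2 p, S p &
      forall x, D x -> q x != 0 <-> De x != 0 /\ p (t x) != 0].
    by move=> q [].
  apply/seteqP; split=> x /=.
    move=> [Dx [x0]]; rewrite VE => -[_ [p Sp px]]; split=> //.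
    have [a [b [ha hb hab]]] := fraction_comp ht (hS _ Sp).
    exists (fun x => De x * a x).
      split; first exact: GenMul.
      exists p => // y Dy; rewrite mulf_eq0 negb_or; split=> [/andP[y0 ay]|[y0 py]].
        split=> //; have [b0 E] := hab y (conj Dy y0); rewrite /= in E.
        by rewrite E mulf_neq0 ?invr_eq0.
      have [b0 E] := hab y (conj Dy y0); rewrite /= in E.
      by rewrite y0; move: py; rewrite E mulf_eq0 negb_or => /andP[].
    have [b0 E] := hab x (conj Dx x0); rewrite /= in E.
    by rewrite mulf_neq0 //; move: px; rewrite E mulf_eq0 negb_or => /andP[].
  move=> [Dx [q [hq [p Sp hp]] qx]]; have [x0 px] := (hp x Dx).1 qx.
  by split=> //; split=> //; rewrite VE; split=> //; exists p.
have traceE V : f @^-1` V `&` points (subspace (quotient_space (zariski D gens) pi) A) =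
    ext V `&` A.
  apply/seteqP; split=> c [].
    move=> Vc [[x Dx xc] Ac]; rewrite -xc in Ac Vc *; have [x0 fE] := hA x Dx Ac.
    by split=> //; apply/extE => //; split=> //; rewrite -fE.
  move=> [[x [Dx x0 xc]] Vc] Ac; rewrite -xc in Ac Vc *; have [_ fE] := hA x Dx Ac.
  split; first by rewrite /= fE -hE.
  by split=> //; exists x.
split=> //.
- by move=> V /open_ext oV; rewrite traceE; exists (ext V).
- move=> V r oV rV; rewrite traceE => c [[[x [Dx x0 xc]] Vc] Ac].
  have hx : h c = t x by rewrite -xc hE.
  have [W [a [b [oW Wx WV [ha hb] hW]]]] := rV _ Vc.
  exists (ext W), (r \o h); split=> //.
  + exact: open_ext.
  + have [_ ho] := open_ext W oW.
    apply: fraction_regular => //.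
    have [a1 [b1 [ha1 hb1 h1]]] := fraction_comp ht ha.
    have [a2 [b2 [ha2 hb2 h2]]] := fraction_comp ht hb.
    exists (fun x => a1 x * b2 x), (fun x => b1 x * a2 x); split; try exact: GenMul.
    move=> y; rewrite [points _]/= preE => -[Dy [y0 Wy]].
    have [b10 E1] := h1 y (conj Dy y0); have [b20 E2] := h2 y (conj Dy y0).
    have [by0 E3] := hW _ Wy; rewrite /= in E1 E2.
    have a20 : a2 y != 0 by move: by0; rewrite E2 mulf_eq0 negb_or => /andP[].
    split; first by rewrite mulf_neq0.
    by rewrite /= hE // E3 E1 E2 invf_div mulf_div.
  + by split=> //; exists x.
  + move=> y [[[z [Dz z0 zy]] Wy] Ay]; rewrite -[X in X y]traceE; split.
      rewrite /= -zy; rewrite -zy in Ay Wy; have [_ ->] := hA z Dz Ay.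
      by rewrite -hE //; apply: WV.
    by split=> //; exists z.
  + move=> y [[z [Dz z0 zy]] Wy] Ay; rewrite -zy in Ay *; have [_ /= ->] := hA z Dz Ay.
    by rewrite /= hE.
Qed.

End Morphisms.

(** The rows of [M] are a basis of S, obtained as a matrix of maximal rank with rows in S: a vector
    outside its row space would raise the rank. This makes the skew matrices of a cell an affine
    space. *)
Lemma subspace_coordinates (F : fieldType) (N : nat) (S : set 'rV[F]_N) :
  S 0 -> (forall c u v, S u -> S v -> S (c *: u + v)) ->
  exists d (M : 'M[F]_(d, N)) (M' : 'M[F]_(N, d)),
    [/\ M *m M' = 1%:M, forall t, S (t *m M) & forall r, S r -> r *m M' *m M = r].
Proof.
move=> S0 SL.
pose ok d := `[< exists M : 'M[F]_(d, N), row_free M /\ forall i, S (row i M) >].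
have ok0 : exists d, ok d.
  exists 0%N; apply/asboolP; exists 0; split; last by case.
  by rewrite /row_free mxrank0.
have okN d : ok d -> (d <= N)%N.
  by move=> /asboolP[M [fM _]]; have := rank_leq_col M; rewrite (eqP fM).
case: (ex_maxnP ok0 okN) => d /asboolP[M [fM SM]] dmax.
have lin (m : nat) (A : 'M[F]_(m, N)) : (forall i, S (row i A)) -> forall t, S (t *m A).
  move=> hA t; rewrite mulmx_sum_row; apply: (big_ind S) => //.
    by move=> u v Su Sv; rewrite -[u]scale1r; apply: SL.
  by move=> i _; rewrite -[_ *: _]addr0; apply: SL.
exists d, M, (pinvmx M); split; first by rewrite -[LHS]mul1mx mulmxA mulmxKp.
  exact: lin.
move=> r Sr; apply: mulmxKpV; apply: contraT => nr.
suff : ok d.+1 by move=> /dmax; rewrite ltnn.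
apply/asboolP; exists (col_mx r M); split.
  have rE : \rank (col_mx r M) = \rank (r + M)%MS by rewrite addsmxE.
  rewrite /row_free eqn_leq rank_leq_row /= rE.
  have : (\rank M < \rank (r + M)%MS)%N.
    apply: rank_ltmx; rewrite ltmxE addsmxSr /=; apply: contra nr => h.
    by apply: submx_trans h; apply: addsmxSl.
  by rewrite (eqP fM).
move=> i; case: (split_ordP (i : 'I_(1 + d))) => j ->.
  have rj : row j r = r by apply/matrixP => a t; rewrite mxE !ord1.
  by change (S (row (lshift d j) (col_mx r M))); rewrite rowKu rj.
by change (S (row (rshift 1 j) (col_mx r M))); rewrite rowKd.
Qed.

(** * Ratios of minors *)

Section Minors.
Variables (K : closedFieldType) (V : lmodType K) (I : choiceType) (e : I -> V).
Hypothesis hb : is_basis e.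
Local Notation co := (coord e).
Local Notation sp := (spans e).
Variable A : seq I.
Hypothesis uA : uniq A.
Local Notation nthA := (tnth (in_tuple A)).

Definition submatrix (h : V -> V) : 'M[K]_(size A) :=
  \matrix_(a, b) co (nthA a) (h (e (nthA b))).

Definition subrow (i : I) (h : V -> V) : 'rV[K]_(size A) :=
  \row_b co i (h (e (nthA b))).

Let nthA_inj : injective nthA.
Proof. by apply/injectiveP; rewrite /injectiveb /dinjectiveb map_inj_uniq ?enum_uniq //;
  apply/tuple_uniqP. Qed.

Lemma nthA_mem a : nthA a \in A.
Proof. exact: mem_tnth. Qed.

Let expand h1 h2 i b : linear h1 ->
  (forall j, j \in A -> sp (fun t => t \in A) (h2 (e j))) ->
  co i (h1 (h2 (e (nthA b)))) =
  \sum_c co i (h1 (e (nthA c))) * co (nthA c) (h2 (e (nthA b))).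
Proof.
move=> l1 h2A; rewrite (coord_image hb i l1 uA (h2A _ (nthA_mem b))) big_tnth.
by apply: eq_bigr => c _; rewrite mulrC.
Qed.

Lemma submatrix_comp h1 h2 : linear h1 ->
  (forall j, j \in A -> sp (fun t => t \in A) (h2 (e j))) ->
  submatrix (h1 \o h2) = submatrix h1 *m submatrix h2.
Proof.
move=> l1 h2A; apply/matrixP => a b; rewrite !mxE; apply: (etrans (expand _ _ l1 h2A)).
by apply: eq_bigr => c _; rewrite !mxE.
Qed.

Lemma subrow_comp i h1 h2 : linear h1 ->
  (forall j, j \in A -> sp (fun t => t \in A) (h2 (e j))) ->
  subrow i (h1 \o h2) = subrow i h1 *m submatrix h2.
Proof.
move=> l1 h2A; apply/matrixP => a b; rewrite !mxE; apply: (etrans (expand _ _ l1 h2A)).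
by apply: eq_bigr => c _; rewrite !mxE.
Qed.

Lemma submatrix_id : submatrix id = 1%:M.
Proof.
apply/matrixP => a b; rewrite !mxE coord_basis // (inj_eq nthA_inj).
by case: eqP.
Qed.

(** The compression of u to [A] is itself unipotent triangular and preserves the span of [A], so its
    inverse provides the inverse matrix. *)
Lemma submatrix_unitri le r u : total_order le -> (forall i j, r i j -> strict le i j) ->
  unitri e r u -> submatrix u \in unitmx.
Proof.
move=> tle rle hu.
have [w lw wE] := basis_map hb (fun i => if i \in A then
  \sum_(a <- A) co a (u (e i)) *: e a else e i).
have cw i j : j \in A -> i \in A -> co i (w (e j)) = co i (u (e j)).
  move=> jA iA; rewrite wE jA coord_bigsum // (bigD1_seq i) //= coordZ // coord_basis //.
  rewrite eqxx mulr1 big1 ?addr0 // => t ti.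
  by rewrite coordZ // coord_basis // eq_sym (negPf ti) mulr0.
have wA j : j \in A -> sp (fun t => t \in A) (w (e j)).
  move=> jA; rewrite wE jA; apply: spans_sum => // a aA.
  by apply: spans_scale => //; apply: spans_basis.
have hw : unitri e (strict le) w.
  move=> j; case: (boolP (j \in A)) => jA; last first.
    by rewrite wE (negPf jA) subrr; apply: spans_zero.
  move=> i; rewrite coordB // => hi.
  have iA : i \in A.
    apply: contraT => niA; move: hi; rewrite coord_basis //.
    have [ij|_] := eqVneq i j; first by rewrite ij jA in niA.
    rewrite subr0 => /(wA j jA); by rewrite (negPf niA).
  by apply/rle/hu; rewrite coordB // -cw.
have fw : finitary e w.
  by apply: (unitri_finitary hb tle _ lw _ hw) => //; exists A => i /negPf iA;
    rewrite wE iA.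
have [w' [[lw' _ _] wK w'K]] := finitary_inverse fw.
have E : submatrix w' *m submatrix w = 1%:M.
  rewrite -submatrix_comp // -submatrix_id; congr submatrix.
  by apply: funext => v /=; rewrite wK.
have -> : submatrix u = submatrix w.
  by apply/matrixP => a b; rewrite !mxE cw ?nthA_mem.
by have [] := mulmx1_unit E.
Qed.

(** Row i of h restricted to the columns [A], times the inverse of the [A]-block of h; the sum only
    selects the column of j. The adjugate displays it as a quotient of polynomials. *)
Definition chart_coord (i j : I) (h : V -> V) : K :=
  \sum_(b < size A | nthA b == j)
     (subrow i h *m \adj (submatrix h)) 0 b / \det (submatrix h).

Lemma chart_coordE i j h : submatrix h \in unitmx ->
  chart_coord i j h = \sum_(b < size A | nthA b == j)
    (subrow i h *m invmx (submatrix h)) 0 b.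
Proof.
move=> hu; apply: eq_bigr => b _; rewrite /invmx hu -scalemxAr [in RHS]mxE.
by rewrite mulrC.
Qed.

Lemma submatrix_stable_unit h h' : linear h' -> cancel h h' ->
  (forall j, j \in A -> sp (fun t => t \in A) (h (e j))) -> submatrix h \in unitmx.
Proof.
move=> lh' hK hA; have E : submatrix h' *m submatrix h = 1%:M.
  rewrite -submatrix_comp // -submatrix_id; congr submatrix.
  by apply: funext => v /=; rewrite hK.
by have [] := mulmx1_unit E.
Qed.

(** When p preserves the span of [A], the row and the block are both multiplied on the right by the
    block of p, which cancels. *)
Lemma chart_coord_invariant i j h p : linear h ->
  (forall j, j \in A -> sp (fun t => t \in A) (p (e j))) -> submatrix p \in unitmx ->
  submatrix h \in unitmx -> chart_coord i j (h \o p) = chart_coord i j h.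
Proof.
move=> lh pA pu hu; rewrite !chart_coordE //; last by rewrite submatrix_comp //
  unitmx_mul hu.
apply: eq_bigr => b _; congr (_ 0 b); rewrite submatrix_comp // subrow_comp //.
have -> : invmx (submatrix h *m submatrix p) = invmx (submatrix p) *m invmx (submatrix h).
  have hpu : submatrix h *m submatrix p \in unitmx by rewrite unitmx_mul hu.
  apply: (can_inj (mulKmx hpu)).
  by rewrite /= mulmxV // mulmxA mulmxK // mulmxV.
by rewrite mulmxA mulmxK.
Qed.

(** No index of [A] is related to j, so column j of the block is a unit vector and the inverse
    matrix fixes it; the entry of u itself remains. *)
Lemma chart_coord_unitri r i j u : j \in A -> (forall t, t \in A -> ~ r t j) ->
  (forall t, ~ r t t) -> unitri e r u -> submatrix u \in unitmx ->
  chart_coord i j u = co i (u (e j)).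
Proof.
move=> jA rA ir hu uu; have /seq_tnthP[b0 jb] := jA.
rewrite chart_coordE // (bigD1 b0) /=; last by rewrite jb.
rewrite big1 ?addr0; last first.
  by move=> b /andP[/eqP h]; rewrite -(inj_eq nthA_inj) h jb eqxx.
have colX (X : 'rV[K]_(size A)) : X 0 b0 = (X *m delta_mx b0 (0 : 'I_1)) 0 0.
  by rewrite -colE mxE.
have hcol : submatrix u *m delta_mx b0 (0 : 'I_1) = delta_mx b0 0.
  rewrite -colE; apply/matrixP => a c; rewrite !mxE (ord1 c) eqxx andbT.
  have [->|nab] := eqVneq a b0; first exact: unitri_diag hu.
  apply/eqP; apply: contraT => h0.
  have na : nthA a <> nthA b0 by move=> /nthA_inj /eqP; rewrite (negPf nab).
  have := unitri_off hb hu na h0; rewrite -jb => /rA; case.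
  exact: nthA_mem.
rewrite colX -mulmxA (canLR (mulKmx uu) (esym hcol)) -colX mxE.
by rewrite -jb.
Qed.

End Minors.

Section IterateAlgebra.
Variables (K : fieldType) (V : lmodType K) (T : Type) (Al : (T -> K) -> Prop).
Hypothesis Al_const : forall c, Al (fun=> c).
Hypothesis Al_mul : forall f g, Al f -> Al g -> Al (fun x => f x * g x).
Hypothesis Al_sum : forall (N : nat) (F : 'I_N -> T -> K), (forall l, Al (F l)) ->
  Al (fun x => \sum_(l < N) F l x).
Variables (N : nat) (t : 'I_N -> T -> K) (z : 'I_N -> V -> V).
Hypothesis lz : forall l, linear (z l).
Hypothesis At : forall l, Al (t l).

Definition combination x (v : V) := \sum_(l < N) t l x *: z l v.

Lemma linear_combination x : linear (combination x).
Proof. by apply: (@linear_bigsum K V _ _ (fun l v => t l x *: z l v)) => l;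
  apply: linear_mulz. Qed.

(** The induction absorbs each [z l] into the functional. [Al] stands for the polynomials on an
    affine space in one use and for fractions on an open set in the other. *)
Lemma iter_combination n (phi : V -> K) v : scalar phi ->
  Al (fun x => phi (iter n (combination x) v)).
Proof.
elim: n phi => [|n IH] phi lphi /=; first exact: Al_const.
rewrite (_ : (fun _ => _) = fun x => \sum_(l < N) t l x * phi (z l (iter n
  (combination x) v))).
  apply: Al_sum => l; apply: Al_mul => //; apply: (IH (phi \o z l)).
  exact: scalar_comp.
apply: funext => x; rewrite {1}/combination (scal_sum lphi).
by apply: eq_bigr => l _; rewrite (scal_scale lphi).
Qed.

Lemma neumann_combination n (phi : V -> K) v : scalar phi ->
  Al (fun x => phi (neumann n (combination x) v)).
Proof.
move=> lphi; rewrite (_ : (fun _ => _) = fun x => \sum_(m < n) phi (iter m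
  (combination x) v)).
  by apply: Al_sum => m; apply: iter_combination.
by apply: funext => x; rewrite (scal_sum lphi).
Qed.

Lemma combination_neumann n (phi : V -> K) v : scalar phi ->
  Al (fun x => phi (combination x (neumann n (combination x) v))).
Proof.
move=> lphi.
rewrite (_ : (fun _ => _) = fun x => \sum_(m < n) phi (iter m.+1 (combination x) v)).
  by apply: Al_sum => m; apply: iter_combination.
apply: funext => x; rewrite /neumann (lin_sum (linear_combination x)) (scal_sum lphi).
exact: eq_bigr.
Qed.

End IterateAlgebra.

(** * The Cayley transform on a finite cell *)

Section Cayley.
Variables (K : closedFieldType) (V : lmodType K) (I : choiceType) (e : I -> V).
Hypothesis hb : is_basis e.
Local Notation co := (coord e).
Local Notation sp := (spans e).
Variables (E : nat -> set I) (k : group_kind V I).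
Hypothesis adm : admissible e E k.
Hypothesis two0 : 2%:R != 0 :> K.
Local Notation G := (ambient_group e k).
Variables (le : rel I) (r : I -> I -> Prop) (L : seq (I * I)).
Hypotheses (tle : total_order le) (rle : forall i j, r i j -> strict le i j).
Hypothesis rtrans : forall i j l, r i j -> r j l -> r i l.
Hypotheses (uL : uniq L) (hL : forall i j, (i, j) \in L <-> r i j).
Local Notation N := (size L).
Local Notation Lr l := (tnth (in_tuple L) l).1.
Local Notation Lc l := (tnth (in_tuple L) l).2.
Local Notation n0 := (size [seq p.2 | p <- L]).+1.

Definition elementary (l : 'I_N) (v : V) := co (Lc l) v *: e (Lr l).

Definition nilp (t : 'rV[K]_N) (v : V) := \sum_(l < N) t 0 l *: elementary l v.

Definition entries (x : V -> V) : 'rV[K]_N := \row_l co (Lr l) (x (e (Lc l))).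

(** This is (1 + x)/(1 - x) for x = [nilp t]; the length [n0] of the series comes from
    [strict_nilpotent]. *)
Definition cayley (t : 'rV[K]_N) (v : V) :=
  neumann n0 (nilp t) v + nilp t (neumann n0 (nilp t) v).

Definition half_opp (t : 'rV[K]_N) := - 2%:R^-1 *: t.

(** This is (u - 1)/(u + 1), where t lists the entries of u - 1: with y = -(u - 1)/2, it equals
    -y/(1 - y). *)
Definition inverse_cayley (t : 'rV[K]_N) (v : V) :=
  - nilp (half_opp t) (neumann n0 (nilp (half_opp t)) v).

Lemma linear_elementary l : linear (elementary l).
Proof. by move=> c u v; rewrite /elementary coord_lin // scalerDl scalerA. Qed.

Lemma linear_nilp t : linear (nilp t).
Proof.
apply: (@linear_bigsum K V _ _ (fun l v => t 0 l *: elementary l v)) => l.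
by apply: linear_mulz; apply: linear_elementary.
Qed.

Let Lmem l : r (Lr l) (Lc l).
Proof. by apply/hL; rewrite -surjective_pairing; apply: mem_tnth. Qed.

Let Linj i j : r i j -> exists l, i = Lr l /\ j = Lc l.
Proof. by move=> /hL /seq_tnthP[l hl]; exists l; rewrite -hl. Qed.

Let tnth_injL (a b : 'I_N) : Lr a = Lr b -> Lc a = Lc b -> a = b.
Proof.
move=> h1 h2; have : tnth (in_tuple L) a = tnth (in_tuple L) b.
  by rewrite [LHS]surjective_pairing [RHS]surjective_pairing h1 h2.
by move: a b {h1 h2}; apply/tuple_uniqP.
Qed.

Lemma nilp_tri t j : sp (r^~ j) (nilp t (e j)).
Proof.
apply: spans_sum => // l _; apply: spans_scale => //; rewrite /elementary coord_basis //.
case: (Lc l =P j) => [<-|_]; last by rewrite scale0r; apply: spans_zero.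
by apply: spans_scale => //; apply: spans_basis => //; apply: Lmem.
Qed.

Arguments nilp_tri : clear implicits.

Lemma entries_nilp t : entries (nilp t) = t.
Proof.
apply/rowP => l; rewrite mxE coord_bigsum // (bigD1 l) //= coordZ // coordZ //.
rewrite !coord_basis // !eqxx !mulr1 big1 ?addr0 // => a nal.
rewrite !coordZ // !coord_basis //; case: (Lc a =P Lc l) => [h1|];
  last by rewrite !(mul0r, mulr0).
case: (Lr l =P Lr a) => [h2|]; last by rewrite !mulr0.
by case/eqP: nal; apply: tnth_injL.
Qed.

Lemma nilp_entries x : linear x -> (forall j, sp (r^~ j) (x (e j))) -> nilp (entries x) = x.
Proof.
move=> lx hx; apply: (linear_ext hb (linear_nilp _) lx) => j.
apply: (coord_ext hb) => i; case: (pselect (r i j)) => rij.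
  have [l [-> ->]] := Linj rij.
  by have := congr1 (fun M : 'rV_N => M 0 l) (entries_nilp (entries x)); rewrite !mxE.
have z w : sp (r^~ j) w -> co i w = 0.
  by move=> hw; apply/eqP; apply: contraT => /hw.
by rewrite !z //; apply: nilp_tri.
Qed.

Lemma nilp_lin c t t' v : nilp (c *: t + t') v = c *: nilp t v + nilp t' v.
Proof.
rewrite /nilp scaler_sumr -big_split; apply: eq_bigr => l _ /=.
by rewrite !mxE scalerDl scalerA.
Qed.

Lemma nilp_half t v : nilp (half_opp t) v = - 2%:R^-1 *: nilp t v.
Proof.
rewrite /half_opp -[_ *: t]addr0 nilp_lin (_ : nilp 0 v = 0) ?addr0 //.
by rewrite /nilp big1 // => l _; rewrite mxE scale0r.
Qed.

Let nilp0 t i : i \notin [seq p.2 | p <- L] -> nilp t (e i) = 0.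
Proof.
move=> hi; rewrite /nilp big1 // => l _; rewrite /elementary coord_basis //.
case: (Lc l =P i) => [h|]; last by rewrite scale0r scaler0.
by move: hi; rewrite -h map_f // mem_tnth.
Qed.

Lemma nilp_nilpotent t v : iter n0 (nilp t) v = 0.
Proof.
have [rl al tl _] := tle.
apply: (strict_nilpotent hb tl al (linear_nilp t) (nilp0 t)) => j.
by apply: (spans_sub_set (nilp_tri t j) _) => i /rle.
Qed.

Lemma cayleyE t v : cayley t (v - nilp t v) = v + nilp t v.
Proof. by rewrite /cayley (neumannVK (linear_nilp t) (nilp_nilpotent t v)). Qed.

Let bij_sub t : bijective (fun v => v - nilp t v).
Proof. exact: one_sub_bij (linear_nilp t) (nilp_nilpotent t). Qed.

Lemma linear_cayley t : linear (cayley t).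
Proof.
have ln := linear_neumann n0 (linear_nilp t).
by apply: linear_add => //; apply: (linear_comp (linear_nilp t) ln).
Qed.

Lemma cayley_unitri t : unitri e r (cayley t).
Proof.
have lt := linear_nilp t; pose a v := v - nilp t v; pose b v := v + nilp t v.
have la : linear a by move=> c u v; rewrite /a lt opprD addrACA scalerBr.
have lb : linear b by apply: linear_add.
have ha : unitri e r a.
  by move=> j; rewrite /a addrAC subrr add0r; apply: spans_opp => //; apply: nilp_tri.
have hbb : unitri e r b.
  by move=> j; rewrite /b addrAC subrr add0r; apply: nilp_tri.
have fa : finitary e a.
  apply: (unitri_finitary hb tle rle la _ ha).
  by exists [seq p.2 | p <- L] => i /(nilp0 t) h; rewrite /a h subr0.
have aK : cancel a (neumann n0 (nilp t)).
  by move=> v; apply: neumannVK (nilp_nilpotent t v).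
have Ka : cancel (neumann n0 (nilp t)) a.
  by move=> v; apply: neumannK (nilp_nilpotent t v).
have hn := unitri_inverse hb rtrans fa aK Ka ha.
exact: (unitri_comp hb lb rtrans hbb hn).
Qed.

Arguments cayley_unitri : clear implicits.

Lemma cayley_ambient t : skew k (nilp t) -> G (cayley t).
Proof.
move=> sk; apply/ambientP; split.
  apply: (unitri_finitary hb tle rle (linear_cayley t) _ (cayley_unitri t)).
  exists [seq p.2 | p <- L] => i /(nilp0 t) h; rewrite -{1}[e i]subr0 -h cayleyE h.
  by rewrite addr0.
exact: (cayley_preserving adm (linear_nilp t) (bij_sub t) (cayleyE t) sk).
Qed.

Let entries_opp1 u : unitri e r u -> linear u ->
  (fun v => u v - v) = nilp (entries (fun v => u v - v)).
Proof.
move=> hu lu; rewrite nilp_entries // => c v w.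
by rewrite lu opprD addrACA scalerBr.
Qed.

Lemma inverse_cayleyE u v : linear u -> unitri e r u ->
  inverse_cayley (entries (fun v => u v - v)) (v + u v) = u v - v.
Proof.
move=> lu hu; set t := entries _; pose y := nilp (half_opp t).
have ly : linear y by apply: linear_nilp.
have yE w : u w - w = - (2%:R *: y w).
  rewrite -[u w - w]/((fun v => u v - v) w) (entries_opp1 hu lu) -/t /y nilp_half.
  by rewrite scalerA mulrN divff // scaleN1r opprK.
have -> : v + u v = 2%:R *: (v - y v).
  rewrite scalerBr -[u v](subrK v) yE addrA addrAC [in RHS]scaler_nat mulr2n.
  by rewrite -addrA addrC -!addrA [- _ + _]addrC addrA.
rewrite /inverse_cayley -/y (lin_scale (linear_neumann _ ly)).
rewrite (neumannVK ly (nilp_nilpotent _ _)) (lin_scale ly) yE.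
by [].
Qed.

Lemma linear_inverse_cayley t : linear (inverse_cayley t).
Proof.
have ly := linear_nilp (half_opp t).
have := linear_comp ly (linear_neumann n0 ly) => h c u v.
have := h c u v; rewrite /inverse_cayley /= => ->.
by rewrite opprD scalerN.
Qed.

Lemma inverse_cayley_tri t j : sp (r^~ j) (inverse_cayley t (e j)).
Proof.
set y := half_opp t; apply: spans_opp => //.
rewrite /neumann (lin_sum (linear_nilp y)); apply: spans_sum => // m _.
elim: (m : nat) => [|a IH] /=; first exact: nilp_tri.
apply: (spans_lin hb (linear_nilp y) _ IH) => i ij.
by apply: (spans_sub_set (nilp_tri y i) _) => l li; apply: rtrans li ij.
Qed.

Let two_half (v : V) : 2%:R *: (2%:R^-1 *: v) = v.
Proof. by rewrite scalerA divff // scale1r. Qed.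

(** As u - 1 is nilpotent and 2 is invertible, 1 + u = 2 (1 - y) is bijective. The transform
    therefore reaches every unipotent isometry supported on the cell. *)
Lemma cayley_inverse_cayley u : G u -> unitri e r u ->
  let t := entries (inverse_cayley (entries (fun v => u v - v))) in
  skew k (nilp t) /\ cayley t = u.
Proof.
move=> /ambientP[[lu bu _] pu] hu.
set x := inverse_cayley _; set t := entries x => /=.
have lx : linear x by apply: linear_inverse_cayley.
have xE v : x (v + u v) = u v - v by apply: inverse_cayleyE.
have tE : nilp t = x by apply: nilp_entries => // j; apply: inverse_cayley_tri.
have ly := linear_nilp (half_opp (entries (fun v => u v - v))).
have ph v : v + u v = 2%:R *: (v - nilp (half_opp (entries (fun v => u v - v))) v).
  rewrite nilp_half -(entries_opp1 hu lu) scaleNr opprK scalerDr two_half.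
  by apply: (coord_ext hb) => i; rewrite !(coordD, coordZ, coordN) //; ring.
have bplus : bijective (fun v => v + u v).
  have [g gK Kg] := bij_sub (half_opp (entries (fun v => u v - v))).
  exists (fun v => g (2%:R^-1 *: v)) => v; first by rewrite ph scalerA mulVf // scale1r gK.
  by rewrite ph Kg two_half.
split; first by rewrite tE; apply: (cayley_skew adm lu bplus xE pu).
have [g gK Kg] := bij_sub t; apply: funext => w.
have [h hK Kh] := bplus.
rewrite -[w]Kg; set v := g w; rewrite cayleyE tE -[v]Kh; set z := h v.
rewrite xE.
have -> : z + u z + (u z - z) = 2%:R *: u z.
  by apply: (coord_ext hb) => i; rewrite !(coordD, coordZ, coordN) //; ring.
have -> : z + u z - (u z - z) = 2%:R *: z.
  by apply: (coord_ext hb) => i; rewrite !(coordD, coordZ, coordN) //; ring.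
by rewrite (lin_scale lu).
Qed.

Lemma entries_cayley t :
  entries (inverse_cayley (entries (fun v => cayley t v - v))) = t.
Proof.
rewrite -[RHS]entries_nilp; congr entries; apply: funext => v.
set u := cayley t; set x := inverse_cayley _.
have lx : linear x by apply: linear_inverse_cayley.
have xE w : x (w + u w) = u w - w.
  by apply: inverse_cayleyE; [apply: linear_cayley | apply: cayley_unitri].
have := xE (v - nilp t v); rewrite /u cayleyE.
have -> : v - nilp t v + (v + nilp t v) = 2%:R *: v.
  by apply: (coord_ext hb) => i; rewrite !(coordD, coordZ, coordN) //; ring.
have -> : v + nilp t v - (v - nilp t v) = 2%:R *: nilp t v.
  by apply: (coord_ext hb) => i; rewrite !(coordD, coordZ, coordN) //; ring.
rewrite (lin_scale lx) => h.
by rewrite -[LHS]scale1r -[RHS]scale1r -(mulVf two0) -!scalerA h.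
Qed.

End Cayley.

(** * Finite cells are affine spaces *)

Section Charts.
Variables (K : closedFieldType) (V : lmodType K) (I : choiceType) (e : I -> V).
Hypothesis hb : is_basis e.
Local Notation co := (coord e).
Local Notation sp := (spans e).
Variables (E : nat -> set I) (k : group_kind V I).
Hypothesis hE : is_filtration E.
Hypothesis adm : admissible e E k.
Hypothesis two0 : 2%:R != 0 :> K.
Local Notation G := (ambient_group e k).
Variables (P : set (V -> V)) (le0 : rel I).
Hypotheses (gP : is_group P) (PG : P `<=` G) (cle0 : compatible_order k le0).
Hypothesis BP : forall g, G g -> tri e le0 g -> P g.
Variable le : rel I.
Hypothesis cle : compatible_order k le.
Local Notation R := (gen_rel e P).
Local Notation B := (order_stabilizer e k le).
Local Notation cellr := (cell_rel e P le).
Local Notation mono := (monomial_element e k).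
Local Notation orbit := (orbit_of e k P le).
Local Notation level := (level e E k).
Local Notation alg := (generated_algebra (matrix_coefficients (V := V))).
Local Notation frac := (fraction_on (matrix_coefficients (V := V))).

Let PP := parabolicP hb adm two0 gP PG cle0 BP.

Lemma matrix_coefficient_alg (phi : V -> K) v : scalar phi -> alg (fun g => phi (g v)).
Proof. by move=> lphi; apply: GenBase; exists phi, v. Qed.

(* The coordinates on the big cell w U^- P of G/P are ratios of minors: the
   column j of u is the vector of u p (span A) = g n^{-1} (span A) whose
   projection to span A is e j, where span A is stable under n P n^{-1}. *)
Lemma chart_exists n s s' N j : mono n s s' -> level N n -> E N j ->
  exists (De : (V -> V) -> K) (F : (V -> V) -> I -> K),
  [/\ alg De,
      forall i, frac [set g | De g != 0] (F^~ i),
      forall g1 g2, level N g1 -> level N g2 -> coset P g1 = coset P g2 ->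
        De g1 != 0 -> De g2 != 0 /\ F g1 = F g2 &
      forall u, level N u -> unitri e (cellr s') u ->
        De (u \o n) != 0 /\ forall i, F (u \o n) i = co i (u (e j))].
Proof.
move=> hn Nn Ej; have [Gn mn sK s'K] := hn.
have [n' [Gn' nK n'K]] := ambient_inverse Gn.
have lin g : G g -> linear g by apply: ambient_linear.
have Nn' : level N n' by apply: level_cancel Nn nK n'K.
(* [A] spans the level N part of the smallest coordinate subspace through j stable under n P n^-1. A
   cell entry (t, j) has t outside [A], so the minors leave column j of u untouched. *)
have [A [uA hA]] : exists A : seq I, uniq A /\
    forall x, x \in A <-> E N x /\ R (s' x) (s' j).
  have [/(_ N)/finite_seqP[t ht] _ _] := hE.
  exists [seq x <- undup t | `[<R (s' x) (s' j)>]]; rewrite filter_uniq ?undup_uniq //.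
  split=> // x; rewrite mem_filter mem_undup ht /=.
  by split=> [/andP[/asboolP]|[? ?]] //; apply/andP; split=> //; apply/asboolP.
have jA : j \in A by apply/hA; split=> //; apply: gen_rel_refl.
have tle := compatible_total cle.
have rle i i' : cellr s' i i' -> strict le i i' by case.
have detalg : alg (fun g => \det (submatrix e A (g \o n'))).
  apply: alg_det => a b.
  rewrite (_ : (fun _ => _) = fun g => co (tnth (in_tuple A) a) (g (n' (e (tnth
    (in_tuple A) b))))).
    by apply: matrix_coefficient_alg; apply: (coord_scalar hb).
  by apply: funext => g; rewrite mxE.
exists (fun g => \det (submatrix e A (g \o n'))), (fun g i =>
  chart_coord e A i j (g \o n')).
have stab p : level N p -> P p -> forall i, i \in A ->
    sp (fun t => t \in A) ((n \o p \o n') (e i)).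
  move=> Np Pp i /hA[Ei Ri] t ht; apply/hA; split.
    have : level N ((n \o p) \o n') by do 2?[apply: level_comp => //].
    by move=> /(levelP hb)[_ _ /(_ _ Ei t)]; apply.
  have [Gp tp] := (PP p).1 Pp.
  have mn' := monomial_inverse (lin _ Gn') nK mn s'K.
  have := conjugate_tri hb (r := fun x y => R (s' x) (s' y)) (lin _ Gp) (lin _ Gn)
    n'K nK mn' s'K sK.
  move=> /(_ _ i t ht) h; apply: gen_rel_trans Ri; apply: h.
  by move=> x; apply: (spans_sub_set (tp x) _) => y; rewrite !sK.
have unitE g : (submatrix e A g \in unitmx) = (\det (submatrix e A g) != 0).
  by rewrite unitmxE unitfE.
split=> //.
- move=> i.
  rewrite (_ : (fun _ => _) = fun g => \sum_(b < size A) (if tnth (in_tuple A) b == j then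
      (subrow e A i (g \o n') *m \adj (submatrix e A (g \o n'))) 0 b /
      \det (submatrix e A (g \o n')) else 0)); last first.
    by apply: funext => g; rewrite /chart_coord big_mkcond.
  apply: fraction_sum => b; case: eqP => _; last first.
    by apply: fraction_alg; apply: GenConst.
  exists (fun g => \sum_c (subrow e A i (g \o n')) 0 c *
    (\adj (submatrix e A (g \o n'))) c b).
  exists (fun g => \det (submatrix e A (g \o n'))); split=> //.
    apply: alg_sum => c; apply: GenMul.
      rewrite (_ : (fun _ => _) = fun g => co i (g (n' (e (tnth (in_tuple A) c))))).
        by apply: matrix_coefficient_alg; apply: (coord_scalar hb).
      by apply: funext => g; rewrite mxE.
    apply: alg_adj => a b'.
    rewrite (_ : (fun _ => _) = fun g => co (tnth (in_tuple A) a) (g (n' (e (tnth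
      (in_tuple A) b'))))).
      by apply: matrix_coefficient_alg; apply: (coord_scalar hb).
    by apply: funext => g; rewrite mxE.
  by move=> g; rewrite mxE.
- move=> g1 g2 N1 N2 /(cosetP gP)[p Pp gE] d1.
  have Gg2 : G g2 by case: N2.
  have [g2' [Gg2' g2K g2'K]] := ambient_inverse Gg2.
  have Np : level N p.
    have -> : p = g2' \o g1 by apply: funext => v; rewrite gE /= g2K.
    by apply: level_comp => //; apply: level_cancel N2 g2K g2'K.
  have [p' [Pp' pK p'K]] := parabolic_inverse gP Pp.
  have Gp' := PG Pp'.
  have hE12 : g1 \o n' = (g2 \o n') \o (n \o p \o n').
    by apply: funext => v; rewrite gE /= nK.
  have lg2 : linear (g2 \o n') by apply: linear_comp; apply: lin.
  have pA := stab p Np Pp.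
  have pu : submatrix e A (n \o p \o n') \in unitmx.
    apply: (submatrix_stable_unit hb uA (h' := n \o p' \o n')) => //.
      by apply: linear_comp; [apply: linear_comp; apply: lin | apply: lin].
    by move=> v /=; rewrite nK pK n'K.
  have u2 : submatrix e A (g2 \o n') \in unitmx.
    move: d1; rewrite hE12 -unitE submatrix_comp // unitmx_mul.
    by case/andP.
  split; first by rewrite -unitE.
  by apply: funext => i; rewrite hE12 chart_coord_invariant.
- move=> u Nu hu.
  have uE : (u \o n) \o n' = u by apply: funext => v /=; rewrite n'K.
  have uu := submatrix_unitri hb uA tle rle hu.
  rewrite uE -unitE; split=> // i.
  apply: (chart_coord_unitri hb uA i jA _ _ hu uu) => [t /hA[_ h] [_ _]//|t [_ h _]].
  exact: h.
Qed.

Lemma skew_zero (x : V -> V) : (forall v, x v = 0) -> skew k x.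
Proof.
move=> x0; rewrite /skew; case kE : k => [//|om iE] u v.
by rewrite !x0 (scal_zero (form_linl adm kE _)) (scal_zero (form_linr adm kE _)) addr0.
Qed.

Lemma skew_lin c (x y z : V -> V) : skew k x -> skew k y ->
  (forall v, z v = c *: x v + y v) -> skew k z.
Proof.
rewrite /skew; case kE : k => [//|om iE] hx hy zE u v.
rewrite !zE (form_linl adm kE) (form_linr adm kE) addrACA -mulrDr.
by rewrite hx hy mulr0 addr0.
Qed.

Lemma level_unitri N r u : G u -> unitri e r u -> (forall i j, r i j -> E N i /\ E N j) ->
  level N u.
Proof.
move=> Gu hu hr; apply/(levelP hb); split=> // i Ei.
  apply: (coord_ext hb) => t; apply/subr0_eq; rewrite -coordB //.
  by apply/eqP; apply: contraT => /hu /hr[_ /Ei].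
rewrite -[u (e i)](subrK (e i)); apply: spans_add => //; last exact: spans_basis.
by move=> t /hu /hr[].
Qed.

Lemma orbit_cell n s s' c : mono n s s' -> orbit n c ->
  exists u, [/\ G u, unitri e (cellr s') u & c = coset P (u \o n)].
Proof.
move=> hn [b Bb <-].
by apply: (cell_surjective hb adm two0 gP PG cle0 BP cle hn Bb).
Qed.

(** The composite of a linear parametrization of the skew matrices, the Cayley transform and the
    quotient map is bijective onto the orbit; regularity is then checked in both directions. *)
Lemma finite_cell_finite_dimensional n s s' : mono n s s' ->
  (exists L : seq (I * I), forall i j, cellr s' i j -> (i, j) \in L) ->
  finite_dimensional_orbit e E k P (orbit n).
Proof.
move=> hn [L0 hL0]; have [Gn mn sK s'K] := hn.
pose L := [seq p <- undup L0 | `[<cellr s' p.1 p.2>]].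
have uL : uniq L by rewrite filter_uniq ?undup_uniq.
have hL i j : (i, j) \in L <-> cellr s' i j.
  rewrite mem_filter mem_undup; split=> [/andP[/asboolP]//|h].
  by apply/andP; split; [apply/asboolP | apply: hL0].
clearbody L; clear L0 hL0.
have tle := compatible_total cle.
have rle i i' : cellr s' i i' -> strict le i i' by case.
have rtr := cell_rel_trans hb adm two0 cle0 BP cle (s' := s').
have S0 : skew k (nilp e (L := L) 0).
  by apply: skew_zero => v; rewrite /nilp big1 // => l _; rewrite mxE scale0r.
have SL c t t' : skew k (nilp e (L := L) t) -> skew k (nilp e (L := L) t') ->
    skew k (nilp e (c *: t + t')).
  by move=> h h'; apply: (skew_lin h h') => v; apply: nilp_lin.
(* Skewness is a linear condition on the entries, so the dimension d is that of its solution
   space. *)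
have [d [M [M' [MM' SM SM']]]] :=
  subspace_coordinates (S := fun t => skew k (nilp e (L := L) t)) S0 SL.
pose cay y := cayley e (L := L) (y *m M).
have Gcay y : G (cay y) by apply: (cayley_ambient hb adm tle rle rtr hL (SM y)).
have hcay y : unitri e (cellr s') (cay y) by apply: (cayley_unitri hb tle rle rtr hL).
pose Phi y := coset P (cay y \o n).
have PhiI : injective Phi.
  move=> y y' /(cell_injective hb adm two0 gP PG cle0 BP cle hn (Gcay y) (Gcay y')
    (hcay y) (hcay y')) cE.
  have : y *m M = y' *m M.
    rewrite -[LHS](entries_cayley hb two0 tle rle rtr uL hL).
    rewrite -[RHS](entries_cayley hb two0 tle rle rtr uL hL).
    by rewrite -/(cay y) cE.
  by move=> /(congr1 (fun X => X *m M')); rewrite -!mulmxA MM' !mulmx1.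
have PhiS c : orbit n c -> exists y, Phi y = c.
  move=> /(orbit_cell hn)[u [Gu hu ->]].
  have [sk cE] := cayley_inverse_cayley hb adm two0 tle rle rtr uL hL Gu hu.
  exists (entries e L (inverse_cayley e (entries e L (fun v => u v - v))) *m M').
  by rewrite /Phi /cay (SM' _ sk) cE.
have PhiO y : orbit n (Phi y).
  by exists (cay y) => //; apply: (cell_borel hb cle _ (hcay y)).
pose f c := if pselect (exists y, Phi y = c) is left H then projT1 (cid H) else 0.
have fK y : f (Phi y) = y.
  rewrite /f; case: pselect => [H|]; last by case; exists y.
  by apply: PhiI; case: (cid H).
have [N1 N1n] := level_ex hb hE Gn.
have [N2 N2L] := filtration_seq hE ([seq p.1 | p <- L] ++ [seq p.2 | p <- L]).
pose N0 := maxn N1 N2.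
have N0n : level N0 n by apply: (level_le hb hE _ N1n); apply: leq_maxl.
have N0L i j : cellr s' i j -> E N0 i /\ E N0 j.
  move=> /hL h; split; apply: (filtration_le hE (leq_maxr _ _)); apply: N2L.
    by rewrite mem_cat; apply/orP; left; apply/mapP; exists (i, j).
  by rewrite mem_cat; apply/orP; right; apply/mapP; exists (i, j).
exists d, f, Phi; split.
(* The target chain is constant, so index 0 will do. Charts are built at a level N that contains
   level m as well as n and the cell. *)
- move=> m; exists 0%N.
  pose N := maxn m N0.
  have Nn : level N n by apply: (level_le hb hE _ N0n); apply: leq_maxr.
  have NL i j : cellr s' i j -> E N i /\ E N j.
    by move=> /N0L[h1 h2]; split; apply: (filtration_le hE (leq_maxr _ _)).
  have mN g : level m g -> level N g by apply: (level_le hb hE); apply: leq_maxl.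
  have /choice[ch hch] : forall l : 'I_(size L),
      exists DF : ((V -> V) -> K) * ((V -> V) -> I -> K),
      [/\ alg DF.1,
      forall i, frac [set g | DF.1 g != 0] (DF.2^~ i),
      forall g1 g2, level N g1 -> level N g2 -> coset P g1 = coset P g2 ->
        DF.1 g1 != 0 -> DF.1 g2 != 0 /\ DF.2 g1 = DF.2 g2 &
      forall u, level N u -> unitri e (cellr s') u -> DF.1 (u \o n) != 0 /\
        forall i, DF.2 (u \o n) i = co i (u (e (tnth (in_tuple L) l).2))].
    move=> l; have Ej : E N (tnth (in_tuple L) l).2.
      have : cellr s' (tnth (in_tuple L) l).1 (tnth (in_tuple L) l).2.
        by apply/hL; rewrite -surjective_pairing; apply: mem_tnth.
      by move=> /NL[].
    by have [De [F h]] := chart_exists hn Nn Ej; exists (De, F).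
  (* One chart per cell position, with the product of the denominators as common denominator. [yv]
     recovers the entries of u - 1, from which [tau] computes the parameter by the inverse Cayley
     transform. *)
  pose De g := \prod_(l < size L) (ch l).1 g.
  pose yv g : 'rV[K]_(size L) := \row_l (ch l).2 g (tnth (in_tuple L) l).1.
  pose tau g := entries e L (inverse_cayley e (yv g)) *m M'.
  have DeP g : reflect (forall l, (ch l).1 g != 0) (De g != 0).
    by apply: (iffP (prodf_neq0 _ _)) => h l; [apply: h | move=> _; apply: h].
  apply: (quotient_chart_morphism (De := De) (t := tau)).
  + by apply: alg_prod => l; case: (hch l).
  + move=> i; rewrite /tau.
    set W := [set x | _].
    have frl l : frac W (fun x => (half_opp (yv x)) 0 l).
      rewrite (_ : (fun _ => _) = fun x => - 2%:R^-1 * (ch l).2 x (tnth (in_tuple L) l).1).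
        apply: fraction_mul; first by apply: fraction_alg; apply: GenConst.
        have [_ h _ _] := hch l.
        by apply: fraction_sub (h _) => x [_ /DeP hx]; apply: hx.
      by apply: funext => x; rewrite !mxE.
    rewrite (_ : (fun _ => _) = fun x => \sum_l
      (- co (tnth (in_tuple L) l).1 (nilp e (half_opp (yv x))
        (neumann (size [seq p.2 | p <- L]).+1 (nilp e (half_opp (yv x)))
          (e (tnth (in_tuple L) l).2)))) * M' l i); last first.
      by apply: funext => x; rewrite mxE; apply: eq_bigr => l _; rewrite mxE coordN.
    apply: fraction_sum => l; apply: fraction_mul; last by apply: fraction_alg;
      apply: GenConst.
    rewrite (_ : (fun _ => _) = fun x => -1 * co (tnth (in_tuple L) l).1 (nilp e
      (half_opp (yv x))
        (neumann (size [seq p.2 | p <- L]).+1 (nilp e (half_opp (yv x)))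
          (e (tnth (in_tuple L) l).2)))); last first.
      by apply: funext => x; rewrite mulN1r.
    apply: fraction_mul; first by apply: fraction_alg; apply: GenConst.
    apply: (@combination_neumann _ _ _ (frac W) _ _ _ _
      (fun l x => half_opp (yv x) 0 l) (elementary e (L := L))).
    * by move=> c; apply: fraction_alg; apply: GenConst.
    * exact: fraction_mul.
    * by move=> a F hF; apply: fraction_sum.
    * exact: linear_elementary.
    * exact: frl.
    * exact: (coord_scalar hb).
  + move=> x y /mN Nx /mN Ny xy /DeP hx.
    have h l : (ch l).1 y != 0 /\ (ch l).2 x = (ch l).2 y.
      by have [_ _ h _] := hch l; apply: h.
    split; first by apply/DeP => l; case: (h l).
    rewrite /tau (_ : yv x = yv y) //; apply/rowP => l; rewrite !mxE.
    by case: (h l) => _ ->.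
  + move=> x /mN Nx /PhiS[y hy]; rewrite -hy fK.
    have Ncay : level N (cay y) by apply: level_unitri (hcay y) NL.
    have Nun : level N (cay y \o n) by apply: level_comp.
    have h l : (ch l).1 x != 0 /\
        forall i, (ch l).2 x i = co i (cay y (e (tnth (in_tuple L) l).2)).
      have [_ _ h1 /(_ _ Ncay (hcay y))[h2 h3]] := hch l.
      by have [h4 h5] := h1 _ _ Nun Nx hy h2; rewrite -h5.
    split; first by apply/DeP => l; case: (h l).
    have -> : tau x = entries e L
        (inverse_cayley e (entries e L (fun v => cay y v - v))) *m M'.
      rewrite /tau (_ : yv x = entries e L (fun v => cay y v - v)) //; apply/rowP => l.
      rewrite !mxE (h l).2 coordB // coord_basis //.
      have : cellr s' (tnth (in_tuple L) l).1 (tnth (in_tuple L) l).2.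
        by apply/hL; rewrite -surjective_pairing; apply: mem_tnth.
      by move=> [_ /eqP/negPf -> _]; rewrite subr0.
    by rewrite (entries_cayley hb two0 tle rle rtr uL hL) -mulmxA MM' mulmx1.
(* The inverse map lands in the single level [N0], and its matrix coefficients are polynomials
   because the Neumann series is finite. *)
- move=> _; exists N0.
  apply: subspace_morphism => [|y _]; last exact: PhiO.
  apply: (morphism_comp (Y := level_variety e E k N0) (f := fun y => cay y \o n));
    last first.
    exact: quotient_morphism.
  apply: zariski_morphism => [y _|_ [phi [v [lphi ->]]]].
    by apply: level_comp => //; apply: level_unitri (hcay y) N0L.
  have hal l : generated_algebra (@row_coordinates K d) (fun y => (y *m M) 0 l).
    rewrite (_ : (fun _ => _) = fun y : 'rV[K]_d => \sum_c y 0 c * M c l); last first.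
      by apply: funext => y; rewrite mxE.
    apply: alg_sum => c; apply: GenMul; last exact: GenConst.
    by apply: GenBase; exists c.
  rewrite (_ : _ \o _ = fun y =>
    phi (neumann (size [seq p.2 | p <- L]).+1 (nilp e (y *m M)) (n v)) +
    phi (nilp e (y *m M) (neumann (size [seq p.2 |
      p <- L]).+1 (nilp e (y *m M)) (n v)))); last first.
    by apply: funext => y; rewrite -(scal_addr lphi).
  apply: GenAdd.
    apply: (@neumann_combination _ _ _ (generated_algebra (@row_coordinates K d)) _ _ _ _
      (fun l y => (y *m M) 0 l) (elementary e (L := L))) => //.
    * by move=> c; apply: GenConst.
    * exact: GenMul.
    * by move=> a F hF; apply: alg_sum.
    * exact: linear_elementary.
  apply: (@combination_neumann _ _ _ (generated_algebra (@row_coordinates K d)) _ _ _ _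
      (fun l y => (y *m M) 0 l) (elementary e (L := L))) => //.
  * by move=> c; apply: GenConst.
  * exact: GenMul.
  * by move=> a F hF; apply: alg_sum.
  * exact: linear_elementary.
- by move=> c [m _ [_ /PhiS[y <-]]]; rewrite fK.
- by move=> y _; apply: fK.
Qed.

End Charts.

(** * Infinite cells are not finite-dimensional *)

Section Germs.
Variable K : fieldType.
Hypothesis charK : [pchar K] =i pred0.
Implicit Types (s a w : {poly K}) (f g : K -> K).

(* [f] is a rational function near 0 whose derivative at 0 is [c]. *)
Definition derivative_at0 f c := exists s a, [/\ s.[0] != 0,
  forall t, s.[t] != 0 -> s.[t] * f t = a.[t] &
  a^`().[0] = s^`().[0] * f 0 + s.[0] * c].

(** Truth on a Zariski neighbourhood of 0 in the line. *)
Definition near0 (Q : K -> Prop) := exists2 w, w.[0] != 0 &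
  forall t, w.[t] != 0 -> Q t.

Lemma near0_sub (Q Q' : K -> Prop) : (forall t, Q t -> Q' t) -> near0 Q -> near0 Q'.
Proof. by move=> h [w w0 hw]; exists w => // t /hw /h. Qed.

Lemma derivative_poly (p : {poly K}) : derivative_at0 (fun t => p.[t]) p^`().[0].
Proof.
exists 1, p; split; first by rewrite hornerC oner_eq0.
  by move=> t _; rewrite hornerC mul1r.
by rewrite derivC horner0 mul0r add0r hornerC mul1r.
Qed.

Lemma derivative_const c : derivative_at0 (fun=> c) 0.
Proof.
have := derivative_poly c%:P; rewrite derivC horner0.
by rewrite (_ : (fun t => _) = fun=> c) //; apply: funext => t; rewrite hornerC.
Qed.

Lemma derivative_add f g c d : derivative_at0 f c -> derivative_at0 g d ->
  derivative_at0 (fun t => f t + g t) (c + d).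
Proof.
move=> [s [a [s0 sa ha]]] [r [b [r0 rb hb]]].
exists (s * r), (a * r + b * s); split; first by rewrite hornerM mulf_neq0.
  move=> t; rewrite hornerM mulf_eq0 negb_or => /andP[/sa h1 /rb h2].
  by rewrite !(hornerD, hornerN, hornerM) -h1 -h2; ring.
by rewrite !(derivD, derivM, derivN, hornerD, hornerN,
  hornerM) ha hb -(sa 0 s0) -(rb 0 r0); ring.
Qed.

Lemma derivative_mul f g c d : derivative_at0 f c -> derivative_at0 g d ->
  derivative_at0 (fun t => f t * g t) (c * g 0 + f 0 * d).
Proof.
move=> [s [a [s0 sa ha]]] [r [b [r0 rb hb]]].
exists (s * r), (a * b); split; first by rewrite hornerM mulf_neq0.
  move=> t; rewrite hornerM mulf_eq0 negb_or => /andP[/sa h1 /rb h2].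
  by rewrite !(hornerD, hornerN, hornerM) -h1 -h2; ring.
by rewrite !(derivD, derivM, derivN, hornerD, hornerN,
  hornerM) ha hb -(sa 0 s0) -(rb 0 r0); ring.
Qed.

Lemma derivative_near f g c : near0 (fun t => f t = g t) -> derivative_at0 f c ->
  derivative_at0 g c.
Proof.
move=> [w w0 hw] [s [a [s0 sa ha]]].
exists (s * w), (a * w); split; first by rewrite hornerM mulf_neq0.
  move=> t; rewrite hornerM mulf_eq0 negb_or => /andP[/sa h1 /hw <-].
  by rewrite !hornerM -h1; ring.
by rewrite !(derivD, derivM, derivN, hornerD, hornerN, hornerM) -(hw 0 w0) ha -(sa 0 s0);
  ring.
Qed.

Lemma derivative_quotient f (a b : {poly K}) : b.[0] != 0 ->
  near0 (fun t => f t = a.[t] / b.[t]) -> exists c, derivative_at0 f c.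
Proof.
move=> b0 hf.
exists ((a^`().[0] - b^`().[0] * (a.[0] / b.[0])) / b.[0]).
apply: (derivative_near (f := fun t => a.[t] / b.[t])).
  by apply: near0_sub hf.
exists b, a; split=> //; first by move=> t bt; rewrite mulrC divfK.
by field.
Qed.

Lemma derivative_neq0 f c : derivative_at0 f c -> f 0 != 0 -> near0 (fun t => f t != 0).
Proof.
move=> [s [a [s0 sa _]]] f0; exists (a * s).
  by rewrite hornerM mulf_neq0 // -(sa 0 s0) mulf_neq0.
move=> t; rewrite hornerM mulf_eq0 negb_or => /andP[at0 st].
by apply: contraNneq at0 => ft; rewrite -(sa t st) ft mulr0.
Qed.

(** In characteristic zero the natural numbers are distinct in K, and p w vanishes at all of them,
    hence at more points than its degree allows. *)
Lemma poly_near0 (p : {poly K}) : near0 (fun t => p.[t] = 0) -> p = 0.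
Proof.
move=> [w w0 hw]; apply/eqP; apply: contraT => p0.
have wn0 : w != 0 by apply: contraNneq w0 => ->; rewrite horner0.
have pw0 : p * w != 0 by rewrite mulf_neq0.
have inj : injective (fun n : nat => n%:R : K).
  have aux m n : (m <= n)%N -> m%:R = n%:R :> K -> m = n.
    move=> mn /esym/eqP; rewrite -subr_eq0 -natrB // => h.
    by apply/eqP; rewrite eqn_leq mn -subn_eq0 -((pcharf0P K).1 charK) h.
  move=> m n h; case/orP: (leq_total m n) => /aux; first exact.
  by move=> /(_ (esym h)).
have := max_poly_roots pw0 (rs := [seq n%:R | n <- iota 0 (size (p * w))]).
rewrite size_map size_iota ltnn => -> //; last by rewrite map_inj_uniq ?iota_uniq.
apply/allP => _ /mapP[n _ ->]; rewrite /root hornerM.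
have [->|/hw ->] := eqVneq w.[n%:R] 0; by rewrite ?mulr0 ?mul0r.
Qed.

(** Two presentations give a r = b s near 0, hence as polynomials, and differentiating this identity
    at 0 compares c with d. *)
Lemma derivative_unique f c d : derivative_at0 f c -> derivative_at0 f d -> c = d.
Proof.
move=> [s [a [s0 sa ha]]] [r [b [r0 rb hb]]].
have : a * r - b * s = 0.
  apply: poly_near0; exists (s * r); first by rewrite hornerM mulf_neq0.
  move=> t; rewrite hornerM mulf_eq0 negb_or => /andP[/sa h1 /rb h2].
  by rewrite !(hornerD, hornerN, hornerM) -h1 -h2; ring.
move=> /subr0_eq /(congr1 (fun p => p^`().[0])).
rewrite !(derivM, hornerD, hornerM) ha hb -(sa 0 s0) -(rb 0 r0) => h.
have : s.[0] * r.[0] * (c - d) =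
    (s^`().[0] * f 0 + s.[0] * c) * r.[0] + s.[0] * f 0 * r^`().[0] -
    ((r^`().[0] * f 0 + r.[0] * d) * s.[0] + r.[0] * f 0 * s^`().[0]) by ring.
rewrite h subrr => /eqP; rewrite !mulf_eq0 (negPf s0) (negPf r0) subr_eq0 /=.
exact: eqP.
Qed.

(** Chain rule: z is the gradient of p at y0, so the derivative of p along a curve depends linearly
    on the velocity D. Linearity is what bounds the rank later. *)
Lemma gradient_exists d (p : 'rV[K]_d -> K) (y0 : 'rV[K]_d) :
  generated_algebra (@row_coordinates K d) p ->
  exists z : 'cV[K]_d, forall (f : K -> 'rV[K]_d) (D : 'rV[K]_d), f 0 = y0 ->
    (forall i, derivative_at0 (fun t => f t 0 i) (D 0 i)) ->
    derivative_at0 (p \o f) ((D *m z) 0 0).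
Proof.
elim=> [c|_ [i ->]|a b _ [z hz] _ [w hw]|a b _ [z hz] _ [w hw]].
- by exists 0 => f D _ _; rewrite mulmx0 mxE; apply: derivative_const.
- by exists (delta_mx i 0) => f D _ hD; rewrite -colE mxE; apply: hD.
- exists (z + w) => f D f0 hD; rewrite mulmxDr mxE.
  by apply: derivative_add; [apply: hz | apply: hw].
exists (b y0 *: z + a y0 *: w) => f D f0 hD.
rewrite mulmxDr -!scalemxAr mxE [X in X + _]mxE [X in _ + X]mxE [b y0 * _]mulrC.
by rewrite -f0; apply: derivative_mul; [apply: hz | apply: hw].
Qed.

End Germs.

Section QuotientFunctions.
Variable K : fieldType.

Lemma quotient_chart_regular (T T' : Type) (D : set T) (gens : set (T -> K)) (pi : T -> T')
    (De : T -> K) (F : T -> K) :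
  generated_algebra gens De -> fraction_on gens [set x | D x /\ De x != 0] F ->
  (forall x y, D x -> D y -> pi x = pi y -> De x != 0 -> De y != 0 /\ F x = F y) ->
  exists W h, [/\ opens (quotient_space (zariski D gens) pi) W,
    regular (quotient_space (zariski D gens) pi) W h &
    forall x, D x -> (W (pi x) <-> De x != 0) /\ (De x != 0 -> h (pi x) = F x)].
Proof.
move=> hDe hF inv.
pose lifts c x := [/\ D x, De x != 0 & pi x = c].
pose h c := if pselect (exists x, lifts c x) is left H then F (projT1 (cid H)) else 0.
pose W := [set c | exists x, lifts c x].
have hE x : D x -> De x != 0 -> h (pi x) = F x.
  move=> Dx x0; rewrite /h; case: pselect => [H|]; last by case; exists x.
  by case: (cid H) => y [Dy y0 yx] /=; case: (inv y x Dy Dx yx y0).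
have WE x : D x -> W (pi x) <-> De x != 0.
  move=> Dx; split=> [[y [Dy y0 yx]]|x0]; last by exists x.
  by case: (inv y x Dy Dx yx y0).
have preW : pi @^-1` W `&` D = [set x | D x /\ De x != 0].
  apply/seteqP; split=> x /=; first by move=> [h1 Dx]; split=> //; apply/WE.
  by move=> [Dx x0]; split=> //; apply/WE.
have oW : opens (zariski D gens) (pi @^-1` W `&` D).
  by rewrite preW; apply: zariski_open.
exists W, h; split.
- by split=> // c [x [Dx _ xc]]; exists x.
- apply: fraction_regular => //; have [a [b [ha hb hab]]] := hF.
  exists a, b; split=> // x; rewrite [points _]/= preW => -[Dx x0].
  have [b0 E] := hab x (conj Dx x0).
  by rewrite /= hE.
- by move=> x Dx; split; [apply: WE | apply: hE].
Qed.

End QuotientFunctions.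

Section InfiniteCells.
Variables (K : closedFieldType) (V : lmodType K) (I : choiceType) (e : I -> V).
Hypothesis charK : [pchar K] =i pred0.
Hypothesis hb : is_basis e.
Local Notation co := (coord e).
Local Notation sp := (spans e).
Variables (E : nat -> set I) (k : group_kind V I).
Hypothesis hE : is_filtration E.
Hypothesis adm : admissible e E k.
Hypothesis two0 : 2%:R != 0 :> K.
Local Notation G := (ambient_group e k).
Variables (P : set (V -> V)) (le0 : rel I).
Hypotheses (gP : is_group P) (PG : P `<=` G) (cle0 : compatible_order k le0).
Hypothesis BP : forall g, G g -> tri e le0 g -> P g.
Variable le : rel I.
Hypothesis cle : compatible_order k le.
Local Notation R := (gen_rel e P).
Local Notation B := (order_stabilizer e k le).
Local Notation cellr := (cell_rel e P le).
Local Notation mono := (monomial_element e k).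
Local Notation orbit := (orbit_of e k P le).
Local Notation level := (level e E k).
Local Notation rootv := (root_vector e k).
Local Notation rexp := (rexp e k).

Lemma cell_rel_dual om iE n s s' i j : k = Isometry om iE -> mono n s s' ->
  cellr s' i j -> cellr s' (iE j) (iE i).
Proof.
move=> kE hn [ij nij nR]; have dK := dualK adm kE; have [_ _ sK s'K] := hn.
have := respects_dual_inverse sK s'K (monomial_dual hb adm hn).
rewrite /respects_dual kE => hs'.
split; first by rewrite -(compatible_dual _ _ kE cle).
  by move=> /(can_inj dK) h; apply: nij.
rewrite !hs' => h; apply: nR.
by have := gen_rel_dual hb adm gP PG kE h; rewrite !dK.
Qed.

(** A pair (i, iE i) without a root vector lies in the cell only if (i, o) does, o being the fixed
    index, and that pair has a root vector. Finiteness for pairs with root vectors thus gives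
    finiteness of the cell. *)
Lemma infinite_roots n s s' : mono n s s' ->
  (exists L : seq (I * I), forall i j, cellr s' i j ->
     co i (rootv i j (e j)) != 0 -> (i, j) \in L) ->
  exists L : seq (I * I), forall i j, cellr s' i j -> (i, j) \in L.
Proof.
move=> hn [L hL].
exists (L ++ if k is Isometry _ iE then [seq (p.1, iE p.1) | p <- L] else [::]) => i j cij.
rewrite mem_cat; have [h|/(hL _ _ cij) ->//] := eqVneq (co i (rootv i j (e j))) 0.
have [ij nij nR] := cij.
have [om [iE [o [kE iD _ fixo _]]]] := root_degenerate hb adm two0 h nij.
have dK := dualK adm kE; have jD : j = iE i by rewrite iD dK.
apply/orP; right; rewrite kE; apply/mapP; exists (i, o); last by rewrite jD.
have [io oj] : le i o /\ le o j.
  by rewrite jD; apply: (fixed_between kE cle fixo); rewrite -jD.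
have nio : i <> o by move=> h'; apply: nij; rewrite jD h' fixo.
have [_ _ sK s'K] := hn.
have := respects_dual_inverse sK s'K (monomial_dual hb adm hn).
rewrite /respects_dual kE => hs'.
apply: hL.
  split=> // Rio; apply: nR; apply: (gen_rel_trans Rio).
  by have := gen_rel_dual hb adm gP PG kE Rio; rewrite -!hs' fixo -jD.
apply/eqP => h0; have [om1 [iE1 [o1 [kE1 iD1 _ _ _]]]] :=
  root_degenerate hb adm two0 h0 nio.
by apply: nio; move: kE1; rewrite kE => -[_ iEE]; rewrite iD1 -iEE.
Qed.

(** Each root vector has finitely many nonzero entries, so the next pair can be chosen away from
    those of all earlier ones. The matrix of mutual coefficients is then triangular with nonzero
    diagonal. *)
Lemma root_family s' (D : nat) :
  ~ (exists L : seq (I * I), forall i j, cellr s' i j ->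
     co i (rootv i j (e j)) != 0 -> (i, j) \in L) ->
  exists q : seq (I * I), [/\ size q = D,
    forall p, p \in q -> cellr s' p.1 p.2 /\ co p.1 (rootv p.1 p.2 (e p.2)) != 0 &
    pairwise (fun a b => co b.1 (rootv a.1 a.2 (e b.2)) == 0) q].
Proof.
move=> inf; elim: D => [|D [q [sq hq pq]]]; first by exists [::].
pose L := flatten [seq (p.1, p.2) :: (if k is Isometry _ iE
  then [:: (iE p.2, iE p.1)] else [::]) | p <- q].
have [p [cp p0 pL]] : exists p, [/\ cellr s' p.1 p.2, co p.1 (rootv p.1 p.2 (e p.2)) != 0 &
    p \notin L].
  apply: contrapT => no; apply: inf; exists L => i j cij h.
  by apply: contrapT => /negP hL; apply: no; exists (i, j).
exists (rcons q p); split; first by rewrite size_rcons sq.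
  by move=> t; rewrite mem_rcons inE => /orP[/eqP ->|/hq].
rewrite pairwise_rcons pq andbT; apply/allP => a aq /=.
have [[_ nij _] _] := hq a aq.
apply: contraT => h; case/negP: pL; apply/flatten_mapP; exists a => //.
pose r i j : Prop := (i, j) \in (a.1, a.2) ::
  (if k is Isometry _ iE then [:: (iE a.2, iE a.1)] else [::]).
have r1 : r a.1 a.2 by rewrite /r mem_head.
suff hr : sp (r^~ p.2) (rootv a.1 a.2 (e p.2)).
  by have := hr _ h; rewrite /r -(surjective_pairing p).
apply: (root_support hb adm (r := r) r1).
by rewrite /r; case: k => // om iE; rewrite !inE eqxx orbT.
Qed.

Lemma curve_poly c d (phi : V -> K) v : scalar phi ->
  exists p : {poly K}, forall t, phi (rexp c d t v) = p.[t].
Proof.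
move=> lphi.
exists ((phi v)%:P + (phi (rootv c d v))%:P * 'X +
  (phi (rootv c d (rootv c d v)) / 2%:R)%:P * 'X * 'X) => t.
rewrite (rexpE hb adm two0) !(scal_addr lphi, scal_scale lphi).
by rewrite !(hornerD, hornerM, hornerC, hornerX); ring.
Qed.

Lemma curve_alg c d n (a : (V -> V) -> K) :
  generated_algebra (matrix_coefficients (V := V)) a ->
  exists p : {poly K}, forall t, a (rexp c d t \o n) = p.[t].
Proof.
elim=> [x|_ [phi [v [lphi ->]]]|f g _ [p hp] _ [q hq]|f g _ [p hp] _ [q hq]].
- by exists x%:P => t; rewrite hornerC.
- exact: curve_poly.
- by exists (p + q) => t; rewrite hornerD hp hq.
- by exists (p * q) => t; rewrite hornerM hp hq.
Qed.

Lemma rexp0 c d v : rexp c d 0 v = v.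
Proof. by rewrite (rexpE hb adm two0) !mul0r !scale0r !addr0. Qed.

Lemma rexp_unitri s' n s c d t : mono n s s' -> cellr s' c d ->
  unitri e (cellr s') (rexp c d t).
Proof.
move=> hn ccd j.
have rt := cell_rel_trans hb adm two0 cle0 BP cle (s' := s').
have sup i : sp ((cellr s')^~ i) (rootv c d (e i)).
  apply: (root_support hb adm) => //; case kE : k => [//|om iE].
  exact: (cell_rel_dual kE hn ccd).
rewrite (rexpE hb adm two0) -[X in X - _]addrA addrAC subrr add0r.
apply: spans_add => //; apply: spans_scale => //.
apply: (spans_lin hb (linear_root hb adm c d)) (sup j) => i ij.
by apply: (spans_sub_set (sup i) _) => l li; apply: rt li ij.
Qed.

(* An isomorphism with A^d would embed the D > d independent tangent
   directions of the curves t |-> exp (t x_a) n P into a space of dimension d: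
   the functions on G/P given by chart coordinates detect these directions. *)
Lemma infinite_cell_not_affine n s s' : mono n s s' ->
  finite_dimensional_orbit e E k P (orbit n) ->
  exists L : seq (I * I), forall i j, cellr s' i j -> (i, j) \in L.
Proof.
move=> hn [d [f [g [mf mg gf fg]]]]; have [Gn mn sK s'K] := hn.
apply: (infinite_roots hn); apply: contrapT => inf.
have [q [sq hq pq]] := root_family d.+1 inf.
have lin := @ambient_linear _ _ _ e k.
pose qa (a : 'I_d.+1) := nth (tnth (in_tuple q) (cast_ord (esym sq) a)) q a.
have qaE a x0 : qa a = nth x0 q a by apply: set_nth_default; rewrite sq.
have qmem a : qa a \in q by rewrite mem_nth // sq.
have qcell a : cellr s' (qa a).1 (qa a).2 by case: (hq _ (qmem a)).
have qneq a : (qa a).1 <> (qa a).2 by case: (qcell a).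
(* Row a holds the tangent vector of the a-th curve, measured by the d + 1 coordinate functions at
   the chosen pairs. *)
pose T : 'M[K]_d.+1 := \matrix_(a, b) co (qa b).1 (rootv (qa a).1 (qa a).2 (e (qa b).2)).
have Tu : T \in unitmx.
  rewrite unitmxE unitfE det_trig.
    by apply/prodf_neq0 => a _; rewrite mxE; case: (hq _ (qmem a)).
  apply/is_trig_mxP => a b ab; rewrite mxE; apply/eqP.
  have /pairwiseP := pq => /(_ (qa a) a b).
  by rewrite -(qaE a (qa a)) -(qaE b (qa a)) !inE sq; apply.
pose ga (a : 'I_d.+1) t := rexp (qa a).1 (qa a).2 t \o n.
have Grexp a t : G (rexp (qa a).1 (qa a).2 t).
  exact: (rexp_ambient hb adm two0 t (qneq a)).
have hrexp a t : unitri e (cellr s') (rexp (qa a).1 (qa a).2 t).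
  by apply: (@rexp_unitri s' n s) => //; apply: qcell.
have ga0 a : ga a 0 = n by apply: funext => v; rewrite /ga /= rexp0.
have gaO a t : orbit n (coset P (ga a t)).
  by exists (rexp (qa a).1 (qa a).2 t) => //; apply: (cell_borel hb cle _ (hrexp a t)).
have [N1 N1n] := level_ex hb hE Gn.
have [N2 N2q] : exists N2, forall a i j,
    ((i, j) = qa a \/ if k is Isometry _ iE then (i, j) = (iE (qa a).2,
      iE (qa a).1) else False) ->
    E N2 i /\ E N2 j.
  pose q2 := q ++ if k is Isometry _ iE then [seq (iE p.2, iE p.1) | p <- q] else [::].
  have [N2 hN2] := filtration_seq hE ([seq p.1 | p <- q2] ++ [seq p.2 | p <- q2]).
  exists N2 => a i j h.
  have : (i, j) \in q2.
    rewrite mem_cat; case: h => [->|]; first by rewrite qmem.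
    case: k => // om iE ->; apply/orP; right; apply/mapP; exists (qa a) => //.
  move=> h2; split; apply: hN2; rewrite mem_cat; apply/orP; [left|right];
    by apply/mapP; exists (i, j).
pose N0 := maxn N1 N2.
have lrexp N a t : (N0 <= N)%N -> level N (rexp (qa a).1 (qa a).2 t).
  move=> NN; pose r i j := E N i /\ E N j.
  have rt i j l : r i j -> r j l -> r i l by move=> [? ?] [? ?].
  suff hr : unitri e r (rexp (qa a).1 (qa a).2 t).
    by apply: level_unitri hr _ => // i j [].
  move=> j.
  have sup i : sp (r^~ i) (rootv (qa a).1 (qa a).2 (e i)).
    have le2 i' : E N2 i' -> E N i'.
      apply: (filtration_le hE); exact: leq_trans (leq_maxr _ _) NN.
    apply: (root_support hb adm).
      have [h1 h2] := N2q a (qa a).1 (qa a).2 (or_introl (esym (surjective_pairing _))).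
      by split; apply: le2.
    case kE : k => [//|om iE]; have := N2q a (iE (qa a).2) (iE (qa a).1).
    by rewrite kE => /(_ (or_intror erefl))[h1 h2]; split; apply: le2.
  rewrite (rexpE hb adm two0) -[X in X - _]addrA addrAC subrr add0r.
  apply: spans_add => //; apply: spans_scale => //.
  apply: (spans_lin hb (linear_root hb adm _ _)) (sup j) => i ij.
  by apply: (spans_sub_set (sup i) _) => l li; apply: rt li ij.
have lga N a t : (N0 <= N)%N -> level N (ga a t).
  move=> NN; apply: level_comp => //; first exact: lrexp.
  by apply: (level_le hb hE _ N1n); apply: leq_trans NN; apply: leq_maxl.
have gfga a t : g (f (coset P (ga a t))) = coset P (ga a t).
  apply: gf; exists N0 => //; split; last exact: gaO.
  by exists (ga a t) => //; apply: lga.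
pose y0 := f (coset P n).
pose phi a t := f (coset P (ga a t)).
have phi0 a : phi a 0 = y0 by rewrite /phi ga0.
have [m' [_ _ mf3]] := mf N0.
have openT : opens (affine_space K d) setT by apply: zariski_openT.
(* Composed with f, each curve becomes near 0 a quotient of polynomials in t, so it has a velocity
   in A^d. *)
have phiD a i : exists c, derivative_at0 (fun t => phi a t 0 i) c.
  have rcoord : regular (affine_space K d) setT (fun y : 'rV[K]_d => y 0 i).
    apply: fraction_regular; first exact: zariski_openT.
    by apply: fraction_alg; apply: GenBase; exists i.
  have N0n : level N0 n by rewrite -(ga0 a); apply: lga.
  have h0 : (f @^-1` setT `&` points (subspace (homogeneous_space e E k P N0) (orbit n)))
      (coset P n).
    by split=> //; split; [exists n | have := gaO a 0; rewrite ga0].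
  have [W [h [oW rW Wn _ hW]]] := mf3 _ _ openT rcoord _ h0.
  have [W' [A [C [oW' W'n W'W [hA hC] hAC]]]] := rW n (conj Wn N0n).
  have [S hS W'E] := oW'.
  move: (W'n); rewrite W'E => -[_ [p Sp pn]].
  have [pA hpA] := curve_alg (qa a).1 (qa a).2 n hA.
  have [pC hpC] := curve_alg (qa a).1 (qa a).2 n hC.
  have [pp hpp] := curve_alg (qa a).1 (qa a).2 n (hS _ Sp).
  apply: (derivative_quotient (a := pA) (b := pC)).
    by rewrite -hpC -/(ga a 0) ga0; have [] := hAC n W'n.
  exists pp => [|t]; first by rewrite -hpp -/(ga a 0) ga0.
  rewrite -hpp -/(ga a t) => pt.
  have W't : W' (ga a t).
    by rewrite W'E; split; [apply: lga | exists p].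
  have [Wt _] := W'W _ W't; have [C0 E1] := hAC _ W't.
  have h1 := hW _ Wt (gaO a t); rewrite /= in h1 E1.
  by rewrite /phi h1 E1 hpA hpC.
have /choice[Dv hDv] : forall ai : 'I_d.+1 * 'I_d, exists c,
    derivative_at0 (fun t => phi ai.1 t 0 ai.2) c by move=> ai; apply: phiD.
pose DM : 'M[K]_(d.+1, d) := \matrix_(a, i) Dv (a, i).
have hDM a i : derivative_at0 (fun t => phi a t 0 i) ((row a DM) 0 i).
  by rewrite !mxE; apply: (hDv (a, i)).
have psiD a b : derivative_at0 (fun t => co (qa b).1 (rexp (qa a).1 (qa a).2 t (e
  (qa b).2))) (T a b).
  set x := co (qa b).1 (rootv (qa a).1 (qa a).2 (rootv (qa a).1 (qa a).2 (e (qa b).2))).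
  have := derivative_poly ((T a b)%:P * 'X + (x / 2%:R)%:P * 'X * 'X).
  have -> : ((T a b)%:P * 'X + (x / 2%:R)%:P * 'X * 'X)^`().[0] = T a b.
    rewrite derivD !derivM !derivC derivX !(hornerD, hornerM, hornerC, hornerX).
    by rewrite !(horner0, mul0r, mulr0, add0r, addr0, mulr1).
  apply: derivative_near; exists 1; first by rewrite hornerC oner_eq0.
  move=> t _; rewrite (rexpE hb adm two0) !coordD // !coordZ // coord_basis //.
  rewrite (introF eqP (qneq b)) -/x !(hornerD, hornerM, hornerC, hornerX) mxE.
  by rewrite add0r; ring.
have psi0 a b : co (qa b).1 (rexp (qa a).1 (qa a).2 0 (e (qa b).2)) = 0.
  by rewrite rexp0 coord_basis // (introF eqP (qneq b)).
(* The source chain is constant, so g maps all of A^d into one level m1; the charts must then live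
   at a level above both m1 and the curves. *)
have [m1 [mg1 mg2 mg3]] := mg 0%N.
pose N := maxn m1 N0.
have Nn : level N n.
  by rewrite -(ga0 ord0); apply: lga; apply: leq_maxr.
have m1N x : level m1 x -> level N x by apply: (level_le hb hE); apply: leq_maxl.
(* The b-th coordinate function extends to a regular function on an open set of G/P. Pulled back
   along g to A^d, it has a gradient there, so column b of T is the velocity matrix times a vector.
   This factors T, of rank d + 1, through d dimensions. *)
have zb b : exists z : 'cV[K]_d, forall a, T a b = (row a DM *m z) 0 0.
  have Ej : E N (qa b).2.
    have [_ h] := N2q b (qa b).1 (qa b).2 (or_introl (esym (surjective_pairing _))).
    apply: (filtration_le hE _ h); apply: leq_trans (leq_maxr _ _); exact: leq_maxr.
  have [De [F [hDe hF inv val]]] := chart_exists hb hE adm two0 gP PG cle0 BP cle hn Nn Ej.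
  have [W [h [oW rW hW]]] := quotient_chart_regular (pi := coset P) (D := level m1) hDe
    (fraction_sub (fun x (hx : _ /\ _) => hx.2) (hF (qa b).1))
    (fun x y lx ly xy x0 => let: conj y0' Fxy := inv x y (m1N _ lx) (m1N _ ly) xy x0 in
       conj y0' (congr1 (fun F => F (qa b).1) Fxy)).
  have gaval a t x : level m1 x -> coset P x = coset P (ga a t) ->
      De x != 0 /\ F x (qa b).1 = co (qa b).1 (rexp (qa a).1 (qa a).2 t (e (qa b).2)).
    move=> lx xt; have NN : (N0 <= N)%N by apply: leq_maxr.
    have [v1 v2] := val _ (lrexp N a t NN) (hrexp a t).
    have [h1 h2] := inv _ _ (lga N a t NN) (m1N _ lx) (esym xt) v1.
    by rewrite -h2 v2.
  pose O := orbit n.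
  have oU : opens (subspace (homogeneous_space e E k P m1) O) (W `&` O) by exists W.
  have rU : regular (subspace (homogeneous_space e E k P m1) O) (W `&` O) h.
    move=> c [Wc Oc]; exists W, h; split=> //.
  have pts a t : exists2 x, level m1 x & coset P x = coset P (ga a t).
    have [] := mg1 (phi a t) Logic.I.
    by rewrite /phi gfga => -[x lx <-] _; exists x.
  have inU a t : (W `&` O) (g (phi a t)).
    rewrite /phi gfga; split; last exact: gaO.
    have [x lx xt] := pts a t; rewrite -xt; apply/(hW x lx).1.
    by case: (gaval a t x lx xt).
  have hval a t : h (g (phi a t)) = co (qa b).1 (rexp (qa a).1 (qa a).2 t (e (qa b).2)).
    rewrite /phi gfga; have [x lx xt] := pts a t; have [x0 Fx] := gaval a t x lx xt.
    by rewrite -xt (hW x lx).2.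
  have y0in : (g @^-1` (W `&` O) `&` points (affine_space K d)) y0.
    by split=> //; rewrite -(phi0 ord0); apply: inU.
  have [W' [A [C [oW' W'y W'W [hA hC] hAC]]]] := mg3 _ _ oU rU _ y0in.
  have [S hS W'E] := oW'.
  move: (W'y); rewrite W'E => -[_ [p Sp py]].
  have [zA gA] := gradient_exists y0 hA.
  have [zC gC] := gradient_exists y0 hC.
  have [zp gp] := gradient_exists y0 (hS _ Sp).
  have [Cy0 _] := hAC _ W'y.
  exists ((C y0)^-1 *: zA) => a.
  (* The pullback is A/C. Differentiating C h = A at 0 loses the term with the derivative of C,
     since h vanishes at the start of the curve. *)
  have near : near0 (fun t => C (phi a t) *
      co (qa b).1 (rexp (qa a).1 (qa a).2 t (e (qa b).2)) = A (phi a t)).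
    have := derivative_neq0 (gp _ _ (phi0 a) (hDM a)).
    rewrite /= phi0 => /(_ py); apply: near0_sub => t pt.
    have W't : W' (phi a t) by rewrite W'E; split=> //; exists p.
    have [C0 E1] := hAC _ W't; rewrite /= hval in E1.
    by rewrite E1 mulrC divfK.
  have d1 := derivative_near near (derivative_mul (gC _ _ (phi0 a) (hDM a)) (psiD a b)).
  have d2 := gA _ _ (phi0 a) (hDM a).
  have := derivative_unique charK d1 d2; rewrite /= psi0 mulr0 add0r phi0 => h1.
  by rewrite -scalemxAr [RHS]mxE -h1 mulKf.
have /choice[z hz] := zb.
have TE : T = DM *m (\matrix_(i, b) z b i 0).
  apply/matrixP => a b; rewrite hz !mxE; apply: eq_bigr => i _; by rewrite !mxE.
have := mulmx_max_rank DM (\matrix_(i, b) z b i 0).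
by rewrite -TE mxrank_unit // ltnn.
Qed.

End InfiniteCells.

(** * Orbits *)

Lemma embedded_interval_finite (I : choiceType) (le : rel I) (f : I -> int) x y :
  antisymmetric le -> (forall i j, le i j = (f i <= f j)) ->
  exists s : seq I, forall z, le x z -> le z y -> z \in s.
Proof.
move=> al lef.
pose g (m : int) : option I := if pselect (exists z, f z = m) is left h
  then Some (projT1 (cid h)) else None.
have gf z : g (f z) = Some z.
  rewrite /g; case: pselect => [h|]; last by case; exists z.
  case: (cid h) => t /= ft; congr Some; apply: al.
  by rewrite !lef ft Order.POrderTheory.lexx.
exists (pmap g [seq f x + k%:Z | k <- iota 0 `|f y - f x|.+1]) => z.
rewrite !lef => xz zy; rewrite mem_pmap; apply/mapP; exists (f z); last by rewrite gf.
apply/mapP; exists `|f z - f x|%N; last by rewrite gez0_abs ?Num.Theory.subr_ge0 //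
  [RHS]addrC subrK.
have xy := Order.POrderTheory.le_trans xz zy.
rewrite mem_iota add0n ltnS leq0n -lez_nat.
by rewrite !gez0_abs ?Num.Theory.subr_ge0 // Num.Theory.lerD2r.
Qed.

Section Orbits.
Variables (K : closedFieldType) (V : lmodType K) (I : choiceType) (e : I -> V).
Hypothesis charK : [pchar K] =i pred0.
Hypothesis hb : is_basis e.
Variables (E : nat -> set I) (k : group_kind V I).
Hypothesis hE : is_filtration E.
Hypothesis adm : admissible e E k.
Hypothesis two0 : 2%:R != 0 :> K.
Local Notation G := (ambient_group e k).
Variables (P : set (V -> V)) (le0 : rel I).
Hypotheses (gP : is_group P) (PG : P `<=` G) (cle0 : compatible_order k le0).
Hypothesis BP : forall g, G g -> tri e le0 g -> P g.
Variable le : rel I.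
Hypothesis cle : compatible_order k le.
Local Notation R := (gen_rel e P).
Local Notation B := (order_stabilizer e k le).
Local Notation cellr := (cell_rel e P le).
Local Notation mono := (monomial_element e k).
Local Notation orbit := (orbit_of e k P le).
Local Notation fd := (finite_dimensional_orbit e E k P).

Let tle : total_order le := compatible_total cle.
Let le_refl x : le x x. Proof. by case: cle => h _ _ _ _; apply: h. Qed.
Let le_anti x y : le x y -> le y x -> x = y.
Proof. by case: cle => _ h _ _ _ h1 h2; apply: h; rewrite h1 h2. Qed.
Let le_trans x y z : le x y -> le y z -> le x z.
Proof. by case: cle => _ _ h _ _; apply: h. Qed.
Let le_tot x y : le x y \/ le y x.
Proof. by case: cle => _ _ _ h _; apply/orP/h. Qed.

Let point_monomial := monomial_orbit_point hb adm two0 gP PG cle0 BP cle.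
Let conj_point := conjugate_orbit_point hb gP cle.
Let to_monomial := orbit_monomial hb adm gP cle0 BP cle.

Lemma finite_dimensional_cell n s s' : mono n s s' ->
  fd (orbit n) <-> exists L : seq (I * I), forall i j, cellr s' i j -> (i, j) \in L.
Proof.
move=> hn; split.
  exact: (infinite_cell_not_affine charK hb hE adm two0 gP PG cle0 BP cle hn).
exact: (finite_cell_finite_dimensional hb hE adm two0 gP PG cle0 BP cle hn).
Qed.

Lemma conjugate_sub_order : conjugate_into G B P <->
  exists n s s', mono n s s' /\ sub_order e P le s.
Proof.
rewrite conj_point; split=> [[g Gg hx]|[n [s [s' [hn so]]]]].
  have [n [s [s' [hn gn]]]] := to_monomial Gg; exists n, s, s'; split=> //.
  by apply/(point_monomial hn); rewrite -gn.
exists n; first by case: hn.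
exact/(point_monomial hn).
Qed.

Lemma sub_order_cell n s s' i j : mono n s s' -> sub_order e P le s -> ~ cellr s' i j.
Proof.
move=> [_ _ _ s'K] so [ij _]; apply; apply: so; by rewrite !s'K.
Qed.

Lemma conjugate_finite_dimensional : conjugate_into G B P <->
  exists2 g, G g & fd (orbit g).
Proof.
rewrite conjugate_sub_order; split=> [[n [s [s' [hn so]]]]|[g Gg]].
  exists n; first by case: hn.
  by apply/(finite_dimensional_cell hn); exists [::] => i j /(sub_order_cell hn so).
have [n [s [s' [hn ->]]]] := to_monomial Gg.
move=> /(finite_dimensional_cell hn).
exact: (finite_cell_point hb adm two0 gP PG cle0 BP cle hn).
Qed.

Lemma orbit_points_eq g g' x x' : G g -> G g' ->
  orbit g = [set x] -> orbit g' = [set x'] -> orbit g = orbit g'.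
Proof.
move=> Gg Gg'; have [n [s [s' [hn ->]]]] := to_monomial Gg.
have [m [t [t' [hm ->]]]] := to_monomial Gg' => hx hx'.
have mem h : orbit h (coset P h).
  by exists id => //; apply: (borel_id hb cle).
have nx : coset P n = x by have := mem n; rewrite hx.
have mx : coset P m = x' by have := mem m; rewrite hx'.
rewrite hx hx' -nx -mx; congr [set _].
apply: (orbit_point_unique hb adm two0 gP PG cle0 BP cle hn hm).
  by apply/(point_monomial hn); exists x.
by apply/(point_monomial hm); exists x'.
Qed.

(** Compared with a point orbit, the permutation of any orbit is off by a finitary t. An inverted
    pair must contain an index moved by t, and an unmoved partner is trapped between that index and
    its image. *)
Lemma interval_finite_dimensional g : conjugate_into G B P ->
  (forall x y, exists s : seq I, forall z, le x z -> le z y -> z \in s) ->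
  G g -> fd (orbit g).
Proof.
move=> /conjugate_sub_order[n1 [s1 [s1' [hn1 so]]]] fin Gg.
have [n [s [s' [hn ->]]]] := to_monomial Gg.
apply/(finite_dimensional_cell hn).
have [Gn1 m1 s1K s1'K] := hn1; have [Gn mn sK s'K] := hn.
have [n' [Gn' nK n'K]] := ambient_inverse Gn.
have ln' := ambient_linear Gn'; have ln1 := ambient_linear Gn1.
have mt : monomial e (n1 \o n') (s1 \o s').
  by apply: monomial_comp => //; apply: (monomial_inverse ln' nK mn s'K).
have [_ [S [_ _ tS]]] := monomial_perm hb (ambient_comp Gn1 Gn') mt.
pose t := s1 \o s'; rewrite -/t in tS.
have /choice[iv hiv] : forall p : I * I, exists s : seq I,
    forall z, le p.1 z -> le z p.2 -> z \in s by move=> p; apply: fin.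
(* The three lists cover the pairs with both indices moved, only the lower one moved, and only the
   upper one moved. *)
exists ([seq (i, j) | i <- S, j <- S] ++
  flatten [seq [seq (i, j) | j <- iv (i, t i)] | i <- S] ++
  flatten [seq [seq (i, j) | i <- iv (t j, j)] | j <- S]) => i j [ij nij nR].
have nt : ~ le (t i) (t j) by move=> /so.
have tji : le (t j) (t i) by have [] := le_tot (t i) (t j).
rewrite !mem_cat; case: (boolP (i \in S)) => iS; case: (boolP (j \in S)) => jS.
- by apply/orP; left; apply/allpairsP; exists (i, j).
- apply/orP; right; apply/orP; left; apply/flatten_mapP; exists i => //.
  by apply: map_f; apply: hiv; rewrite // -(tS _ jS).
- apply/orP; right; apply/orP; right; apply/flatten_mapP; exists j => //.
  apply/mapP; exists i => //; by apply: hiv; rewrite // -(tS _ iS).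
- by case: nt; rewrite !tS.
Qed.

Lemma finite_dimensional_interval : P <> G -> conjugate_into G B P ->
  (forall g, G g -> fd (orbit g)) ->
  forall x y, exists s : seq I, forall z, le x z -> le z y -> z \in s.
Proof.
move=> nPG /conjugate_sub_order[n1 [s1 [s1' [hn1 so]]]] all x y.
have [Gn1 m1 s1K s1'K] := hn1.
have PP := parabolicP hb adm two0 gP PG cle0 BP.
have Rtrans := @gen_rel_trans K V I e P.
pose R1 i j := R (s1' i) (s1' j).
have R1t i j l : R1 i j -> R1 j l -> R1 i l by apply: Rtrans.
have leR i j : le i j -> R1 i j by move=> ij; apply: so; rewrite !s1'K.
have R1tot i j : R1 i j \/ R1 j i by case: (le_tot i j) => /leR; [left | right].
have R1d om iE i j : k = Isometry om iE -> R1 i j -> R1 (iE j) (iE i).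
  move=> kE; have := respects_dual_inverse s1K s1'K (monomial_dual hb adm hn1).
  rewrite /respects_dual kE => hs; rewrite /R1 !hs.
  exact: (gen_rel_dual hb adm gP PG kE).
pose covered x y := exists s : seq I, forall z, le x z -> le z y -> z \in s.
have cov_sub x1 y1 x2 y2 : le x2 x1 -> le y1 y2 -> covered x2 y2 -> covered x1 y1.
  move=> h1 h2 [s hs]; exists s => z xz zy; apply: hs.
    exact: le_trans h1 xz.
  exact: le_trans zy h2.
have swap_cov x1 y1 : nonfixed k x1 -> nonfixed k y1 -> ~ R1 y1 x1 -> covered x1 y1.
  move=> nx ny nR; pose p := swap k x1 y1.
  have pK : involutive p by apply: (swap_involutive adm).
  have dp : respects_dual k p by apply: (swap_respects_dual adm).
  pose X := [:: x1; y1] ++ if k is Isometry _ iE then [:: iE x1; iE y1] else [::].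
  have pX i : i \notin X -> p i = i.
    rewrite /X mem_cat !inE !negb_or => /andP[/andP[/eqP h1 /eqP h2] h3].
    apply: swap_off => //; move: h3; case: k => // om iE.
    by rewrite !inE negb_or => /andP[/eqP ? /eqP ?].
  have [m Gm mm] := monomial_realization hb adm cle pK pK pX dp.
  have hn : mono (m \o n1) (p \o s1) (s1' \o p).
    split; first exact: ambient_comp.
    - by apply: monomial_comp => //; apply: ambient_linear Gm.
    - by move=> i /=; rewrite pK s1K.
    - by move=> i /=; rewrite s1'K pK.
  have /(finite_dimensional_cell hn)[L hL] := all _ (ambient_comp Gm Gn1).
  exists (X ++ [seq q.1 | q <- L] ++ [seq q.2 | q <- L]) => z xz zy.
  rewrite mem_cat; case: (boolP (z \in X)) => //= zX; rewrite mem_cat; have pz := pX _ zX.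
  have nzx : x1 <> z by move=> h; move: zX; rewrite -h mem_head.
  have nzy : z <> y1 by move=> h; move: zX; rewrite h /X inE mem_head orbT.
  have [yz|nyz] := pselect (R1 y1 z).
    apply/orP; left; apply/mapP; exists (z, y1) => //; apply: hL; split=> //=.
    by rewrite pz /p swapR => zx; apply: nR; exact: (R1t _ _ _ yz zx).
  apply/orP; right; apply/mapP; exists (x1, z) => //; apply: hL; split=> //=.
  by rewrite pz /p swapL.
(* The fixed index of the involution cannot be swapped with another one. If it is an endpoint, the
   interval is enlarged to one between an index and its dual, whose endpoints can be swapped. *)
have strict_cov x1 y1 : ~ R1 y1 x1 -> covered x1 y1.
  move=> nR; have nyx : y1 <> x1 by move=> h; apply: nR; rewrite h; apply: gen_rel_refl.
  have dual_case om iE x2 y2 : k = Isometry om iE -> ~ R1 y2 x2 -> iE x2 = x2 ->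
      [/\ le (iE y2) x2, nonfixed k y2, nonfixed k (iE y2) & ~ R1 y2 (iE y2)].
    move=> kE n2 fx; have dK := dualK adm kE.
    have n3 : ~ R1 x2 (iE y2).
      by move=> /(R1d _ _ _ _ kE); rewrite dK fx.
    have yx : le (iE y2) x2 by have [/leR|] := le_tot x2 (iE y2).
    have ny : iE y2 <> y2.
      by move=> fy; apply: n2; rewrite (dual_fix adm kE fx fy); apply: gen_rel_refl.
    split=> //; rewrite /nonfixed ?kE //.
      by rewrite dK => /esym.
    by move=> h; apply: n2; apply: (R1t _ _ _ h); apply: leR.
  have [nx|fx] := pselect (nonfixed k x1); have [ny|fy] := pselect (nonfixed k y1).
  - exact: swap_cov.
  - move: fy; rewrite {1}/nonfixed; case kE : k => [|om iE]; first by case.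
    move=> /contrapT fy; have dK := dualK adm kE.
    have n2 : ~ R1 (iE x1) y1 by move=> /(R1d _ _ _ _ kE); rewrite dK fy.
    have [h1 h2 h3 h4] := dual_case _ _ _ _ kE n2 fy; rewrite dK in h1 h3 h4.
    apply: (cov_sub _ _ x1 (iE x1)) => //.
      by have [/leR|] := le_tot (iE x1) y1.
    exact: swap_cov.
  - move: fx; rewrite {1}/nonfixed; case kE : k => [|om iE]; first by case.
    move=> /contrapT fx; have [h1 h2 h3 h4] := dual_case _ _ _ _ kE nR fx.
    by apply: (cov_sub _ _ (iE y1) y1) => //; apply: swap_cov.
  move: fx fy; rewrite /nonfixed; case kE : k => [|om iE]; first by case.
  by move=> /contrapT fx /contrapT fy; case: nyx; apply: (dual_fix adm kE).
have [nR|/contrapT yx] := pselect (~ R1 y x); first exact: strict_cov.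
(* Since P is proper, the preorder is not the full relation; a strict pair serves to treat intervals
   whose endpoints are equivalent for it. *)
have [a [b nba]] : exists a b, ~ R1 b a.
  apply: contrapT => no; apply: nPG; apply/seteqP; split=> // g Gg.
  apply/PP; split=> // j i _; apply: contrapT => nR; apply: no.
  by exists (s1 j), (s1 i); rewrite /R1 !s1K.
have [xy|yx'] := le_tot x y; last first.
  by exists [:: x] => z xz zy; rewrite inE; apply/eqP/le_anti => //; apply: le_trans zy yx'.
(* Depending on where x sits relative to a, the interval is contained in the one from x to b or in
   the one from a to y, and either has strictly related endpoints. *)
have [xa|nxa] := pselect (R1 x a).
  have nbx : ~ R1 b x by move=> bx; apply: nba; exact: (R1t _ _ _ bx xa).
  apply: (cov_sub _ _ x b) => //; last exact: strict_cov.
  by have [yb|//] := le_tot b y; case: nbx; exact: (R1t _ _ _ (leR _ _ yb) yx).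
have ax : le a x by have [/leR|] := le_tot x a.
apply: (cov_sub _ _ a y) => //; apply: strict_cov => ya; apply: nxa.
exact: (R1t _ _ _ (leR _ _ xy) ya).
Qed.

End Orbits.


Theorem theorem3 (K : closedFieldType) (charK : [pchar K] =i pred0)
    (V : lmodType K) (I : choiceType) (e : I -> V) (E : nat -> set I)
    (e_basis : is_basis e) (I_countable : ([set: I] #= [set: nat])%card)
    (E_filtration : is_filtration E)
    (k : group_kind V I) (k_admissible : admissible e E k)
    (P B : set (V -> V))
    (P_parabolic : splitting_parabolic e E k P)
    (B_borel : splitting_borel e E k B) :
  let G := ambient_group e k in
  let orbits := orbits_in_quotient G P B in
  [/\ conjugate_into G B P <->
        (exists2 O, orbits O & finite_dimensional_orbit e E k P O),
      conjugate_into G B P <-> (exists2 O, orbits O & exists x, O = [set x]) &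
      forall O O', orbits O -> orbits O' ->
        (exists x, O = [set x]) -> (exists x, O' = [set x]) -> O = O'] /\
  (forall le : rel I, compatible_order k le -> B = order_stabilizer e k le ->
     P <> G ->
     (conjugate_into G B P /\
      exists f : I -> int, forall i j, le i j = (f i <= f j)) <->
     (forall O, orbits O -> finite_dimensional_orbit e E k P O)).
Proof.
move=> G orbits.
have two0 : 2%:R != 0 :> K by rewrite ((pcharf0P K).1 charK 2).
have [[gP PG _] [B0 [_ _ _ _ [le0 cle0 B0E]] B0P]] := P_parabolic.
have [_ _ _ _ [le1 cle1 BE]] := B_borel.
have BP g : G g -> tri e le0 g -> P g.
  move=> Gg tg; apply: B0P; have [rl al tl _ _] := cle0; rewrite B0E.
  by apply/(order_stabilizerP e_basis).
split.
  rewrite {B_borel}BE in orbits *.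
  have exP (Q : set (set (set (V -> V)))) :
      (exists2 g, G g & Q (orbit_of e k P le1 g)) <-> (exists2 O, orbits O & Q O).
    split=> [[g Gg h]|[_ [g Gg ->] h]]; last by exists g.
    by exists (orbit_of e k P le1 g) => //; exists g.
  split.
  - rewrite (conjugate_finite_dimensional charK e_basis E_filtration
      k_admissible two0 gP PG cle0 BP cle1).
    exact: exP.
  - by rewrite (conjugate_orbit_point e_basis gP cle1); apply: exP.
  move=> _ _ [g Gg ->] [g' Gg' ->] [x gx] [x' gx'].
  exact: (orbit_points_eq e_basis k_admissible two0 gP PG cle0 BP cle1 Gg Gg' gx gx').
move=> le cle {}BE nPG; rewrite {B_borel}BE in orbits *.
have allP : (forall O, orbits O -> finite_dimensional_orbit e E k P O) <->
    forall g, G g -> finite_dimensional_orbit e E k P (orbit_of e k P le g).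
  by split=> [h g Gg|h _ [g Gg ->]]; [apply: h; exists g | apply: h].
rewrite allP; split=> [[conj [f lef]] g Gg|all].
  apply: (interval_finite_dimensional charK e_basis E_filtration k_admissible two0
    gP PG cle0 BP cle conj) => // x y.
  by have [_ al _ _ _] := cle; apply: embedded_interval_finite lef.
have conj : conjugate_into G (order_stabilizer e k le) P.
  apply/(conjugate_finite_dimensional charK e_basis E_filtration k_admissible two0
    gP PG cle0 BP cle).
  by have [/PG Gid _ _] := gP; exists id => //; apply: all.
split=> //; apply: (interval_embedding (compatible_total cle)).
exact: (finite_dimensional_interval charK e_basis E_filtration k_admissible two0
  gP PG cle0 BP cle nPG conj all).
Qed.
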